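(* Let $M$ be a positive integer and $V>0$ real, and let $\mu=\inf\{n\ge 0: N_n>M\}$, $\nu=\inf\{n\ge 0: W_n>V\}$, $\rho=\min\{\mu,\nu\}$. Let $\alpha_0,\alpha$ be complex numbers of modulus at most $1$ and $\beta_0,\beta,h_0,h$ complex numbers with nonnegative real parts. Then $$E\left[\alpha_0^{N_{\rho-1}}\alpha^{N_\rho}e^{-\beta_0W_{\rho-1}-\beta W_\rho}e^{-h_0\tau_{\rho-1}-h\tau_\rho}\right]=\mathrm D_{xy}^{-1}\left(\zeta_0^1-\Gamma_0+\frac{\gamma_0}{1-\gamma}\left(\zeta^1-\Gamma\right)\right)(M,V),$$ where, as functions of $(x,y)$ with $|x|<1$, $\mathrm{Re}(y)>0$, $\gamma=\gamma(\alpha_0\alpha x,\beta_0+\beta+y,h_0+h)$, $\gamma_0=\gamma_0(\alpha_0\alpha x,\beta_0+\beta+y,h_0+h)$, $\Gamma=\gamma(\alpha x,\beta+y,h)$, $\Gamma_0=\gamma_0(\alpha x,\beta+y,h)$, $\zeta^1=\gamma(\alpha,\beta,h)$, $\zeta_0^1=\gamma_0(\alpha,\beta,h)$.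
   Context: Attack process: attack times $t_1<t_2<\dots$ form a Poisson process of rate $\lambda>0$ on $\mathbb R_+$. At $t_k$, $n_k$ nodes are lost, with total weight $w_k=\sum_{j=1}^{n_k}w_{jk}$. The $n_k$ are iid with values in $\{1,2,\dots\}$ and PGF $g(z)=E[z^{n_1}]$; the $w_{jk}$ are iid nonnegative real with Laplace-Stieltjes transform $l(v)=E[e^{-vw_{11}}]$; attack times, $(n_k)$ and $(w_{jk})$ are independent. For Borel $T\subset\mathbb R_+$ put $\mathcal N(T)=\sum_{k:t_k\in T}n_k$, $\mathcal W(T)=\sum_{k:t_k\in T}w_k$. Observations: a delayed renewal process $\tau_0\le\tau_1\le\dots$ independent of the attack process; $\Delta_0=\tau_0\ge0$, and $\Delta_n=\tau_n-\tau_{n-1}$ ($n\ge1$) are iid nonnegative, not a.s. zero, independent of $\Delta_0$; $L_0(\theta)=E[e^{-\theta\Delta_0}]$, $L(\theta)=E[e^{-\theta\Delta_1}]$. Put $X_0=\mathcal N([0,\tau_0])$, $Y_0=\mathcal W([0,\tau_0])$, $X_n=\mathcal N((\tau_{n-1},\tau_n])$, $Y_n=\mathcal W((\tau_{n-1},\tau_n])$ for $n\ge1$, $N_n=\sum_{i=0}^nX_i$, $W_n=\sum_{i=0}^nY_i$. Conventions: $N_{-1}=W_{-1}=\tau_{-1}=0$, $0^0=1$, $\inf\emptyset=\infty$. Transforms of the increments, for $|z|\le1$, $\mathrm{Re}(v)\ge0$, $\mathrm{Re}(\theta)\ge0$: $\gamma_0(z,v,\theta)=L_0[\theta+\lambda-\lambda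 g(zl(v))]$ and $\gamma(z,v,\theta)=L[\theta+\lambda-\lambda g(zl(v))]$. Inverse operator: $\mathcal D_x^k(F)=\frac1{k!}\frac{\partial^k}{\partial x^k}\left[\frac{F(x)}{1-x}\right]_{x=0}$ for integers $k\ge0$; $\mathcal{LC}_y^{-1}(G)(q)=\mathcal L_y^{-1}\left(G(y)/y\right)(q)$, where $\mathcal L_y^{-1}$ is the inverse Laplace transform (the right-continuous function of $q\ge0$ whose Laplace transform is $G(y)/y$, $\mathrm{Re}(y)>0$); and $\mathrm D_{xy}^{-1}(F)(p,q)=\mathcal{LC}_y^{-1}\left(\mathcal D_x^p(F)\right)(q)$. *)

(* Defs.v *)
From HB Require Import structures.
From mathcomp Require Import all_boot all_order all_algebra finmap.
From mathcomp Require Import all_classical all_reals all_analysis.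
From mathcomp Require Import complex.

Set Implicit Arguments.
Unset Strict Implicit.
Unset Printing Implicit Defensive.
Import Order.TTheory GRing.Theory Num.Theory.
Import numFieldNormedType.Exports.

Local Open Scope classical_set_scope.
Local Open Scope ring_scope.
Local Open Scope complex_scope.

(* Stated over an arbitrary numFieldType K because the topology and the
   normed-module structure of R[i] are the ones every K has over itself. *)
Definition nth_derivative {K : numFieldType} (k : nat) (F : K -> K) (x : K) : K :=
  (F^`(k))%classic x.

Definition right_continuous_at {R : realType} {K : numFieldType}
    (f : R -> K) (q : R) : Prop :=
  f x @[x --> q^'+] --> f q.

Section ComplexAnalysis.
Context {R : realType}.
Implicit Types z : R[i].

Definition cexp z : R[i] :=
  (expR (complex.Re z) * cos (complex.Im z))
    +i* (expR (complex.Re z) * sin (complex.Im z)).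

Definition cintegrable d (T : measurableType d) (mu : {measure set T -> \bar R})
    (D : set T) (f : T -> R[i]) : Prop :=
  mu.-integrable D (fun x => (complex.Re (f x))%:E)
  /\ mu.-integrable D (fun x => (complex.Im (f x))%:E).

Definition cintegral d (T : measurableType d) (mu : {measure set T -> \bar R})
    (D : set T) (f : T -> R[i]) : R[i] :=
  (\int[mu]_(x in D) complex.Re (f x)) +i* (\int[mu]_(x in D) complex.Im (f x)).

Definition cexpectation d (T : measurableType d) (P : probability T R)
    (Z : T -> R[i]) : R[i] :=
  fine ('E_P[fun w => complex.Re (Z w)])%E
    +i* fine ('E_P[fun w => complex.Im (Z w)])%E.

Definition is_inverse_laplace (G : R[i] -> R[i]) (f : R -> R[i]) : Prop :=
  (forall q : R, 0 <= q -> right_continuous_at f q) /\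
  (forall y : R[i], 0 < complex.Re y ->
     let h := fun s : R => cexp (- (y * s%:C)) * f s in
     cintegrable (@lebesgue_measure R) `[0, +oo[ h
     /\ cintegral (@lebesgue_measure R) `[0, +oo[ h = G y).

(* Two functions satisfying [is_inverse_laplace G] agree on [0, +oo[ (Lerch),
   so the values at q >= 0 do not depend on the choice; the default is 0. *)
Definition inverse_laplace (G : R[i] -> R[i]) : R -> R[i] :=
  xget (fun=> 0) [set f | is_inverse_laplace G f].

Definition LCinv (G : R[i] -> R[i]) (q : R) : R[i] :=
  inverse_laplace (fun y => G y / y) q.

Definition Dop (k : nat) (F : R[i] -> R[i]) : R[i] :=
  (k`!%:R)^-1 * nth_derivative k (fun x => F x / (1 - x)) 0.

Definition Dinv (F : R[i] -> R[i] -> R[i]) (p : nat) (q : R) : R[i] :=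
  LCinv (fun y => Dop p (fun x => F x y)) q.

End ComplexAnalysis.

Section Independence.
Context d {T : measurableType d} {R : realType} (P : probability T R).

Definition sigma_of {I : Type} d' {T' : measurableType d'} (X : I -> T -> T') :
    set (set T) :=
  <<s \bigcup_i preimage_set_system setT (X i) measurable >>.

Definition mutually_independent {I : choiceType} (F : I -> set (set T)) : Prop :=
  forall (J : {fset I}) (A : I -> set T),
    (forall i, i \in J -> F i (A i)) ->
    P (\bigcap_(i in [set` J]) A i) = (\prod_(i <- J) P (A i))%E.

Definition independent (F G : set (set T)) : Prop :=
  forall A B, F A -> G B -> P (A `&` B) = (P A * P B)%E.

Definition iid {I : choiceType} d' {T' : measurableType d'}
    (X : I -> {RV P >-> T'}) : Prop :=
  mutually_independent (fun i => preimage_set_system setT (X i) measurable)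
  /\ forall i j A, measurable A -> distribution P (X i) A = distribution P (X j) A.

End Independence.

Section Model.
Context d {T : measurableType d} {R : realType} (P : probability T R).

(* The k-th point is [t k], k >= 0. The numbers of points in disjoint Borel sets
   are independent, and the number of points in A is Poisson with parameter
   lam * |A|. The library's [poisson_pmf] is 1 at parameter 0, hence the use of
   [poisson_prob], which is the Dirac mass at 0 there. The second argument of
   [poisson_prob] is a dummy. *)
Record poisson_process (lam : R) (t : nat -> {RV P >-> R}) : Prop := {
  poisson_process_ge0 : forall w, 0 <= t 0%N w ;
  poisson_process_lt : forall k w, t k w < t k.+1 w ;
  poisson_process_law : forall (m : nat) (A : 'I_m -> set R) (c : 'I_m -> nat),
    (forall i, measurable (A i)) ->
    (forall i, A i `<=` `[0, +oo[) ->
    (forall i, (lebesgue_measure (A i) < +oo)%E) ->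
    trivIset setT A ->
    P [set w | forall i, ([set k | A i (t k w)] #= `I_(c i))%card]
    = (\prod_(i < m)
        poisson_prob (lam * fine (lebesgue_measure (A i))) (c i) [set c i])%E }.

(* Sums over a set of indices are finitely supported sums, equal to 0 when
   infinitely many terms are nonzero. They are only used for bounded S, which
   almost surely contains finitely many attack times. *)
Definition lost_nodes (t : nat -> {RV P >-> R}) (n : nat -> {RV P >-> nat})
    (S : set R) (w : T) : nat :=
  \big[addn/0%N]_(k \in [set k | S (t k w)]) n k w.

(* [wt j k] is the weight of the (j+1)-st node lost in attack k *)
Definition lost_weight (t : nat -> {RV P >-> R}) (n : nat -> {RV P >-> nat})
    (wt : nat -> nat -> {RV P >-> R}) (S : set R) (w : T) : R :=
  \sum_(k \in [set k | S (t k w)]) \sum_(j < n k w) wt j k w.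

Definition obs_time (Delta : nat -> {RV P >-> R}) (n : nat) (w : T) : R :=
  \sum_(i < n.+1) Delta i w.

Definition obs_window (Delta : nat -> {RV P >-> R}) (n : nat) (w : T) : set R :=
  if n is m.+1 then `]obs_time Delta m w, obs_time Delta m.+1 w]
  else `[0, obs_time Delta 0 w].

Definition cum_nodes t n Delta (m : nat) (w : T) : nat :=
  (\sum_(i < m.+1) lost_nodes t n (obs_window Delta i w) w)%N.

Definition cum_weight t n wt Delta (m : nat) (w : T) : R :=
  \sum_(i < m.+1) lost_weight t n wt (obs_window Delta i w) w.

(* the term of index m - 1, with the convention that the term of index -1 is 0 *)
Definition before {V : nmodType} (u : nat -> T -> V) (m : nat) (w : T) : V :=
  if m is m'.+1 then u m' w else 0.

(* infimum of a set of indices in [0, +oo], with inf set0 = +oo *)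
Definition inf_index (Q : set nat) : \bar R := ereal_inf [set m%:R%:E | m in Q].

(* [u] at the index [r], and 0 when the index is infinite *)
Definition at_index (r : \bar R) (u : nat -> R[i]) : R[i] :=
  if r is x%:E then u (Num.truncn x) else 0.

Definition pgf (n : {RV P >-> nat}) (z : R[i]) : R[i] :=
  cexpectation P (fun w => z ^+ n w).

Definition lst (X : {RV P >-> R}) (v : R[i]) : R[i] :=
  cexpectation P (fun w => cexp (- (v * (X w)%:C))).

Definition increment_transform (lam : R) (n : {RV P >-> nat})
    (wt X : {RV P >-> R}) (z v theta : R[i]) : R[i] :=
  lst X (theta + lam%:C - lam%:C * pgf n (z * lst wt v)).

End Model.

(* Main.v *)
(* Let p and s play the roles of M and V. As N and W are nondecreasing in m, the event
   {rho = m} is the difference of {N_{m-1} <= p, W_{m-1} <= s} and {N_m <= p, W_m <= s}, so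
   the left-hand side is a telescoping series in m, the m-th term of the expectation being
   cut off by these two events. Applying sum_p x^p and y int_0^oo e^{-ys} ds turns
   the cut-offs into x^N e^{-yW} / (1 - x), and by independence the m-th term becomes
   gamma_0 gamma^{m-1} (zeta - Gamma), whence the geometric series. For |x| <= 1/2 one has
   |gamma| <= r := E[e^{-lambda Delta_1 / 2}] < 1, which also gives P(N_m <= p) <= 2^p r^m and makes
   the truncation errors uniform in s. The two inverse operators are then undone by
   uniqueness of power series coefficients and Lerch's theorem, the latter by means of the
   kernels (1 - e^{-ans})^{2^n}, which tend to an indicator function and are finite
   combinations of exponentials. *)

From HB Require Import structures.
Require Import Defs.
From mathcomp Require Import all_boot all_order all_algebra finmap.
From mathcomp Require Import all_classical all_reals all_analysis.
From mathcomp Require Import complex.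
From mathcomp Require Import measurable_realfun ring lra.

Set Implicit Arguments.
Unset Strict Implicit.
Unset Printing Implicit Defensive.
Import Order.TTheory GRing.Theory Num.Theory.
Import numFieldNormedType.Exports.

Local Open Scope classical_set_scope.
Local Open Scope ring_scope.
Local Open Scope complex_scope.

(** * Complex numbers and limits *)

(** Three obstacles shape the details. Independence is assumed for generated sigma-algebras, whereas
    averaging proceeds by freezing variables: the sample space is therefore re-equipped with each
    generated sigma-algebra and its identity map is treated as a random element, which turns every
    conditioning step into Fubini for a product of laws. The order of freezing is observation times,
    then attack times, then numbers of nodes. Secondly, lost nodes and weights are finitely
    supported sums without evident measurability; they are exchanged for regular versions off a null
    set, by an equality of integrals that asks no measurability of the integrands. Thirdly, [Dop] is
    an iterated derivative and [inverse_laplace] a function selected by choice, so both have to be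
    pinned down: the former by a power series with bounded coefficients, the latter by exhibiting a
    right-continuous function with the correct transform. Truncation in $m$ costs $2^p r^m$ in the
    coefficient of $x^p$, which is summable against $|x|^p$ only for $|x|<1/2$; the radius $1/4$
    leaves the ratio $1/2$, and any disc determines the derivatives at 0. *)

Notation normc := Normc.normc.

Section ComplexBasics.
Context {R : realType}.
Implicit Types (z w : R[i]) (x : R).

Lemma ReM z w : complex.Re (z * w)
  = complex.Re z * complex.Re w - complex.Im z * complex.Im w.
Proof. by case: z w => [a b] [c d]. Qed.

Lemma ImM z w : complex.Im (z * w)
  = complex.Re z * complex.Im w + complex.Im z * complex.Re w.
Proof. by case: z w => [a b] [c d]. Qed.

Lemma ReD z w : complex.Re (z + w) = complex.Re z + complex.Re w.
Proof. by case: z w => [a b] [c d]. Qed.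

Lemma ImD z w : complex.Im (z + w) = complex.Im z + complex.Im w.
Proof. by case: z w => [a b] [c d]. Qed.

Lemma ReN z : complex.Re (- z) = - complex.Re z.
Proof. by case: z. Qed.

Lemma ImN z : complex.Im (- z) = - complex.Im z.
Proof. by case: z. Qed.

Definition ReImE := (ReD, ImD, ReN, ImN, ReM, ImM).

Lemma complex_ext z w : complex.Re z = complex.Re w ->
  complex.Im z = complex.Im w -> z = w.
Proof. by case: z w => [a b] [c d] /= -> ->. Qed.

Lemma normCE z : `|z| = (normc z)%:C.
Proof. by case: z. Qed.

Lemma normc_ge0 z : 0 <= normc z.
Proof. by case: z => a b; rewrite sqrtr_ge0. Qed.

Lemma normc_Re z : `|complex.Re z| <= normc z.
Proof. by rewrite -lecR -normCE; exact: normc_ge_Re. Qed.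

Lemma normc_Im z : `|complex.Im z| <= normc z.
Proof.
case: z => a b /=; rewrite -sqrtr_sqr ler_sqrt ?addr_ge0 ?sqr_ge0//.
by rewrite lerDr sqr_ge0.
Qed.

Lemma normc_real x : normc x%:C = `|x|.
Proof. by rewrite /= expr0n/= addr0 sqrtr_sqr. Qed.

Lemma normc_le z : normc z <= `|complex.Re z| + `|complex.Im z|.
Proof.
case: z => a b; rewrite -(normc_real a) (_ : normc (_ +i* _) = normc (a%:C + 0 +i* b)).
  apply: (le_trans (le_normcD _ _)); rewrite lerD2l.
  by rewrite /= expr0n/= add0r sqrtr_sqr.
by congr normc; apply: complex_ext => /=; rewrite ?addr0 ?add0r.
Qed.

Lemma normc0' : normc (0 : R[i]) = 0. Proof. exact: Normc.normc0. Qed.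
Lemma normc1' : normc (1 : R[i]) = 1. Proof. exact: Normc.normc1. Qed.

Lemma normcX z n : normc (z ^+ n) = normc z ^+ n.
Proof.
by elim: n => [|n ih]; rewrite ?expr0 ?normc1'// !exprS Normc.normcM ih.
Qed.

Lemma normc_sub z w : normc (z - w) = normc (w - z).
Proof. by rewrite -[LHS]normcN opprB. Qed.

Lemma normc_sum (I : Type) (r : seq I) (P : pred I) (F : I -> R[i]) :
  normc (\sum_(i <- r | P i) F i) <= \sum_(i <- r | P i) normc (F i).
Proof.
elim/big_ind2: _ => // [|z a w b za wb]; first by rewrite normc0'.
by apply: (le_trans (le_normcD _ _)); exact: lerD.
Qed.

Lemma normc_prod (I : Type) (r : seq I) (P : pred I) (F : I -> R[i]) :
  normc (\prod_(i <- r | P i) F i) = \prod_(i <- r | P i) normc (F i).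
Proof.
by elim/big_ind2: _ => // [|z a w b <- <-]; rewrite ?normc1'// Normc.normcM.
Qed.

Lemma normc_eq0 z : (normc z == 0) = (z == 0).
Proof.
apply/eqP/eqP => [|->]; [exact: Normc.eq0_normc|exact: normc0'].
Qed.

Lemma normc_le1 z : (`|z| <= 1) = (normc z <= 1).
Proof. by rewrite normCE -lecR. Qed.

Lemma realcX x n : (x ^+ n)%:C = x%:C ^+ n :> R[i].
Proof. exact: rmorphXn. Qed.

Lemma cexp0 : cexp (0 : R[i]) = 1.
Proof. by rewrite /cexp /= expR0 cos0 sin0 mulr0 mul1r. Qed.

Lemma cexpD z w : cexp (z + w) = cexp z * cexp w.
Proof.
apply: complex_ext; rewrite ?ReImE /cexp/= !ReImE expRD ?cosD ?sinD; ring.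
Qed.

Lemma cexp_sum (I : Type) (r : seq I) (P : pred I) (F : I -> R[i]) :
  cexp (\sum_(i <- r | P i) F i) = \prod_(i <- r | P i) cexp (F i).
Proof. by elim/big_ind2: _ => // [|z a w b <- <-]; rewrite ?cexp0 ?cexpD. Qed.

Lemma cexp_real x : cexp x%:C = (expR x)%:C.
Proof. by rewrite /cexp /= cos0 sin0 mulr0 mulr1. Qed.

Lemma normc_cexp z : normc (cexp z) = expR (complex.Re z).
Proof.
rewrite /cexp /normc !exprMn -mulrDr cos2Dsin2 mulr1 sqrtr_sqr.
by apply: ger0_norm; exact: expR_ge0.
Qed.

Lemma normc_cexp_le1 z : complex.Re z <= 0 -> normc (cexp z) <= 1.
Proof. by rewrite normc_cexp -expR0 ler_expR. Qed.

End ComplexBasics.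

Lemma cvg_dist0 {R : realType} (T : Type) (F : set_system T) {FF : Filter F}
  (f : T -> R) (l : R) : f @ F --> l -> (fun x => `|f x - l|) @ F --> (0 : R).
Proof.
move=> fl; have /cvg_norm : (fun x => f x - l) @ F --> l - l.
  by apply: cvgB => //; exact: cvg_cst.
by rewrite subrr normr0.
Qed.

Section ComplexLimits.
Context {R : realType}.
Implicit Types (u v : nat -> R[i]) (l m : R[i]).

(** Stated through the real sequence of distances, so that squeezing and the real series tests apply
    directly. *)
Definition clim u l := (fun n => normc (u n - l)) @ \oo --> (0 : R).

Lemma clim_bound u l (e : nat -> R) : e @ \oo --> (0 : R) ->
  (forall n, normc (u n - l) <= e n) -> clim u l.
Proof.
move=> e0 ue; apply: (@squeeze_cvgr _ _ _ _ (fun=> 0) e) => //; last exact: cvg_cst.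
by apply: nearW => n; rewrite normc_ge0 ue.
Qed.

Lemma clim_bound_near u l (e : nat -> R) : e @ \oo --> (0 : R) ->
  (\forall n \near \oo, normc (u n - l) <= e n) -> clim u l.
Proof.
move=> e0 ue; apply: (@squeeze_cvgr _ _ _ _ (fun=> 0) e) => //; last exact: cvg_cst.
by apply: filterS ue => n; rewrite normc_ge0.
Qed.

Lemma clim_cst l : clim (fun=> l) l.
Proof.
rewrite /clim; under eq_fun do rewrite subrr normc0'; exact: cvg_cst.
Qed.

Lemma climD u v l m : clim u l -> clim v m -> clim (fun n => u n + v n) (l + m).
Proof.
move=> ul vm; apply: (@clim_bound _ _ (fun n => normc (u n - l) + normc (v n - m))).
  by rewrite -[X in _ --> X](addr0 0); exact: cvgD.
by move=> n; rewrite opprD addrACA; exact: le_normcD.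
Qed.

Lemma climZ a u l : clim u l -> clim (fun n => a * u n) (a * l).
Proof.
move=> ul; apply: (@clim_bound _ _ (fun n => normc a * normc (u n - l))).
  by rewrite -[X in _ --> X](mulr0 (normc a)); apply: cvgM => //; exact: cvg_cst.
by move=> n; rewrite -mulrBr Normc.normcM.
Qed.

Lemma climB u v l m : clim u l -> clim v m -> clim (fun n => u n - v n) (l - m).
Proof.
move=> ul vm; rewrite -[- m]mulN1r.
under eq_fun do rewrite -[X in _ + X]mulN1r; exact/climD/climZ.
Qed.

Lemma climM u v l m : clim u l -> clim v m -> clim (fun n => u n * v n) (l * m).
Proof.
move=> ul vm.
apply: (@clim_bound _ _ (fun n => normc (u n - l) * normc (v n - m)
   + normc l * normc (v n - m) + normc m * normc (u n - l))).
  rewrite (_ : 0 = 0 * 0 + normc l * 0 + normc m * 0); last by rewrite !mulr0 !addr0.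
  by apply: cvgD; [apply: cvgD; apply: cvgM => //; exact: cvg_cst
                  |apply: cvgM => //; exact: cvg_cst].
move=> n; rewrite -!Normc.normcM.
rewrite (_ : _ - _ = (u n - l) * (v n - m) + l * (v n - m) + m * (u n - l)); last ring.
by apply: (le_trans (le_normcD _ _)); rewrite lerD2r; exact: le_normcD.
Qed.

Lemma clim_unique u l m : clim u l -> clim u m -> l = m.
Proof.
move=> ul um; have := climB ul um; rewrite /clim.
under eq_fun do rewrite subrr sub0r normcN.
move=> /cvg_lim; rewrite lim_cst// => /(_ (@norm_hausdorff _ _)) /eqP.
by rewrite normc_eq0 subr_eq0 => /eqP.
Qed.

Lemma clim_normc_le u l (c : R) : clim u l -> (forall n, normc (u n) <= c) ->
  normc l <= c.
Proof.
move=> ul uc; have h : (fun n => normc (u n - l) + c) @ \oo --> 0 + c.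
  by apply: cvgD => //; exact: cvg_cst.
rewrite add0r in h; rewrite -(cvg_lim (@norm_hausdorff _ _) h); apply: limr_ge; first by apply/cvg_ex; exists c.
apply: nearW => n; rewrite normc_sub -[X in normc X](subrK (u n)).
by apply: (le_trans (le_normcD _ _)); exact: lerD.
Qed.

Lemma eq_clim u v l : u =1 v -> clim u l -> clim v l.
Proof. by move=> /funext ->. Qed.

Lemma clim_Re u l : clim u l -> (fun n => complex.Re (u n)) @ \oo --> complex.Re l.
Proof.
move=> ul; apply/cvgrPdist_le => e e0.
move/cvgrPdist_le : ul => /(_ e e0); apply: filterS => n.
rewrite sub0r normrN ger0_norm ?normc_ge0//; apply: le_trans.
by rewrite -ReN -ReD normc_sub; exact: normc_Re.
Qed.

Lemma clim_Im u l : clim u l -> (fun n => complex.Im (u n)) @ \oo --> complex.Im l.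
Proof.
move=> ul; apply/cvgrPdist_le => e e0.
move/cvgrPdist_le : ul => /(_ e e0); apply: filterS => n.
rewrite sub0r normrN ger0_norm ?normc_ge0//; apply: le_trans.
by rewrite -ImN -ImD normc_sub; exact: normc_Im.
Qed.

Lemma climP u l : (fun n => complex.Re (u n)) @ \oo --> complex.Re l ->
  (fun n => complex.Im (u n)) @ \oo --> complex.Im l -> clim u l.
Proof.
move=> hr hi; apply: (@clim_bound _ _ (fun n => `|complex.Re (u n) - complex.Re l|
  + `|complex.Im (u n) - complex.Im l|)).
  by rewrite -[X in _ --> X](addr0 0); apply: cvgD; exact: cvg_dist0.
by move=> n; rewrite -!ReN -!ImN -ReD -ImD; exact: normc_le.
Qed.

(** Real and imaginary parts are each dominated by [b], hence converge absolutely as real series. *)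
Lemma clim_series u (b : nat -> R) : (forall k, normc (u k) <= b k) ->
  cvgn (series b) -> exists l, clim (fun n => \sum_(k < n) u k) l.
Proof.
move=> ub cb.
have aux (f : R[i] -> R) : (forall z, `|f z| <= normc z) ->
    cvgn (series (fun k => f (u k))).
  move=> fn; apply: normed_cvg; apply: (series_le_cvg _ _ _ cb) => k //.
  - exact: normr_ge0.
  - by apply: le_trans (ub k); exact: normc_ge0.
  - exact: le_trans (fn _) (ub k).
have /cvg_ex[/= a ha] := aux _ normc_Re.
have /cvg_ex[/= c hc] := aux _ normc_Im.
exists (a +i* c); apply: climP => /=.
  apply: cvg_trans ha; apply: near_eq_cvg; apply: nearW => n.
  rewrite /series/= big_mkord; elim/big_ind2 : _ => // x1 x2 y1 y2 -> ->.
  by rewrite ReD.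
apply: cvg_trans hc; apply: near_eq_cvg; apply: nearW => n.
rewrite /series/= big_mkord; elim/big_ind2 : _ => // x1 x2 y1 y2 -> ->.
by rewrite ImD.
Qed.

End ComplexLimits.

(** * Power series *)

Section Derivatives.
Context {K : numFieldType}.
Implicit Types (f g : K -> K) (x l C e : K).

(** Dividing the quadratic remainder by $h$ leaves an error of at most $C|h|$. The derivative is
    thus obtained from an inequality alone, which is how power series are differentiated below. *)
Lemma derive1_quadratic f x l C e : 0 < e -> 0 <= C ->
  (forall h, `|h| < e -> `|f (h + x) - f x - h * l| <= C * `|h| ^+ 2) ->
  (f^`())%classic x = l.
Proof.
move=> e0 C0 fq; apply: cvg_lim; first exact: norm_hausdorff.
apply/cvgrPdist_lt => eps eps0; near=> h.
have h0 : h != 0 by near: h; exact: nbhs_dnbhs_neq.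
have hn : 0 < `|h| by rewrite normr_gt0.
rewrite -[l](mulKf h0) -[_ *: _]/(_ * _) -mulrBr normrM normfV mulrC.
rewrite ltr_pdivrMr// distrC (le_lt_trans (fq h _))//.
  by near: h; exact: dnbhs0_lt.
rewrite expr2 mulrA ltr_pM2r//.
apply: (@le_lt_trans _ _ ((C + 1) * `|h|)).
  by rewrite ler_pM2r// lerDl.
rewrite mulrC -ltr_pdivlMr ?ltr_wpDl//; near: h; apply: dnbhs0_lt.
by rewrite divr_gt0// ltr_wpDl.
Unshelve. all: by end_near. Qed.

Lemma eq_near_derive1 f g x e : 0 < e -> (forall y, `|y - x| < e -> f y = g y) ->
  (f^`())%classic x = (g^`())%classic x.
Proof.
move=> e0 fg; rewrite !derive1E; apply: near_eq_derive.
apply/nbhs_normP; exists e => //= y yx; apply: fg.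
by rewrite distrC.
Qed.

(* [F k] only has to be differentiable on a ball that may shrink with [k]:
   the k-th derivative at 0 depends on germs only. *)
Lemma derive1n_family (F : nat -> K -> K) (e : nat -> K) (f : K -> K) :
  (forall k, 0 < e k) -> (forall k, e k.+1 <= e k) ->
  (forall x, `|x| < e 0%N -> f x = F 0%N x) ->
  (forall k x, `|x| < e k.+1 -> ((F k)^`())%classic x = F k.+1 x) ->
  forall k x, `|x| < e k -> (f^`(k))%classic x = F k x.
Proof.
move=> e0 edecr f0 FF; elim => [|k ih] x xe; first exact: f0.
rewrite derive1nS -(FF k x xe); apply: (@eq_near_derive1 _ _ _ (e k - `|x|)).
  by rewrite subr_gt0 (lt_le_trans xe).
move=> y; rewrite ltrBrDr => yx; apply: ih.
by apply: le_lt_trans yx; rewrite -{1}(subrK x y); exact: ler_normD.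
Qed.

End Derivatives.

Section PowerSeries.
Context {R : realType}.
Implicit Types (a : nat -> R[i]) (x h : R[i]) (A b r : R).

(** A limit selected by choice, equal to 0 where none exists; [psum_cvg] guarantees convergence for
    $b|x|\le 1/2$ when $|a_k|\le A b^k$. *)
Definition psum a x : R[i] :=
  xget 0 [set l | clim (fun n => \sum_(k < n) a k * x ^+ k) l].

Definition pdiff a k : R[i] := k.+1%:R * a k.+1.

Lemma normc_nat n : normc (n%:R : R[i]) = n%:R.
Proof. by rewrite -(rmorph_nat (real_complex R)) normc_real normr_nat. Qed.

Lemma is_cvg_half_geometric A : cvgn (series (fun k => A * 2^-1 ^+ k : R)).
Proof. by apply: is_cvg_geometric_series; rewrite ger0_norm ?invr_ge0// invf_lt1 ?ltr1n. Qed.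

Lemma psum_cvg a A b x : (forall k, normc (a k) <= A * b ^+ k) ->
  0 <= b -> b * normc x <= 2^-1 -> clim (fun n => \sum_(k < n) a k * x ^+ k) (psum a x).
Proof.
move=> ab b0 bx; apply: (@xgetPex _ 0 [set l | clim (fun n => \sum_(k < n) a k * x ^+ k) l]).
apply: (@clim_series _ (fun k => a k * x ^+ k) (fun k => A * 2^-1 ^+ k)) => [k|].
  rewrite Normc.normcM normcX (le_trans (ler_wpM2r _ (ab k))) ?exprn_ge0 ?normc_ge0//.
  have A0 : 0 <= A by have := le_trans (normc_ge0 _) (ab 0%N); rewrite expr0 mulr1.
  rewrite -mulrA -exprMn ler_wpM2l// lerXn2r ?nnegrE ?mulr_ge0 ?normc_ge0//.
exact: is_cvg_half_geometric.
Qed.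

Lemma psum0 a : psum a 0 = a 0%N.
Proof.
apply: (@clim_unique _ (fun n => \sum_(k < n) a k * 0 ^+ k)).
  apply: (@xgetPex _ 0 [set l | clim (fun n => \sum_(k < n) a k * 0 ^+ k) l]).
  exists (a 0%N); apply: (@clim_bound_near _ _ _ (fun=> 0)); first exact: cvg_cst.
  exists 1%N => // -[//|n] _ /=; rewrite big_ord_recl/= expr0 mulr1 big1 ?addr0 ?subrr ?normc0'//.
  by move=> i _; rewrite /bump/= add1n expr0n mulr0.
apply: (@clim_bound_near _ _ _ (fun=> 0)); first exact: cvg_cst.
exists 1%N => // -[//|n] _ /=; rewrite big_ord_recl/= expr0 mulr1 big1 ?addr0 ?subrr ?normc0'//.
by move=> i _; rewrite /bump/= add1n expr0n mulr0.
Qed.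

(** Induction on $p$: the remainder $E_p$ satisfies $E_{p+1}=(h+x)E_p+p\,h^2x^{p-1}$. Each step
    produces two contributions of size at most $4^p r^{p+1}|h|^2/r^2$, the second because $p\le
    4^p$, and the factor 4 gained per step has room for both. *)
Lemma quad_pow x h r p : 0 < r -> normc x <= r -> normc (h + x) <= r ->
  normc ((h + x) ^+ p - x ^+ p - p%:R * h * x ^+ p.-1)
  <= normc h ^+ 2 / r ^+ 2 * (4 * r) ^+ p.
Proof.
move=> r0 xr hxr; elim: p => [|p ih].
  by rewrite !expr0 mul0r mul0r subrr subr0 normc0' mulr1 divr_ge0 ?exprn_ge0 ?normc_ge0 ?ltW.
have -> : (h + x) ^+ p.+1 - x ^+ p.+1 - p.+1%:R * h * x ^+ p.+1.-1 =
    (h + x) * ((h + x) ^+ p - x ^+ p - p%:R * h * x ^+ p.-1) + p%:R * h ^+ 2 * x ^+ p.-1.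
  case: p {ih} => [|p] /=; first by rewrite !expr0 !expr1; ring.
  by rewrite !exprS -[p.+2]addn1 natrD; ring.
apply: (le_trans (le_normcD _ _)); rewrite !Normc.normcM !normcX normc_nat.
set H := normc h ^+ 2 in ih *.
have H0 : 0 <= H / r ^+ 2 by rewrite divr_ge0 ?exprn_ge0 ?normc_ge0 ?ltW.
apply: (@le_trans _ _ (r * (H / r ^+ 2 * (4 * r) ^+ p) + H / r ^+ 2 * 4 ^+ p * r ^+ p.+1)).
  apply: lerD; first by apply: ler_pM => //; exact: normc_ge0.
  case: p {ih} => [|p]; first by rewrite !mul0r mulr1 expr1 mulr_ge0// ltW.
  rewrite /= (_ : H / r ^+ 2 * 4 ^+ p.+1 * r ^+ p.+2 = 4 ^+ p.+1 * H * r ^+ p).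
    apply: ler_pM; rewrite ?mulr_ge0 ?exprn_ge0 ?normc_ge0//.
      rewrite -expr2 -/H ler_wpM2r ?exprn_ge0 ?normc_ge0// -natrX ler_nat ltnW//.
      by rewrite (leq_trans (ltn_expl p.+1 (isT : 1 < 2)%N))// leq_exp2r.
    by rewrite lerXn2r ?nnegrE ?normc_ge0// ltW.
  by rewrite !exprS; field; rewrite gt_eqF.
set u := H / _ in H0 *; rewrite !exprMn !exprS; set v := 4 ^+ p; set w := r ^+ p.
have r0' := ltW r0.
have [v0 w0] : 0 <= v /\ 0 <= w by rewrite !exprn_ge0.
clearbody u v w.
have uvw : 0 <= u * v * w * r by rewrite !mulr_ge0.
rewrite -subr_ge0 (_ : _ - _ = 2 * (u * v * w * r)) ?mulr_ge0//.
by ring.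
Qed.

(** The factor $k+1\le 2^k$ is absorbed by doubling the geometric ratio; this is why the discs below
    shrink with every differentiation. *)
Lemma pdiff_bound a A b : 0 <= A -> 0 <= b -> (forall k, normc (a k) <= A * b ^+ k) ->
  forall k, normc (pdiff a k) <= A * b * (2 * b) ^+ k.
Proof.
move=> A0 b0 ab k; rewrite /pdiff Normc.normcM normc_nat.
rewrite (le_trans (ler_wpM2l _ (ab _)))// exprS exprMn.
rewrite (_ : A * b * _ = 2 ^+ k * (A * (b * b ^+ k))); last ring.
by rewrite ler_wpM2r ?mulr_ge0 ?exprn_ge0// -natrX ler_nat ltn_expl.
Qed.

(** The radius $r=1/(8b)$ gives $b\cdot 4r=1/2$, so the remainders bounded by [quad_pow] form a
    geometric series of ratio $1/2$, whence the factor 2. *)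
Lemma psum_quadratic a A b r x h : (forall k, normc (a k) <= A * b ^+ k) ->
  0 < b -> r = (8 * b)^-1 -> normc x <= r -> normc (h + x) <= r ->
  normc (psum a (h + x) - psum a x - h * psum (pdiff a) x)
  <= 2 * A / r ^+ 2 * normc h ^+ 2.
Proof.
move=> ab b0 rE xr hxr.
have A0 : 0 <= A by have := le_trans (normc_ge0 _) (ab 0%N); rewrite expr0 mulr1.
have r0 : 0 < r by rewrite rE invr_gt0 mulr_gt0.
have br : b * r = 8^-1 by rewrite rE; field; rewrite gt_eqF.
have b8 y : normc y <= r -> b * normc y <= 8^-1 by move=> yr; rewrite -br ler_wpM2l// ltW.
have h8 : (8^-1 : R) <= 2^-1 by rewrite lef_pV2 ?posrE// ler_nat.
have c1 := psum_cvg ab (ltW b0) (le_trans (b8 _ hxr) h8).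
have c2 := psum_cvg ab (ltW b0) (le_trans (b8 _ xr) h8).
have c3 : clim (fun n => \sum_(k < n) pdiff a k * x ^+ k) (psum (pdiff a) x).
  apply: (psum_cvg (pdiff_bound A0 (ltW b0) ab)); first by rewrite mulr_ge0// ltW.
  by have := b8 _ xr; lra.
(* Formal differentiation lowers the index by one, so $n$ terms of the derived series are matched
   with $n+1$ terms of the original one. *)
have shift (u : nat -> R[i]) l : clim u l -> clim (fun n => u n.+1) l.
  by move=> ul; rewrite /clim; rewrite (cvg_shiftS (fun n => normc (u n - l))).
apply: (clim_normc_le (climB (climB (shift _ _ c1) (shift _ _ c2)) (climZ h c3))) => n.
rewrite (_ : _ - _ = \sum_(k < n.+1) a k * ((h + x) ^+ k - x ^+ k - k%:R * h * x ^+ k.-1)); last first.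
  under [RHS]eq_bigr do rewrite mulrBr mulrBr.
  rewrite !sumrB; congr (_ - _); rewrite [RHS]big_ord_recl/= mul0r mul0r mulr0 add0r mulr_sumr.
  by apply: eq_bigr => i _; rewrite /bump/= add1n /pdiff; ring.
apply: (le_trans (normc_sum _ _ _)).
apply: (@le_trans _ _ (\sum_(k < n.+1) normc h ^+ 2 / r ^+ 2 * A * 2^-1 ^+ k)).
  apply: ler_sum => k _; rewrite Normc.normcM.
  apply: (le_trans (ler_pM (normc_ge0 _) (normc_ge0 _) (ab k) (quad_pow k r0 xr hxr))).
  rewrite mulrCA !mulrA -[leLHS]mulrA -exprMn mulrCA br.
  by rewrite (_ : 4 / 8 = 2^-1) ?[A * _]mulrC -?mulrA; [rewrite mulrA mulrA mulrAC -mulrA -!mulrA|field].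
rewrite -mulr_sumr.
have -> : \sum_(k < n.+1) (2^-1 : R) ^+ k = 2 * (1 - 2^-1 ^+ n.+1).
  have := subrX1 (2^-1 : R) n.+1; lra.
have : 0 <= (2^-1 : R) ^+ n.+1 by rewrite exprn_ge0// invr_ge0.
set t := _ ^+ n.+1 => t0.
rewrite (_ : 2 * A / r ^+ 2 * normc h ^+ 2 = normc h ^+ 2 / r ^+ 2 * A * 2); last ring.
apply: ler_wpM2l; last lra.
by rewrite !mulr_ge0 ?invr_ge0 ?exprn_ge0 ?normc_ge0// ltW.
Qed.

Lemma iter_pdiff0 a k j : iter k pdiff a j = ((j + k)`! %/ j`!)%:R * a (j + k)%N.
Proof.
elim: k a j => [|k ih] a j; first by rewrite addn0 divnn fact_gt0 mul1r.
rewrite iterSr ih /pdiff mulrA addnS -natrM; congr (_ * _); congr (_%:R).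
rewrite factS divn_mulAC 1?mulnC//.
by rewrite -(bin_fact (leq_addr k j)) mulnCA dvdn_mulr.
Qed.

(** The $j$-th derivative of $F(x)/(1-x)$ agrees with the sum of the $j$ times formally
    differentiated series on a disc whose radius at most halves from one $j$ to the next. At 0 that
    sum is $k!\,a_k$, and the factorial cancels the one in [Dop]. *)
Lemma Dop_series k (F : R[i] -> R[i]) a A b e : 0 < e -> 0 < b ->
  (forall k, normc (a k) <= A * b ^+ k) ->
  (forall x, normc x < e -> clim (fun n => \sum_(k < n) a k * x ^+ k) (F x / (1 - x))) ->
  Dop k F = a k.
Proof.
move=> e0 b0 ab Fa.
have A0 : 0 <= A by have := le_trans (normc_ge0 _) (ab 0%N); rewrite expr0 mulr1.
have bound j : exists A' : R, forall k, normc (iter j pdiff a k) <= A' * (2 ^+ j * b) ^+ k.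
  elim: j => [|j [A' ih]]; first by exists A => k'; rewrite expr0 mul1r.
  exists (A' * (2 ^+ j * b)) => k'.
  rewrite (_ : 2 ^+ j.+1 * b = 2 * (2 ^+ j * b)); last by rewrite exprS mulrA.
  apply: (@pdiff_bound (iter j pdiff a)) => //.
    by have := le_trans (normc_ge0 _) (ih 0%N); rewrite expr0 mulr1.
  by rewrite mulr_ge0 ?exprn_ge0// ltW.
pose rad j := (8 * (2 ^+ j * b))^-1 : R.
have rad0 j : 0 < rad j by rewrite invr_gt0 !mulr_gt0 ?exprn_gt0.
have radS j : rad j.+1 <= rad j.
  rewrite lef_pV2 ?posrE ?mulr_gt0 ?exprn_gt0// ler_wpM2l// ler_wpM2r ?(ltW b0)//.
  by rewrite ler_weXn2l ?ler1n.
pose ee j : R[i] := (Num.min e (rad j))%:C.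
have ee0 j : 0 < ee j by rewrite (ltcR 0) lt_min e0 rad0.
rewrite /Dop /nth_derivative.
rewrite (@derive1n_family _ (fun j => psum (iter j pdiff a)) ee)//.
- by rewrite psum0 iter_pdiff0 add0n fact0 divn1 mulKf// pnatr_eq0 -lt0n fact_gt0.
- move=> j; rewrite lecR le_min !ge_min lexx/= radS orbT//.
- move=> x; rewrite normCE ltcR lt_min => /andP[xe xr].
  apply: (clim_unique (Fa x xe)); apply: (psum_cvg ab (ltW b0)).
  move: xr; rewrite /rad expr0 mul1r => xr.
  have : b * normc x <= b * (8 * b)^-1 by rewrite ler_wpM2l// ltW.
  rewrite (_ : b * (8 * b)^-1 = 8^-1); last by field; rewrite gt_eqF.
  by move=> /le_trans; apply; rewrite lef_pV2 ?posrE// ler_nat.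
- move=> j x xj; have [A' hA'] := bound j.
  move: xj; rewrite normCE ltcR lt_min => /andP[_ xr].
  have {}xr : normc x < rad j by apply: lt_le_trans (radS j).
  have A'0 : 0 <= A' by have := le_trans (normc_ge0 _) (hA' 0%N); rewrite expr0 mulr1.
  apply: (@derive1_quadratic _ _ _ _ (2 * A' / rad j ^+ 2)%:C (rad j - normc x)%:C).
  + by rewrite (ltcR 0) subr_gt0.
  + by rewrite (lecR 0) divr_ge0 ?mulr_ge0 ?exprn_ge0// ltW.
  move=> h; rewrite !normCE ltcR ltrBrDr => hx.
  rewrite -realcX -rmorphM lecR.
  apply: (@psum_quadratic _ A' (2 ^+ j * b)) => //.
  + by rewrite mulr_gt0 ?exprn_gt0.
  + exact: ltW.
  + by apply: (le_trans (le_normcD _ _)); exact: ltW.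
- by rewrite normr0.
Qed.

End PowerSeries.

(** * Complex-valued integrals *)

Section ComplexMeasurable.
Context {R : realType} d (T : measurableType d) (D : set T).
Implicit Types f g : T -> R[i].

Definition cmeasurable f :=
  measurable_fun D (fun x => complex.Re (f x))
  /\ measurable_fun D (fun x => complex.Im (f x)).

Lemma cmeasurable_cst (c : R[i]) : cmeasurable (fun=> c).
Proof. by split; exact: measurable_cst. Qed.

Lemma cmeasurable_real (f : T -> R) : measurable_fun D f ->
  cmeasurable (fun x => (f x)%:C).
Proof. by move=> mf; split => //=; exact: measurable_cst. Qed.

Lemma cmeasurableD f g : cmeasurable f -> cmeasurable g ->
  cmeasurable (fun x => f x + g x).
Proof.
move=> [f1 f2] [g1 g2]; split.
  by under eq_fun do rewrite ReD; exact: measurable_funD.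
by under eq_fun do rewrite ImD; exact: measurable_funD.
Qed.

Lemma cmeasurableM f g : cmeasurable f -> cmeasurable g ->
  cmeasurable (fun x => f x * g x).
Proof.
move=> [f1 f2] [g1 g2]; split.
  by under eq_fun do rewrite ReM; apply: measurable_funB; exact: measurable_funM.
by under eq_fun do rewrite ImM; apply: measurable_funD; exact: measurable_funM.
Qed.

Lemma cmeasurableN f : cmeasurable f -> cmeasurable (fun x => - f x).
Proof.
move=> mf; under eq_fun do rewrite -mulN1r.
by apply: cmeasurableM => //; exact: cmeasurable_cst.
Qed.

Lemma cmeasurableB f g : cmeasurable f -> cmeasurable g ->
  cmeasurable (fun x => f x - g x).
Proof. by move=> mf /cmeasurableN; exact: cmeasurableD. Qed.

Lemma cmeasurable_sum (I : Type) (r : seq I) (F : I -> T -> R[i]) :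
  (forall i, cmeasurable (F i)) -> cmeasurable (fun x => \sum_(i <- r) F i x).
Proof.
move=> mF; elim: r => [|i r ih].
  by under eq_fun do rewrite big_nil; exact: cmeasurable_cst.
by under eq_fun do rewrite big_cons; exact: cmeasurableD.
Qed.

Lemma cmeasurable_prod (I : Type) (r : seq I) (F : I -> T -> R[i]) :
  (forall i, cmeasurable (F i)) -> cmeasurable (fun x => \prod_(i <- r) F i x).
Proof.
move=> mF; elim: r => [|i r ih].
  by under eq_fun do rewrite big_nil; exact: cmeasurable_cst.
by under eq_fun do rewrite big_cons; exact: cmeasurableM.
Qed.

Lemma cmeasurable_cexp f : cmeasurable f -> cmeasurable (fun x => cexp (f x)).
Proof.
move=> [f1 f2]; split; apply: measurable_funM.
- by apply: measurableT_comp => //; exact: measurable_expR.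
- by apply: measurableT_comp => //; apply: continuous_measurable_fun; exact: continuous_cos.
- by apply: measurableT_comp => //; exact: measurable_expR.
- by apply: measurableT_comp => //; apply: continuous_measurable_fun; exact: continuous_sin.
Qed.

Lemma cmeasurable_lim (F : nat -> T -> R[i]) f : (forall n, cmeasurable (F n)) ->
  (forall x, D x -> clim (F ^~ x) (f x)) -> cmeasurable f.
Proof.
move=> mF Ff; split.
  apply: (@measurable_fun_cvg _ _ _ _ (fun n x => complex.Re (F n x))).
  - by move=> n; exact: (mF n).1.
  - by move=> x Dx; apply: clim_Re; exact: Ff.
apply: (@measurable_fun_cvg _ _ _ _ (fun n x => complex.Im (F n x))).
- by move=> n; exact: (mF n).2.
- by move=> x Dx; apply: clim_Im; exact: Ff.
Qed.

End ComplexMeasurable.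

Lemma cmeasurable_if {R : realType} d (T : measurableType d) (b : T -> bool) (f g : T -> R[i]) :
  measurable_fun setT b -> cmeasurable setT f -> cmeasurable setT g ->
  cmeasurable setT (fun x => if b x then f x else g x).
Proof.
move=> mb [f1 f2] [g1 g2]; split.
  rewrite (_ : (fun x => _) = (fun x => if b x then complex.Re (f x) else complex.Re (g x))); last first.
    by apply/funext => x; case: ifP.
  by apply: measurable_fun_ifT.
rewrite (_ : (fun x => _) = (fun x => if b x then complex.Im (f x) else complex.Im (g x))); last first.
  by apply/funext => x; case: ifP.
by apply: measurable_fun_ifT.
Qed.

Lemma cmeasurable_comp {R : realType} d d' (T : measurableType d) (T' : measurableType d')
    (h : T -> T') (f : T' -> R[i]) :
  measurable_fun setT h -> cmeasurable setT f -> cmeasurable setT (fun x => f (h x)).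
Proof.
by move=> mh [f1 f2]; split;
  [exact: (measurableT_comp f1 mh)|exact: (measurableT_comp f2 mh)].
Qed.

Section RandomIndex.
Context {R : realType} d (T : measurableType d).

(** Preimages are split along the countably many values of [k]. This yields the measurability of
    sums and products with a random number of terms. *)
Lemma measurable_fun_index d' (T' : measurableType d') (k : T -> nat)
    (F : nat -> T -> T') : measurable_fun setT k ->
  (forall n, measurable_fun setT (F n)) -> measurable_fun setT (fun x => F (k x) x).
Proof.
move=> mk mF _ Y mY; rewrite setTI.
rewrite (_ : _ @^-1` Y = \bigcup_n (k @^-1` [set n] `&` F n @^-1` Y)); last first.
  apply/seteqP; split => [x /= Yx|x [n _ [/= <-]]//].
  by exists (k x).
apply: bigcupT_measurable => n; apply: measurableI.
  by rewrite -[X in measurable X]setTI; exact: mk.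
by rewrite -[X in measurable X]setTI; exact: mF.
Qed.

Lemma cmeasurable_index (k : T -> nat) (F : nat -> T -> R[i]) :
  measurable_fun setT k -> (forall n, cmeasurable setT (F n)) ->
  cmeasurable setT (fun x => F (k x) x).
Proof.
move=> mk mF; split.
  by apply: (measurable_fun_index (F := fun n x => complex.Re (F n x))) => // n; exact: (mF n).1.
by apply: (measurable_fun_index (F := fun n x => complex.Im (F n x))) => // n; exact: (mF n).2.
Qed.

End RandomIndex.

Section ComplexIntegral.
Context {R : realType} d (T : measurableType d) (mu : {measure set T -> \bar R}).
Context (D : set T) (mD : measurable D).
Implicit Types f g : T -> R[i].

Lemma cintegrable_le f (g : T -> R) : cmeasurable D f ->
  mu.-integrable D (EFin \o g) -> (forall x, D x -> normc (f x) <= g x) ->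
  cintegrable mu D f.
Proof.
move=> [f1 f2] ig fg; split.
  apply: (le_integrable mD _ _ ig); first exact/measurable_EFinP.
  by move=> x Dx; rewrite lee_fin (le_trans (normc_Re _))// (le_trans (fg _ Dx))// ler_norm.
apply: (le_integrable mD _ _ ig); first exact/measurable_EFinP.
by move=> x Dx; rewrite lee_fin (le_trans (normc_Im _))// (le_trans (fg _ Dx))// ler_norm.
Qed.

Lemma eq_cintegral f g : (forall x, D x -> f x = g x) ->
  cintegral mu D f = cintegral mu D g.
Proof.
move=> fg; rewrite /cintegral; congr (_ +i* _); apply: eq_Rintegral => x /set_mem Dx;
  by rewrite fg.
Qed.

Lemma cintegrableD f g : cintegrable mu D f -> cintegrable mu D g ->
  cintegrable mu D (fun x => f x + g x).
Proof.
move=> [f1 f2] [g1 g2]; split.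
  by under eq_fun do rewrite ReD EFinD; exact: integrableD.
by under eq_fun do rewrite ImD EFinD; exact: integrableD.
Qed.

Lemma cintegralD f g : cintegrable mu D f -> cintegrable mu D g ->
  cintegral mu D (fun x => f x + g x) = cintegral mu D f + cintegral mu D g.
Proof.
move=> [f1 f2] [g1 g2]; apply: complex_ext; rewrite ?ReD ?ImD /=.
  by rewrite -RintegralD//; apply: eq_Rintegral => x _; rewrite ReD.
by rewrite -RintegralD//; apply: eq_Rintegral => x _; rewrite ImD.
Qed.

Lemma cintegrableZ a f : cintegrable mu D f -> cintegrable mu D (fun x => a * f x).
Proof.
move=> [f1 f2]; split.
  under eq_fun do rewrite ReM EFinB EFinM EFinM.
  by apply: integrableB => //; exact: integrableZl.
under eq_fun do rewrite ImM EFinD EFinM EFinM.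
by apply: integrableD => //; exact: integrableZl.
Qed.

Lemma cintegralZ a f : cintegrable mu D f ->
  cintegral mu D (fun x => a * f x) = a * cintegral mu D f.
Proof.
move=> [f1 f2].
have iz (c : R) (h : T -> R) : mu.-integrable D (EFin \o h) ->
    mu.-integrable D (EFin \o (fun x => c * h x)).
  by move=> ih; rewrite (_ : _ \o _ = fun x => (c%:E * (EFin \o h) x)%E)//; exact: integrableZl.
apply: complex_ext; rewrite ?ReM ?ImM /=.
  rewrite -!RintegralZl// -RintegralB//; [|exact: iz..].
  by apply: eq_Rintegral => x _; rewrite ReM.
rewrite -!RintegralZl// -RintegralD//; [|exact: iz..].
by apply: eq_Rintegral => x _; rewrite ImM.
Qed.

Lemma cintegrableN f : cintegrable mu D f -> cintegrable mu D (fun x => - f x).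
Proof. by move=> /(cintegrableZ (-1)); under eq_fun do rewrite mulN1r. Qed.

Lemma cintegrableB f g : cintegrable mu D f -> cintegrable mu D g ->
  cintegrable mu D (fun x => f x - g x).
Proof. by move=> fi /cintegrableN; exact: cintegrableD. Qed.

Lemma cintegralB f g : cintegrable mu D f -> cintegrable mu D g ->
  cintegral mu D (fun x => f x - g x) = cintegral mu D f - cintegral mu D g.
Proof.
move=> fi gi; rewrite cintegralD//; last exact: cintegrableN.
rewrite -[in RHS]mulN1r -cintegralZ//; congr (_ + _).
by apply: eq_cintegral => x _; rewrite mulN1r.
Qed.

Lemma cintegrable0 : cintegrable mu D (fun=> 0).
Proof. by split; exact: integrable0. Qed.

Lemma cintegral0 : cintegral mu D (fun=> 0) = 0.
Proof.
rewrite -[RHS](mul0r (cintegral mu D (fun=> 0))) -(cintegralZ 0 cintegrable0).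
by apply: eq_cintegral => x _; rewrite mul0r.
Qed.

Lemma cintegrable_sum (I : Type) (r : seq I) (F : I -> T -> R[i]) :
  (forall i, cintegrable mu D (F i)) ->
  cintegrable mu D (fun x => \sum_(i <- r) F i x).
Proof.
move=> iF; elim: r => [|i r ih].
  by under eq_fun do rewrite big_nil; exact: cintegrable0.
by under eq_fun do rewrite big_cons; exact: cintegrableD.
Qed.

Lemma cintegral_sum (I : Type) (r : seq I) (F : I -> T -> R[i]) :
  (forall i, cintegrable mu D (F i)) ->
  cintegral mu D (fun x => \sum_(i <- r) F i x) = \sum_(i <- r) cintegral mu D (F i).
Proof.
move=> iF; elim: r => [|i r ih].
  by under eq_cintegral do rewrite big_nil; rewrite big_nil cintegral0.
under eq_cintegral do rewrite big_cons.
by rewrite big_cons cintegralD// ?ih//; exact: cintegrable_sum.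
Qed.

(* Multiplying [f] by a unit constant makes its integral a nonnegative real. *)
Lemma normc_cintegral f (g : T -> R) : cintegrable mu D f ->
  mu.-integrable D (EFin \o g) -> (forall x, D x -> normc (f x) <= g x) ->
  normc (cintegral mu D f) <= \int[mu]_(x in D) g x.
Proof.
move=> fi ig fg; set I := cintegral mu D f.
have [I0|I0] := eqVneq I 0.
  rewrite I0 normc0'; apply: Rintegral_ge0 => x /fg; apply: le_trans; exact: normc_ge0.
have nI : normc I != 0 by rewrite normc_eq0.
pose u := (normc I)%:C * I^-1.
have nu : normc u = 1.
  by rewrite Normc.normcM Normc.normcV normc_real ger0_norm ?normc_ge0// divff.
have uI : cintegral mu D (fun x => u * f x) = (normc I)%:C.
  by rewrite cintegralZ// /u -mulrA mulVf// mulr1.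
rewrite -[leLHS]/(complex.Re (normc I)%:C) -uI /=.
apply: le_Rintegral => //; first exact: (cintegrableZ u fi).1.
move=> x Dx; apply: (le_trans _ (fg x Dx)); apply: (le_trans (ler_norm _)).
by apply: (le_trans (normc_Re _)); rewrite Normc.normcM nu mul1r.
Qed.

End ComplexIntegral.

Section ComplexExpectation.
Context {R : realType} d (T : measurableType d) (P : probability T R).
Implicit Types (f g : T -> R[i]) (c : R).

Lemma cexpectationE f : cexpectation P f = cintegral P setT f.
Proof. by rewrite /cexpectation unlock. Qed.

Lemma integrable_cst_prob c : P.-integrable setT (EFin \o fun=> c).
Proof.
exact: (@finite_measure_integrable_cst _ _ _ P).
Qed.

Lemma integral_cst_prob c : (\int[P]_x c%:E = c%:E)%E.
Proof.
transitivity (c%:E * P setT)%E; first exact: integral_cst.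
by rewrite probability_setT mule1.
Qed.

Lemma Rintegral_cst_prob c : \int[P]_x (cst c x) = c.
Proof.
by rewrite /Rintegral integral_cst_prob.
Qed.

Lemma integrable_bounded (h : T -> R) c : measurable_fun setT h ->
  (forall x, `|h x| <= c) -> P.-integrable setT (EFin \o h).
Proof.
move=> mh hc; apply: measurable_bounded_integrable => //.
  by rewrite (le_lt_trans (probability_le1 _ _)) ?ltry.
by exists c; split; [exact: num_real|move=> y cy x _; exact: le_trans (hc x) (ltW cy)].
Qed.

Lemma cintegrable_bounded f c : cmeasurable setT f -> (forall x, normc (f x) <= c) ->
  cintegrable P setT f.
Proof.
move=> mf fc; apply: (@cintegrable_le _ _ _ P _ measurableT f (fun=> c)) => //.
exact: integrable_cst_prob.
Qed.

Lemma cexpectation_cst (z : R[i]) : cexpectation P (fun=> z) = z.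
Proof.
rewrite cexpectationE; apply: complex_ext; exact: Rintegral_cst_prob.
Qed.

Lemma normc_cexpectation f c : cmeasurable setT f -> (forall x, normc (f x) <= c) ->
  normc (cexpectation P f) <= c.
Proof.
move=> mf fc; rewrite cexpectationE.
have := @normc_cintegral _ _ _ P _ measurableT f (fun=> c) (cintegrable_bounded mf fc)
  (integrable_cst_prob _) (fun x _ => fc x).
by rewrite Rintegral_cst_prob.
Qed.

Lemma eq_cexpectation f g : f =1 g -> cexpectation P f = cexpectation P g.
Proof. by move=> /funext ->. Qed.

End ComplexExpectation.

(** * Integrals of functions that agree off a null set, without measurability *)

Section NonMeasurableAE.
Context {R : realType} d (T : measurableType d) (P : probability T R).
Import HBNNSimple.

(** The integral of a nonnegative function is a supremum over simple functions below it. Multiplying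
    such a function by the indicator of the complement of [N] keeps its integral and puts it below
    [g]. *)
Let ge0_le_integral_off_null (f g : T -> \bar R) (N : set T) :
  measurable N -> P N = 0%E -> (forall x, 0 <= f x)%E ->
  (forall x, 0 <= g x)%E -> (forall x, ~ N x -> f x = g x) ->
  (\int[P]_x f x <= \int[P]_x g x)%E.
Proof.
move=> mN N0 f0 g0 fg; rewrite !ge0_integralTE//; apply: ge_ereal_sup => _ [h /= hf <-].
have mNC := measurableC mN.
have -> : sintegral P h = sintegral P (proj_nnsfun h mNC).
  rewrite -!integralT_nnsfun; apply: ae_eq_integral => //.
  - exact/measurable_EFinP.
  - exact/measurable_EFinP.
  exists N; split => // x /= /not_implyP[_ hx]; apply: contrapT => Nx; apply: hx.
  by congr EFin; rewrite /= mindicE mem_set// mulr1.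
apply: ereal_sup_ubound; exists (proj_nnsfun h mNC) => //= x; rewrite mindicE.
have [/set_mem Nx|] := boolP (x \in ~` N); last by rewrite mulr0 g0.
by rewrite mulr1 -fg// hf.
Qed.

Lemma integral_eq_off_null (f g : T -> \bar R) (N : set T) :
  measurable N -> P N = 0%E -> (forall x, ~ N x -> f x = g x) ->
  (\int[P]_x f x = \int[P]_x g x)%E.
Proof.
move=> mN N0 fg; rewrite integralE [RHS]integralE; congr (_ - _)%E; apply/eqP;
  rewrite eq_le; apply/andP; split; apply: (ge0_le_integral_off_null mN) => // x Nx.
all: by rewrite ?funeposE ?funenegE fg.
Qed.

(** Applied to the functional of the theorem, whose integrand is built from [cum_nodes] and
    [cum_weight], and to products indexed by counts of attacks. *)
Lemma cexpectation_eq_off_null (f g : T -> R[i]) (N : set T) :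
  measurable N -> P N = 0%E -> (forall x, ~ N x -> f x = g x) ->
  cexpectation P f = cexpectation P g.
Proof.
move=> mN N0 fg; rewrite /cexpectation unlock; congr (fine _ +i* fine _);
  by apply: (integral_eq_off_null mN) => // x /fg ->.
Qed.

End NonMeasurableAE.

(** * Fubini for a product with a probability, and for independent random elements *)

Section ProductFubini.
Context {R : realType} d1 d2 (T1 : measurableType d1) (T2 : measurableType d2).
Context (m1 : {sigma_finite_measure set T1 -> \bar R}) (P : probability T2 R).
Context (D : set T1) (mD : measurable D).
Variables (f : T1 * T2 -> R[i]) (g : T1 -> R).
Hypotheses (mf : cmeasurable setT f) (ig : m1.-integrable D (EFin \o g)).
Hypothesis fg : forall x w, D x -> normc (f (x, w)) <= g x.

(** A bound depending on the first variable alone suffices, since the second variable carries total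
    mass 1. The bound is only available on [D], so the function is cut off there before the product
    integral is taken. *)
Let real_fubini (h : T1 * T2 -> R) : measurable_fun setT h ->
  (forall x w, D x -> `|h (x, w)| <= g x) ->
  m1.-integrable D (fun x => (\int[P]_w h (x, w))%:E) /\
  \int[m1]_(x in D) (\int[P]_w h (x, w)) = \int[P]_w (\int[m1]_(x in D) h (x, w)).
Proof.
move=> mh hg; pose k (z : T1 * T2) : \bar R := (h z * \1_D z.1)%:E.
have mk : measurable_fun setT k.
  apply/measurable_EFinP; apply: measurable_funM => //.
  by apply: measurableT_comp => //; exact: measurable_indic.
have ik : (m1 \x P)%E.-integrable setT k.
  apply/integrable12ltyP => //.
  have : m1.-integrable setT ((EFin \o g) \_ D) by apply/(integrable_mkcond _ mD).
  move=> /integrableP[mg]; apply: le_lt_trans.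
  apply: ge0_le_integral => //.
  - by move=> x _; exact: integral_ge0.
  - apply: (@measurable_fun_fubini_tonelli_F _ _ _ _ _ P (fun z => `|k z|%E)) => //.
    exact: measurableT_comp.
  - exact: measurableT_comp.
  move=> x _; rewrite patchE; case: ifPn => xD.
    apply: (@le_trans _ _ (\int[P]_w (g x)%:E)%E); last first.
      by rewrite integral_cst_prob lee_fin ler_norm.
    apply: ge0_le_integral => //.
    - apply: measurableT_comp => //; apply: measurableT_comp mk _.
      exact: measurable_fun_pair.
    move=> w _; rewrite /k /= indicE xD mulr1 lee_fin; apply: hg; exact: set_mem.
  rewrite (eq_integral (fun=> 0%E)) ?integral0// => w _.
  by rewrite /k /= indicE (negbTE xD) mulr0 normr0.
have kF : fubini_F P k = (fun x => (\int[P]_w h (x, w))%:E) \_ D.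
  apply/funext => x; rewrite /fubini_F patchE; case: ifPn => xD.
    rewrite /Rintegral fineK.
      by apply: eq_integral => w _; rewrite /k /= indicE xD mulr1.
    apply: integrable_fin_num => //; apply: (@integrable_bounded _ _ _ P _ (g x)).
      by apply: measurableT_comp mh _; exact: measurable_fun_pair.
    by move=> w; apply: hg; exact: set_mem.
  rewrite (eq_integral (fun=> 0%E)) ?integral0// => w _.
  by rewrite /k /= indicE (negbTE xD) mulr0.
have kG : fubini_G m1 k = (fun w => (\int[m1]_(x in D) h (x, w))%:E).
  apply/funext => w; rewrite /fubini_G /Rintegral fineK.
    rewrite [RHS]integral_mkcond; apply: eq_integral => x _.
    by rewrite /k /= indicE patchE; case: ifPn; rewrite ?mulr1 ?mulr0.
  apply: integrable_fin_num => //; apply: (le_integrable mD _ _ ig).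
    apply/measurable_EFinP/measurable_funTS; apply: measurableT_comp mh _.
    exact: measurable_fun_pair.
  by move=> x Dx; rewrite lee_fin (le_trans (hg x w Dx))// ler_norm.
split; first by apply/integrable_mkcond => //; rewrite -kF; exact: integrable_fubini_F.
rewrite /Rintegral integral_mkcond -kF integral12_prod_meas1// -integral21_prod_meas1//.
by rewrite kG.
Qed.

Lemma cintegral_cexpectation :
  cintegrable m1 D (fun x => cexpectation P (fun w => f (x, w))) /\
  cintegral m1 D (fun x => cexpectation P (fun w => f (x, w)))
  = cexpectation P (fun w => cintegral m1 D (fun x => f (x, w))).
Proof.
have [r1 r2] := real_fubini mf.1 (fun x w Dx => le_trans (normc_Re _) (fg w Dx)).
have [i1 i2] := real_fubini mf.2 (fun x w Dx => le_trans (normc_Im _) (fg w Dx)).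
rewrite (_ : (fun x => _) = (fun x => cintegral P setT (fun w => f (x, w)))); last first.
  by apply/funext => x; rewrite cexpectationE.
by split; rewrite // cexpectationE /cintegral /= -r2 -i2.
Qed.

End ProductFubini.

Section IndependentFubini.
Context {R : realType} d d1 d2 (T : measurableType d) (T1 : measurableType d1)
  (T2 : measurableType d2) (P : probability T R).
Variables (X : T -> T1) (Y : T -> T2).
Hypotheses (mX : measurable_fun setT X) (mY : measurable_fun setT Y).
Hypothesis XY : forall A B, measurable A -> measurable B ->
  P (X @^-1` A `&` Y @^-1` B) = (P (X @^-1` A) * P (Y @^-1` B))%E.

Let X' : {RV P >-> T1} := HB.pack X (isMeasurableFun.Build _ _ _ _ X mX).
Let Y' : {RV P >-> T2} := HB.pack Y (isMeasurableFun.Build _ _ _ _ Y mY).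
Let mXY : measurable_fun setT (fun w => (X w, Y w)).
Proof. exact: measurable_fun_pair. Qed.
Let XY' : {RV P >-> (T1 * T2)%type} :=
  HB.pack (fun w => (X w, Y w)) (isMeasurableFun.Build _ _ _ _ _ mXY).

(** By uniqueness of the product measure on rectangles, the joint law is the product of the two
    laws; Fubini is applied there and each variable is pulled back to [P] separately. *)
Let real_case (h : T1 * T2 -> R) (c : R) : measurable_fun setT h ->
  (forall z, `|h z| <= c) ->
  \int[P]_w h (X w, Y w) = \int[P]_w1 (\int[P]_w2 h (X w1, Y w2)).
Proof.
move=> mh hc.
have e1 : (\int[distribution P XY']_z (h z)%:E = \int[P]_w (h (X w, Y w))%:E)%E.
  apply: (@integral_distribution _ _ _ _ _ P XY' (EFin \o h)); first exact/measurable_EFinP.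
  by apply: (@integrable_bounded _ _ _ P (h \o XY') c) => [|w]; [exact: (measurableT_comp mh mXY)|exact: hc].
have e2 : (\int[distribution P XY']_z (h z)%:E =
    \int[distribution P X' \x distribution P Y']_z (h z)%:E)%E.
  apply: eq_measure_integral => A mA _; apply/esym/product_measure_unique => //.
have e3 w1 : (\int[distribution P Y']_y (h (w1, y))%:E = \int[P]_w2 (h (w1, Y w2))%:E)%E.
  have mh1 : measurable_fun setT (fun y => h (w1, y)).
    by apply: measurableT_comp mh _; exact: measurable_fun_pair.
  apply: (@integral_distribution _ _ _ _ _ P Y' (fun y => (h (w1, y))%:E)).
    exact/measurable_EFinP.
  by apply: (@integrable_bounded _ _ _ P (fun w => h (w1, Y' w)) c) => // _; exact: (measurableT_comp mh1 mY).
rewrite /Rintegral -e1 e2.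
have iprod : (distribution P X' \x distribution P Y')%E.-integrable setT (EFin \o h).
  exact: (@integrable_bounded _ _ _ (distribution P X' \x distribution P Y')%E h c).
have mF w1 : measurable_fun setT (fun w => h (w1, Y w)).
  by apply: (measurableT_comp mh); exact: measurable_fun_pair.
pose F w1 := \int[P]_w2 h (w1, Y w2).
have FE : fubini_F (distribution P Y') (EFin \o h) = EFin \o F.
  apply/funext => w1; rewrite /fubini_F /= e3 /F /Rintegral fineK//.
  by apply: integrable_fin_num => //; exact: (@integrable_bounded _ _ _ P _ c).
have iF := integrable_fubini_F iprod.
have mF' : measurable_fun setT F by apply/measurable_EFinP; rewrite -FE; case/integrableP: iF.
have Fc w1 : `|F w1| <= c.
  have ih1 : P.-integrable setT (EFin \o (fun w => h (w1, Y w))).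
    exact: (@integrable_bounded _ _ _ P _ c).
  apply: (le_trans (le_normr_Rintegral _ ih1)) => //.
  rewrite -[leRHS](Rintegral_cst_prob P); apply: le_Rintegral => //.
  - apply: (@integrable_bounded _ _ _ P (fun w => `|h (w1, Y w)|) c) => [|w].
      exact: measurableT_comp.
    by rewrite normr_id.
  - exact: integrable_cst_prob.
rewrite -integral12_prod_meas1// FE; congr fine.
rewrite (@integral_distribution _ _ _ _ _ P X')//; first exact/measurable_EFinP.
by apply: (@integrable_bounded _ _ _ P (F \o X) c) => [|w]; [exact: (measurableT_comp mF' mX)|exact: Fc].
Qed.

(** The form in which conditioning is used: [X] is frozen at an outer sample point while [Y] is
    averaged. The two target spaces will be copies of the sample space with smaller
    sigma-algebras. *)
Lemma cexpectation_independent (f : T1 * T2 -> R[i]) (c : R) : cmeasurable setT f ->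
  (forall z, normc (f z) <= c) ->
  cexpectation P (fun w => f (X w, Y w))
  = cexpectation P (fun w1 => cexpectation P (fun w2 => f (X w1, Y w2))).
Proof.
move=> mf fc; rewrite [RHS]cexpectationE cexpectationE /cintegral.
rewrite (real_case mf.1 (fun z => le_trans (normc_Re _) (fc z))).
rewrite (real_case mf.2 (fun z => le_trans (normc_Im _) (fc z))).
by congr (_ +i* _); apply: eq_Rintegral => w _; rewrite cexpectationE.
Qed.

Lemma cexpectationM (f : T1 -> R[i]) (g : T2 -> R[i]) (a b : R) :
  cmeasurable setT f -> cmeasurable setT g ->
  (forall z, normc (f z) <= a) -> (forall z, normc (g z) <= b) ->
  cexpectation P (fun w => f (X w) * g (Y w))
  = cexpectation P (fun w => f (X w)) * cexpectation P (fun w => g (Y w)).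
Proof.
move=> mf mg fa gb.
rewrite (@cexpectation_independent (fun z => f z.1 * g z.2) (a * b)); first last.
- by move=> z; rewrite Normc.normcM ler_pM ?normc_ge0.
- by apply: cmeasurableM; exact: cmeasurable_comp.
have ig : cintegrable P setT (fun w => g (Y w)).
  by apply: (cintegrable_bounded P (cmeasurable_comp mY mg)) => w; exact: gb.
have if' : cintegrable P setT (fun w => f (X w)).
  by apply: (cintegrable_bounded P (cmeasurable_comp mX mf)) => w; exact: fa.
rewrite mulrC !cexpectationE -cintegralZ//; apply: eq_cintegral => w _.
by rewrite mulrC -cintegralZ// cexpectationE.
Qed.

End IndependentFubini.

(** * Uniqueness of the Laplace transform *)

Section Lerch.
Context {R : realType}.
Implicit Types (u v : R -> R) (a b c q s t x y : R).
Local Notation mu := (@lebesgue_measure R).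
Local Notation D := `[0, +oo[%classic.

Let bernoulli_ge t m : 0 <= t -> t <= 1 -> 1 - m%:R * t <= (1 - t) ^+ m.
Proof.
move=> t0 t1; elim: m => [|m ih]; first by rewrite mul0r subr0 expr0.
rewrite exprS; apply: (@le_trans _ _ ((1 - t) * (1 - m%:R * t))).
  have : 0 <= m%:R * t * t by rewrite !mulr_ge0.
  by rewrite -[m.+1]addn1 natrD; nra.
by rewrite ler_wpM2l// subr_ge0.
Qed.

(** Upper counterpart of the Bernoulli inequality, $(1-t)^m\le 1/(1+mt)$, from $(1-t)(1+(m+1)t)\le
    1+mt$. *)
Let bernoulli_le t m : 0 <= t -> t <= 1 -> (1 - t) ^+ m * (1 + m%:R * t) <= 1.
Proof.
move=> t0 t1; elim: m => [|m ih]; first by rewrite mul0r addr0 expr0 mulr1.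
apply: le_trans ih; rewrite exprSr -mulrA ler_wpM2l ?exprn_ge0 ?subr_ge0//.
have : 0 <= m%:R * t * t by rewrite !mulr_ge0.
by rewrite -[m.+1]addn1 natrD; nra.
Qed.

(** The threshold $1/2$ comes from the exponent $2^n$: the product $2^n x^n$ tends to 0 here and to
    infinity for $x>1/2$. *)
Let step_lt_half x : 0 <= x -> x < 2^-1 ->
  (fun n => (1 - x ^+ n) ^+ (2 ^ n)) @ \oo --> (1 : R).
Proof.
move=> x0 x2; have xn n : 0 <= x ^+ n <= 1.
  by rewrite exprn_ge0//= exprn_ile1//; lra.
apply: (@squeeze_cvgr _ _ _ _ (fun n => 1 - (2 * x) ^+ n) (fun=> 1)).
- apply: nearW => n; have /andP[h0 h1] := xn n.
  rewrite exprn_ile1 ?subr_ge0 ?lerBlDr ?lerDl// andbT.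
  by rewrite -lerBlDr exprMn -natrX; exact: bernoulli_ge.
- rewrite -[X in _ --> X]subr0; apply: cvgB; first exact: cvg_cst.
  by apply: cvg_expr; rewrite ger0_norm ?mulr_ge0//; lra.
- exact: cvg_cst.
Qed.

Let step_gt_half x : 2^-1 < x -> x <= 1 ->
  (fun n => (1 - x ^+ n) ^+ (2 ^ n)) @ \oo --> (0 : R).
Proof.
move=> x2 x1; have x0 : 0 <= x by lra.
have xn n : 0 <= x ^+ n <= 1 by rewrite exprn_ge0//= exprn_ile1.
apply: (@squeeze_cvgr _ _ _ _ (fun=> 0) (fun n => (2 * x)^-1 ^+ n)).
- apply: nearW => n; have /andP[h0 h1] := xn n.
  rewrite exprn_ge0 ?subr_ge0//=.
  have := bernoulli_le (2 ^ n) h0 h1; rewrite natrX -exprMn => h.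
  have p0 : 0 < (2 * x) ^+ n by rewrite exprn_gt0//; lra.
  rewrite exprVn -[leRHS]mul1r ler_pdivlMr// (le_trans _ h)//.
  by rewrite ler_wpM2l ?exprn_ge0 ?subr_ge0// lerDr.
- exact: cvg_cst.
- apply: cvg_expr; rewrite ger0_norm ?invr_ge0; last lra.
  by rewrite invf_lt1; lra.
Qed.

Variable u : R -> R.
Hypothesis ru : forall q, 0 <= q -> u x @[x --> q^'+] --> u q.
Hypothesis iu : forall y, 0 < y -> mu.-integrable D (fun s => (expR (- (y * s)) * u s)%:E).
Hypothesis u0 : forall y, 0 < y -> \int[mu]_(s in D) (expR (- (y * s)) * u s) = 0.

Let mD : measurable (D : set (measurableTypeR R)). Proof. exact: measurable_itv. Qed.

(** Expanding one factor of the kernel at a time turns $e^{-ys}$ into $e^{-ys}-e^{-(y+b)s}$. Since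
    $y$ moves, the induction keeps it universally quantified. *)
Let binomial_kernel b k y : 0 <= b -> 0 < y ->
  mu.-integrable D (fun s => ((1 - expR (- (b * s))) ^+ k * (expR (- (y * s)) * u s))%:E) /\
  \int[mu]_(s in D) ((1 - expR (- (b * s))) ^+ k * (expR (- (y * s)) * u s)) = 0.
Proof.
move=> b0; elim: k y => [|k ih] y y0.
  split; first by apply: (eq_integrable mD _ _ _ (iu y0)) => s _; rewrite expr0 mul1r.
  by under eq_Rintegral do rewrite expr0 mul1r; exact: u0.
have [i1 e1] := ih y y0; have [i2 e2] := ih (y + b) (ltr_wpDr b0 y0).
have E : (fun s => (1 - expR (- (b * s))) ^+ k.+1 * (expR (- (y * s)) * u s)) =
   (fun s => (1 - expR (- (b * s))) ^+ k * (expR (- (y * s)) * u s)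
    - (1 - expR (- (b * s))) ^+ k * (expR (- ((y + b) * s)) * u s)).
  by apply/funext => s; rewrite mulrDl opprD expRD exprS; ring.
split.
  apply: (eq_integrable mD _ _ _ (integrableB mD i1 i2)) => s _.
  by rewrite /= -EFinB; congr EFin; rewrite -[RHS]/((fun s => _) s) E.
have h := RintegralB mD i1 i2; rewrite e1 e2 subrr in h; apply: etrans h.
by apply: eq_Rintegral => s _; rewrite -[LHS]/((fun s => _) s) E.
Qed.

(** The transform at $y=1$ provides an integrable weight; as the kernels lie in $[0,1]$, its modulus
    dominates the whole sequence. *)
Let v s := expR (- s) * u s.

Let iv : mu.-integrable D (EFin \o v).
Proof. by apply: (eq_integrable mD _ _ _ (iu ltr01)) => s _; rewrite mul1r. Qed.

Let tail c : 0 < c -> \int[mu]_(s in D) (\1_(`]c, +oo[%classic) s * v s) = 0.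
Proof.
(* With this rate $e^{-as}$ crosses the threshold $1/2$ of the kernels exactly at $s=c$. *)
move=> c0; pose a := ln 2 / c.
have a0 : 0 < a by rewrite divr_gt0// ln_gt0// ltr1n.
have half : expR (- (a * c)) = 2^-1.
  by rewrite /a divfK ?gt_eqF// expRN lnK// posrE.
have a0' := ltW a0; clearbody a.
pose f n s := (1 - expR (- (a * n%:R * s))) ^+ (2 ^ n) * v s.
have f0 n : \int[mu]_(s in D) (f n s) = 0.
  have [_ ] := @binomial_kernel (a * n%:R) (2 ^ n) 1 (mulr_ge0 (ltW a0) (ler0n _ _)) ltr01.
  by under eq_Rintegral do rewrite mul1r.
have if' n : mu.-integrable D (EFin \o f n).
  have [h _] := @binomial_kernel (a * n%:R) (2 ^ n) 1 (mulr_ge0 (ltW a0) (ler0n _ _)) ltr01.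
  by apply: (eq_integrable mD _ _ _ h) => s _; rewrite mul1r.
have mv : measurable_fun (D : set (measurableTypeR R)) v by apply/measurable_EFinP; case/integrableP : iv.
have kE n s : expR (- (a * n%:R * s)) = expR (- (a * s)) ^+ n.
  by rewrite -expRM_natr; congr expR; ring.
have kle n s : D s -> 0 <= 1 - expR (- (a * n%:R * s)) <= 1.
  rewrite /= in_itv/= andbT => s0; rewrite subr_ge0 lerBlDr lerDl expR_ge0 andbT.
  by rewrite -expR0 ler_expR oppr_le0 !mulr_ge0.
have [|||||_ _] := @dominated_convergence _ _ _ mu _ mD (fun n => EFin \o f n)
    (EFin \o (fun s => \1_(`]c, +oo[%classic) s * v s)) (fun s => `|(v s)%:E|)%E.
- by move=> n; case/integrableP : (if' n).
- by apply/measurable_EFinP; apply: measurable_funM.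
(* At $s=c$ the kernel is $(1-2^{-n})^{2^n}$, with limit $e^{-1}$ instead of 0 or 1; this single
   point is the exceptional null set. *)
- exists [set c]; split => //; first exact: lebesgue_measure_set1.
  move=> s /= /not_implyP[Ds hs]; apply: contrapT => sc; apply: hs.
  apply: cvg_EFin; first exact: nearW.
  apply: cvgM; last exact: cvg_cst.
  rewrite [X in X @ _ --> _](_ : _ = (fun n => (1 - expR (- (a * s)) ^+ n) ^+ (2 ^ n))); last first.
    by apply/funext => n; rewrite kE.
  have s0 : 0 <= s by move: Ds; rewrite /= in_itv/= andbT.
  rewrite indicE; have [cs|sc'] := ltP c s.
    rewrite mem_set/=; last by rewrite in_itv/= cs.
    by apply: step_lt_half; rewrite ?expR_ge0// -half ltr_expR ltrN2 ltr_pM2l.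
  rewrite memNset/=; last by rewrite in_itv/= andbT; apply/negP; rewrite -leNgt.
  have {}sc : s < c by rewrite lt_neqAle sc' andbT; apply/eqP.
  apply: step_gt_half; first by rewrite -half ltr_expR ltrN2 ltr_pM2l.
  by rewrite -expR0 ler_expR oppr_le0 mulr_ge0.
- by apply: integrable_abse.
- apply: aeW => s n Ds /=; rewrite lee_fin normrM normrX.
  have /andP[k0 k1] := kle n s Ds.
  by rewrite ger0_norm// ler_piMl// exprn_ile1.
rewrite /Rintegral => /cvg_lim <-//.
rewrite (_ : (fun n => _) = fun=> 0%E) ?lim_cst//.
apply/funext => n; rewrite -[LHS]fineK; last exact: integrable_fin_num.
by congr EFin; exact: f0.
Qed.

(** Differences of tails show that [v] integrates to 0 over every $]p,d]$ with $p>0$. Were $v(p)\ne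
    0$, right continuity would keep $v(p)v(x)$ above $v(p)^2/2$ on a short such interval;
    multiplying by $v(p)$ treats both signs at once. *)
Lemma real_lerch q : 0 <= q -> u q = 0.
Proof.
have tailp (p c : R) : 0 < p -> mu.-integrable D (EFin \o (fun s => c * (\1_(`]p, +oo[%classic) s * v s))) /\
    \int[mu]_(s in D) (c * (\1_(`]p, +oo[%classic) s * v s)) = 0.
  move=> p0; have ip : mu.-integrable D (EFin \o (fun s => \1_(`]p, +oo[%classic) s * v s)).
    apply: (le_integrable mD _ _ iv).
      apply/measurable_EFinP; apply: measurable_funM; first exact: measurable_indic.
      by apply/measurable_EFinP; case/integrableP : iv.
    move=> s _; rewrite lee_fin normrM ler_piMl// indicE.
    by case: (_ \in _); rewrite ?normr1 ?normr0.
  split; last by rewrite RintegralZl// tail// mulr0.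
  by apply: (eq_integrable mD _ _ _ (integrableZl mD c ip)) => s _; rewrite /= EFinM.
have rv p : 0 <= p -> v x @[x --> p^'+] --> v p.
  move=> p0; apply: cvgM; last exact: ru.
  apply: cvg_at_right_filter; apply: (@continuous_comp _ _ _ -%R expR p).
    exact: opp_continuous.
  exact: continuous_expR.
have vpos p : 0 < p -> v p = 0.
  move=> p0; apply/eqP/negPn/negP => vp0.
  have vp2 : 0 < v p * v p by rewrite -expr2 lt0r sqrf_eq0 vp0 sqr_ge0.
  have vv : (v p * v x) @[x --> p^'+] --> v p * v p.
    by apply: cvgM; [exact: cvg_cst|exact: rv (ltW p0)].
  have : \forall x \near p^'+, v p * v p / 2 < v p * v x.
    by apply: (cvgr_gt _ vv); lra.
  move=> [e /= e0 he].
  pose d := p + e / 2.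
  have pd : p < d by rewrite ltrDl divr_gt0.
  have d0 : 0 < d by exact: lt_trans pd.
  have [i1 e1] := tailp p (v p) p0; have [i2 e2] := tailp d (v p) d0.
  have := RintegralB mD i1 i2; rewrite e1 e2 subrr; apply/eqP; rewrite gt_eqF//.
  have mupd : mu (`]p, d]%classic : set R) = (d - p)%:E.
    by rewrite lebesgue_measure_itv/= lte_fin pd -EFinB.
  have ii : mu.-integrable D (EFin \o (fun s => \1_(`]p, d]%classic) s : R)).
    apply: (@le_integrable _ _ _ mu D mD _ (EFin \o (fun s => \1_(`]p, d]%classic) s : R))) => //.
      exact/measurable_EFinP/measurable_indic.
    apply: (integrableS measurableT mD) => //.
    apply/integrableP; split; first exact/measurable_EFinP/measurable_indic.
    under eq_integral do rewrite /= ger0_norm//.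
    by rewrite integral_indic// setIT [X in (X < _)%E]mupd ltry.
  apply: (@lt_le_trans _ _ (\int[mu]_(s in D) (v p * v p / 2 * \1_(`]p, d]%classic) s))).
    rewrite RintegralZl// mulr_gt0//; first lra.
    rewrite /Rintegral integral_indic// (_ : _ `&` _ = `]p, d]%classic); last first.
      apply/seteqP; split => [x []//|x/=]; rewrite !in_itv/= andbT => /andP[px xd].
      by split; [rewrite px xd|rewrite ltW// (lt_trans p0)].
    by rewrite [X in fine X]mupd/= subr_gt0.
  apply: le_Rintegral => //.
  - by apply: (eq_integrable mD _ _ _ (integrableZl mD (v p * v p / 2) ii)) => s _; rewrite /= EFinM.
  - by apply: (eq_integrable mD _ _ _ (integrableB mD i1 i2)) => s _; rewrite /= EFinB.
  move=> s; rewrite /= in_itv/= andbT => s0; rewrite !indicE.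
  rewrite !mem_setE !in_itv/= !andbT; case: (ltP p s) => ps; last first.
    by rewrite mul0r !mulr0 ltNge (le_trans ps (ltW pd)) /= mul0r mulr0 subrr.
  case: (ltP d s) => ds /=; first by rewrite mulr0 mul1r subrr.
  rewrite mulr1 mul1r mul0r mulr0 subr0 ltW//; apply: he => //=.
  by rewrite ltr0_norm ?subr_lt0// opprB ltrBlDl (le_lt_trans ds)// ltrD2l; lra.
move=> q0; suff : v q = 0.
  by move=> /eqP; rewrite mulf_eq0 gt_eqF ?expR_gt0//= => /eqP.
(* The tails start at positive points, so $q=0$ is reached by right continuity from the values just
   found. *)
move: q0; rewrite le_eqVlt => /predU1P[<-|]; last exact: vpos.
have := cvg_lim (@norm_hausdorff _ _) (rv 0 (lexx 0)) => <-.
apply: cvg_lim; first exact: norm_hausdorff.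
apply: cvg_near_cst; exists 1 => //= x _ x0; exact: vpos.
Qed.

End Lerch.

Lemma right_continuous_at_dist {R : realType} {K : numFieldType} (f : R -> K) (q : R) :
  right_continuous_at f q <->
  (forall e : K, 0 < e -> \forall x \near q^'+, `|f q - f x| < e).
Proof. by split => [/cvgrPdist_lt|h]//; apply/cvgrPdist_lt. Qed.

(** A positive element of [R[i]] is real, so complex tolerances reduce to real ones. *)
Lemma right_continuous_atP {R : realType} (f : R -> R[i]) (q : R) :
  right_continuous_at f q <->
  (forall e : R, 0 < e -> \forall x \near q^'+, normc (f q - f x) < e).
Proof.
split => [/right_continuous_at_dist h e e0|h]; last apply/right_continuous_at_dist => e e0.
  have := h e%:C; rewrite (ltcR 0) => /(_ e0); apply: filterS => x.
  by rewrite normCE ltcR.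
have eE : e = (complex.Re e)%:C by move: e0; case: e => a b; rewrite ltcE /= => /andP[/eqP -> _].
have {}e0 : 0 < complex.Re e by move: e0; rewrite {1}eE (ltcR 0).
apply: filterS (h _ e0) => x.
by rewrite normCE eE ltcR.
Qed.

(** Only real $y$ are used: there the exponential is real, so it commutes with taking real or
    imaginary parts, and each part of the difference has vanishing real Laplace transform. *)
Lemma laplace_unique {R : realType} (G : R[i] -> R[i]) (f1 f2 : R -> R[i]) (q : R) :
  is_inverse_laplace G f1 -> is_inverse_laplace G f2 -> 0 <= q -> f1 q = f2 q.
Proof.
move=> [r1 h1] [r2 h2] q0.
have mD : measurable (`[0, +oo[%classic : set (measurableTypeR R)) by exact: measurable_itv.
have key (F : R[i] -> R) : (forall z w, F (z - w) = F z - F w) ->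
    (forall (a : R) z, F (a%:C * z) = a * F z) ->
    (forall f, (forall q : R, 0 <= q -> right_continuous_at f q) -> forall q : R, 0 <= q ->
       (F \o f) x @[x --> q^'+] --> F (f q)) ->
    (forall f, cintegrable (@lebesgue_measure R) `[0, +oo[ f ->
       (@lebesgue_measure R).-integrable `[0, +oo[ (EFin \o (F \o f))) ->
    (forall f, F (cintegral (@lebesgue_measure R) `[0, +oo[ f) =
       \int[@lebesgue_measure R]_(x in `[0, +oo[) F (f x)) ->
    F (f1 q) = F (f2 q).
  move=> FB FM Frc Fi FI; apply/eqP; rewrite -subr_eq0; apply/eqP.
  apply: (@real_lerch _ (fun s => F (f1 s) - F (f2 s))) => //.
  - by move=> p p0; apply: cvgB; exact: Frc.
  - move=> y y0; have [i1 _] := h1 y%:C y0; have [i2 _] := h2 y%:C y0.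
    apply: (eq_integrable mD _ _ _ (integrableB mD (Fi _ i1) (Fi _ i2))) => s _.
    by rewrite /= -EFinB -rmorphM -rmorphN/= cexp_real !FM mulrBr.
  - move=> y y0; have [i1 e1] := h1 y%:C y0; have [i2 e2] := h2 y%:C y0.
    have e := RintegralB mD (Fi _ i1) (Fi _ i2); rewrite -FI -FI e1 e2 subrr in e.
    apply: etrans e; by apply: eq_Rintegral => s _; rewrite /= -rmorphM -rmorphN/= cexp_real !FM mulrBr.
apply: complex_ext.
- apply: key; first by move=> z w; rewrite ReD ReN.
  + by move=> a z; rewrite ReM /= mul0r subr0.
  + move=> f rf p p0; have := rf p p0.
    move=> /right_continuous_atP h; apply/cvgrPdist_lt => e e0.
    apply: filterS (h e e0) => x; apply: le_lt_trans.
    by rewrite /= -ReN -ReD; exact: normc_Re.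
  + by move=> f [].
  + by [].
- apply: key; first by move=> z w; rewrite ImD ImN.
  + by move=> a z; rewrite ImM /= mul0r addr0.
  + move=> f rf p p0; have := rf p p0.
    move=> /right_continuous_atP h; apply/cvgrPdist_lt => e e0.
    apply: filterS (h e e0) => x; apply: le_lt_trans.
    by rewrite /= -ImN -ImD; exact: normc_Im.
  + by move=> f [].
  + by [].
Qed.

(** * Laplace transform of a step function *)

Section LaplaceStep.
Context {R : realType}.
Implicit Types (a b p q s W : R).
Local Notation mu := (@lebesgue_measure R).
Local Notation D := `[0, +oo[%classic.

(** A family closed under differentiation in [s], which acts linearly on $(p,q)$; antiderivatives
    amount to a two by two linear system. *)
Let trig a b p q s : R := expR (- (a * s)) * (p * cos (b * s) + q * sin (b * s)).

Let cvg_trig a b p q : 0 < a -> trig a b p q s @[s --> +oo%R] --> (0 : R).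
Proof.
move=> a0; have e0 : (`|p| + `|q|) * expR (- (a * s)) @[s --> +oo%R] --> (0 : R).
  rewrite -(mulr0 (`|p| + `|q|)); apply: cvgM; first exact: cvg_cst.
  apply: (@cvg_comp _ _ _ (fun s => a * s) (fun x => expR (- x)) _ _ _ _ (@cvgr_expR R)).
  apply/cvgryPge => A; near=> s.
  rewrite -ler_pdivrMl//; near: s; exact: nbhs_pinfty_ge.
apply/cvgr0Pnorm_lt => e e_gt0.
move/cvgr0Pnorm_lt : e0 => /(_ e e_gt0); apply: filterS => s; apply: le_lt_trans.
rewrite /trig normrM ger0_norm ?expR_ge0// normrM [X in _ <= _ * X]ger0_norm ?expR_ge0// mulrC.
rewrite ler_wpM2r ?expR_ge0// [leRHS]ger0_norm ?addr_ge0//.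
apply: (le_trans (ler_normD _ _)); rewrite !normrM; apply: lerD; apply: ler_piMr => //.
  by rewrite ler_norml cos_geN1 cos_le1.
by rewrite ler_norml sin_geN1 sin_le1.
Unshelve. all: by end_near. Qed.

Let derive_trig a b p q s : is_derive s 1 (trig a b p q)
  (trig a b (- a * p + b * q) (- a * q - b * p) s).
Proof.
have dE : is_derive s 1 (fun s => expR (- (a * s))) (- a * expR (- (a * s))).
  have d1 : is_derive s 1 (fun s => - (a * s)) (- a).
    by apply: is_derive_eq; rewrite /GRing.scale/= mulr1.
  have h := @is_derive1_comp R expR (fun x => - (a * x)) s _ _ (is_derive_expR (- (a * s))) d1.
  by apply: (is_derive_eq h); rewrite mulrC.
have db : is_derive s 1 (fun s => b * s) b.
  by apply: is_derive_eq; rewrite /GRing.scale/= mulr1.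
have dC : is_derive s 1 (fun s => cos (b * s)) (- b * sin (b * s)).
  have h := @is_derive1_comp R cos (fun x => b * x) s _ _ (is_derive_cos (b * s)) db.
  by apply: (is_derive_eq h); rewrite mulrC mulrN mulNr.
have dS : is_derive s 1 (fun s => sin (b * s)) (b * cos (b * s)).
  have h := @is_derive1_comp R sin (fun x => b * x) s _ _ (is_derive_sin (b * s)) db.
  by apply: (is_derive_eq h); rewrite mulrC.
have := is_deriveM dE (is_deriveD (is_deriveZ p dC) (is_deriveZ q dS)).
move=> h; apply: (is_derive_eq h).
transitivity (expR (- (a * s)) * (p * (- b * sin (b * s)) + q * (b * cos (b * s)))
  + (p * cos (b * s) + q * sin (b * s)) * (- a * expR (- (a * s)))); first by [].
by rewrite /trig; ring.
Qed.

(** Adding $e^{-as}$ makes the integrand nonnegative, as the fundamental theorem on a half-line used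
    here requires. The coefficients $P,Q$ solve $-aP+bQ=p$, $-aQ-bP=q$, and the antiderivative
    vanishes at infinity. *)
Let integral_trig_ge0 a b p q W : 0 < a -> (forall x, 0 <= 1 + p * cos (b * x) + q * sin (b * x)) ->
  (\int[mu]_(s in `[W, +oo[) (trig a b p q s + expR (- (a * s)))%:E)%E
  = (- trig a b (- (a * p + b * q) / (a ^+ 2 + b ^+ 2)) ((b * p - a * q) / (a ^+ 2 + b ^+ 2)) W
    + expR (- (a * W)) / a)%:E.
Proof.
move=> a0 pq.
pose P := - (a * p + b * q) / (a ^+ 2 + b ^+ 2).
pose Q := (b * p - a * q) / (a ^+ 2 + b ^+ 2).
have ab0 : a ^+ 2 + b ^+ 2 != 0 by rewrite gt_eqF// ltr_wpDr ?sqr_ge0// exprn_gt0.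
have tE s c : trig a 0 c 0 s = c * expR (- (a * s)).
  by rewrite /trig mul0r cos0 mul0r addr0 mulr1 mulrC.
pose Phi s := trig a b P Q s + trig a 0 (- a^-1) 0 s.
have dPhi s : is_derive s 1 Phi (trig a b p q s + expR (- (a * s))).
  apply: (is_derive_eq (is_deriveD (derive_trig a b P Q s) (derive_trig a 0 (- a^-1) 0 s))).
  congr (_ + _).
    by congr (trig a b _ _ s); rewrite /P /Q; field.
  rewrite /trig !mul0r cos0 sin0 !mulr0 !addr0 mulr1 mulrNN divff ?mulr1//.
  by rewrite gt_eqF.
have cdPhi s : {for s, continuous Phi}.
  by apply/differentiable_continuous/derivable1_diffP; have [] := dPhi s.
rewrite (@ge0_continuous_FTC2y _ _ Phi _ 0).
- rewrite /Phi tE -/P -/Q; congr EFin; rewrite sub0r; ring.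
- move=> s _; rewrite /trig -[X in _ + X]mulr1 -mulrDr mulr_ge0 ?expR_ge0//.
  by have := pq s; lra.
- apply: continuous_subspaceT => s.
  apply/differentiable_continuous/derivable1_diffP; apply: derivableD.
    by have [] := derive_trig a b p q s.
  have [] := derive_trig a 0 1 0 s; rewrite (_ : trig a 0 1 0 = fun s => expR (- (a * s)))//.
  by apply/funext => x; rewrite tE mul1r.
- by rewrite -(addr0 0); apply: cvgD; exact: cvg_trig.
- by move=> s _; have [] := dPhi s.
- exact/cvg_at_right_filter/cdPhi.
- by move=> s _; rewrite derive1E; exact: derive_val.
Qed.

Let integrable_ge0 (f : R -> R) W (l : R) : measurable_fun setT f -> (forall s, 0 <= f s) ->
  (\int[mu]_(s in `[W, +oo[) (f s)%:E = l%:E)%E -> mu.-integrable `[W, +oo[ (EFin \o f).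
Proof.
move=> mf f0 fl; apply/integrableP; split; first exact/measurable_EFinP/measurable_funTS.
by under eq_integral do rewrite /= ger0_norm//; rewrite fl ltry.
Qed.

Let mtrig a b p q : measurable_fun setT (trig a b p q).
Proof.
apply: continuous_measurable_fun => s.
by apply/differentiable_continuous/derivable1_diffP; have [] := derive_trig a b p q s.
Qed.

(** The added exponential is removed by subtracting the case $p=q=0$. *)
Let integral_trig a b p q W : 0 < a -> (forall x, 0 <= 1 + p * cos (b * x) + q * sin (b * x)) ->
  mu.-integrable `[W, +oo[ (EFin \o trig a b p q) /\
  \int[mu]_(s in `[W, +oo[) trig a b p q s
  = - trig a b (- (a * p + b * q) / (a ^+ 2 + b ^+ 2)) ((b * p - a * q) / (a ^+ 2 + b ^+ 2)) W.
Proof.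
move=> a0 pq.
have mW : measurable (`[W, +oo[%classic : set (measurableTypeR R)) by exact: measurable_itv.
have i1 := integral_trig_ge0 W a0 pq.
have pos0 x : 0 <= 1 + 0 * cos (b * x) + 0 * sin (b * x) by rewrite !mul0r !addr0.
have i2 := integral_trig_ge0 W a0 pos0.
have me : measurable_fun setT (fun s => expR (- (a * s)) : R).
  apply: measurableT_comp; first exact: measurable_expR.
  by apply: measurableT_comp => //; apply: measurable_funM.
have t0 s : trig a b 0 0 s = 0 by rewrite /trig !mul0r addr0 mulr0.
have e0 p' q' s : (forall x, 0 <= 1 + p' * cos (b * x) + q' * sin (b * x)) ->
    0 <= trig a b p' q' s + expR (- (a * s)).
  move=> pq'; rewrite /trig -[X in _ + X]mulr1 -mulrDr mulr_ge0 ?expR_ge0//.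
  by have := pq' s; lra.
have I1 := integrable_ge0 (measurable_funD (mtrig a b p q) me) (fun s => e0 p q s pq) i1.
have I2 := integrable_ge0 (measurable_funD (mtrig a b 0 0) me) (fun s => e0 0 0 s pos0) i2.
have E s : trig a b p q s = (trig a b p q s + expR (- (a * s))) - (trig a b 0 0 s + expR (- (a * s))).
  by rewrite t0 add0r addrK.
split.
  apply: (eq_integrable mW _ _ _ (integrableB mW I1 I2)) => s _.
  by rewrite /= -EFinB [in RHS]E.
have h := RintegralB mW I1 I2.
have r1 := congr1 fine i1; have r2 := congr1 fine i2.
have -> : \int[mu]_(s in `[W, +oo[) trig a b p q s =
   \int[mu]_(s in `[W, +oo[) (trig a b p q s + expR (- (a * s)) - (trig a b 0 0 s + expR (- (a * s)))).
  by apply: eq_Rintegral => s _; rewrite [LHS]E.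
apply: (etrans h); rewrite [X in X - _]r1 [X in _ - X]r2 /=.
rewrite (_ : trig a b (- (a * 0 + b * 0) / _) _ W = 0); last first.
  by rewrite !mulr0 !addr0 subrr oppr0 !mul0r t0.
by rewrite oppr0 add0r addrK.
Qed.

Let cexp_neg a b s : cexp (- ((a +i* b) * s%:C)) =
  (expR (- (a * s)) * cos (b * s)) +i* (- (expR (- (a * s)) * sin (b * s))).
Proof.
rewrite /cexp ReN ImN ReM ImM /= !mulr0 subr0 add0r cosN sinN mulrN//.
Qed.

(** Real and imaginary parts are [trig] with $(p,q)=(1,0)$ and $(0,-1)$; the positivity condition
    becomes $1+\cos\ge 0$ and $1-\sin\ge 0$. *)
Lemma laplace_step (y : R[i]) (W : R) : 0 < complex.Re y -> 0 <= W ->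
  cintegrable mu D (fun s => cexp (- (y * s%:C)) * (if W <= s then 1 else 0)) /\
  cintegral mu D (fun s => cexp (- (y * s%:C)) * (if W <= s then 1 else 0))
    = cexp (- (y * W%:C)) / y.
Proof.
case: y => a b /= a0 W0.
have mW : measurable (`[W, +oo[%classic : set (measurableTypeR R)) by exact: measurable_itv.
have mD : measurable (D : set (measurableTypeR R)) by exact: measurable_itv.
have [ic ec] := @integral_trig a b 1 0 W a0 (fun x => ltac:(by have := cos_geN1 (b * x); lra)).
have [iS eS] := @integral_trig a b 0 (-1) W a0 (fun x => ltac:(by have := sin_le1 (b * x); lra)).
have re s : complex.Re (cexp (- ((a +i* b) * s%:C)) * (if W <= s then 1 else 0)) =
    (trig a b 1 0 \_ `[W, +oo[) s.
  rewrite patchE mem_setE in_itv/= andbT; case: ifP => _; last by rewrite mulr0.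
  by rewrite mulr1 cexp_neg /trig mul1r mul0r addr0.
have im s : complex.Im (cexp (- ((a +i* b) * s%:C)) * (if W <= s then 1 else 0)) =
    (trig a b 0 (-1) \_ `[W, +oo[) s.
  rewrite patchE mem_setE in_itv/= andbT; case: ifP => _; last by rewrite mulr0.
  by rewrite mulr1 cexp_neg /trig mul0r add0r mulN1r mulrN.
have sub : `[W, +oo[%classic `<=` (D : set R).
  by move=> x; rewrite /= !in_itv/= !andbT; exact: le_trans.
have DW : (D : set R) `&` `[W, +oo[ = `[W, +oo[%classic by apply: setIidr.
split; first split.
- apply: (eq_integrable mD _ _ _ ((integrable_restrict mu mW mD _).1 _)); last by rewrite DW; exact: ic.
  by move=> s _; rewrite restrict_EFin /= -re.
- apply: (eq_integrable mD _ _ _ ((integrable_restrict mu mW mD _).1 _)); last by rewrite DW; exact: iS.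
  by move=> s _; rewrite restrict_EFin /= -im.
have ab0 : a ^+ 2 + b ^+ 2 != 0 by rewrite gt_eqF// ltr_wpDr ?sqr_ge0// exprn_gt0.
apply: complex_ext.
  rewrite [LHS](_ : _ = \int[mu]_(x in D) (trig a b 1 0 \_ `[W, +oo[) x); last first.
    by apply: eq_Rintegral => s _; rewrite -re.
  rewrite -Rintegral_mkcondr DW ec cexp_neg /trig /=.
  by field.
rewrite [LHS](_ : _ = \int[mu]_(x in D) (trig a b 0 (-1) \_ `[W, +oo[) x); last first.
  by apply: eq_Rintegral => s _; rewrite -im.
rewrite -Rintegral_mkcondr DW eS cexp_neg /trig /=.
by field.
Qed.

End LaplaceStep.

(** * Bounded measurable functions and products of independent variables *)

Section BoundedMeasurable.
Context {R : realType} d (T : measurableType d).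
Implicit Types f g : T -> R[i].

(** An algebra of functions, all integrable against any probability; it contains the random
    integrands whose expectations are split below. *)
Definition cbounded f := cmeasurable setT f /\ exists c : R, forall x, normc (f x) <= c.

Lemma cbounded_cst z : cbounded (fun=> z).
Proof. by split; [exact: cmeasurable_cst|exists (normc z)]. Qed.

Lemma cboundedD f g : cbounded f -> cbounded g -> cbounded (fun x => f x + g x).
Proof.
move=> [mf [a fa]] [mg [b gb]]; split; first exact: cmeasurableD.
by exists (a + b) => x; apply: (le_trans (le_normcD _ _)); exact: lerD.
Qed.

Lemma cboundedM f g : cbounded f -> cbounded g -> cbounded (fun x => f x * g x).
Proof.
move=> [mf [a fa]] [mg [b gb]]; split; first exact: cmeasurableM.
by exists (a * b) => x; rewrite Normc.normcM; apply: ler_pM; rewrite ?normc_ge0.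
Qed.

Lemma cboundedZ z f : cbounded f -> cbounded (fun x => z * f x).
Proof. by move=> bf; apply: cboundedM => //; exact: cbounded_cst. Qed.

Lemma cboundedB f g : cbounded f -> cbounded g -> cbounded (fun x => f x - g x).
Proof.
move=> bf bg; under eq_fun do rewrite -[- g _]mulN1r.
by apply: cboundedD => //; exact: cboundedZ.
Qed.

Lemma cbounded_sum (I : Type) (r : seq I) (F : I -> T -> R[i]) :
  (forall i, cbounded (F i)) -> cbounded (fun x => \sum_(i <- r) F i x).
Proof.
move=> bF; elim: r => [|i r ih].
  by under eq_fun do rewrite big_nil; exact: cbounded_cst.
by under eq_fun do rewrite big_cons; exact: cboundedD.
Qed.

Lemma cbounded_prod (I : Type) (r : seq I) (F : I -> T -> R[i]) :
  (forall i, cbounded (F i)) -> cbounded (fun x => \prod_(i <- r) F i x).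
Proof.
move=> bF; elim: r => [|i r ih].
  by under eq_fun do rewrite big_nil; exact: cbounded_cst.
by under eq_fun do rewrite big_cons; exact: cboundedM.
Qed.

Lemma cbounded_le1 f : cmeasurable setT f -> (forall x, normc (f x) <= 1) -> cbounded f.
Proof. by move=> mf f1; split => //; exists 1. Qed.

Lemma cbounded_indic (A : set T) : measurable A -> cbounded (fun x => (\1_A x : R)%:C).
Proof.
move=> mA; apply: cbounded_le1 => [|x].
  by apply: cmeasurable_real; exact: measurable_indic.
by rewrite normc_real indicE; case: (_ \in _); rewrite ?normr1 ?normr0.
Qed.

Variable P : probability T R.

Lemma cbounded_cintegrable f : cbounded f -> cintegrable P setT f.
Proof. by move=> [mf [c fc]]; exact: cintegrable_bounded fc. Qed.

Lemma cexpectationD f g : cbounded f -> cbounded g ->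
  cexpectation P (fun x => f x + g x) = cexpectation P f + cexpectation P g.
Proof. by move=> bf bg; rewrite !cexpectationE cintegralD//; exact: cbounded_cintegrable. Qed.

Lemma cexpectationB f g : cbounded f -> cbounded g ->
  cexpectation P (fun x => f x - g x) = cexpectation P f - cexpectation P g.
Proof. by move=> bf bg; rewrite !cexpectationE cintegralB//; exact: cbounded_cintegrable. Qed.

Lemma cexpectationZ z f : cbounded f ->
  cexpectation P (fun x => z * f x) = z * cexpectation P f.
Proof. by move=> bf; rewrite !cexpectationE cintegralZ//; exact: cbounded_cintegrable. Qed.

Lemma cexpectation_sum (I : Type) (r : seq I) (F : I -> T -> R[i]) :
  (forall i, cbounded (F i)) ->
  cexpectation P (fun x => \sum_(i <- r) F i x) = \sum_(i <- r) cexpectation P (F i).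
Proof.
move=> bF; rewrite cexpectationE cintegral_sum//; last by move=> i; exact: cbounded_cintegrable.
by apply: eq_bigr => i _; rewrite cexpectationE.
Qed.

Lemma cexpectation_indic (A : set T) : measurable A ->
  cexpectation P (fun x => (\1_A x : R)%:C) = (fine (P A))%:C.
Proof.
move=> mA; rewrite cexpectationE /cintegral /= Rintegral_cst// mul0r.
by rewrite /Rintegral integral_indic// setIT.
Qed.

Lemma cexpectation_dist f g c : cbounded f -> cbounded g ->
  (forall x, normc (f x - g x) <= c) ->
  normc (cexpectation P f - cexpectation P g) <= c.
Proof.
move=> bf bg fg; rewrite -cexpectationB//; apply: normc_cexpectation => //.
by have [] := cboundedB bf bg.
Qed.

Lemma cexpectation_dist_indic f g (A : set T) c : cbounded f -> cbounded g -> measurable A ->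
  (forall x, normc (f x - g x) <= c * \1_A x) ->
  normc (cexpectation P f - cexpectation P g) <= c * fine (P A).
Proof.
move=> bf bg mA fg; rewrite -cexpectationB// cexpectationE.
have ic : P.-integrable setT (EFin \o (fun x => c * \1_A x)).
  apply: (@integrable_bounded _ _ _ P _ `|c|) => [|x].
    by apply: measurable_funM => //; exact: measurable_indic.
  by rewrite normrM ler_piMr// indicE; case: (_ \in _); rewrite ?normr1 ?normr0.
apply: (le_trans (normc_cintegral measurableT (cbounded_cintegrable (cboundedB bf bg)) ic _)) => //.
rewrite RintegralZl//; first by rewrite {1}/Rintegral integral_indic// setIT.
apply: (@integrable_bounded _ _ _ P _ 1) => [|x]; first exact: measurable_indic.
by rewrite indicE; case: (_ \in _); rewrite ?normr1 ?normr0.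
Qed.

End BoundedMeasurable.

Lemma cbounded_comp {R : realType} d d' (T : measurableType d) (T' : measurableType d')
    (h : T -> T') (f : T' -> R[i]) :
  measurable_fun setT h -> cbounded f -> cbounded (fun x => f (h x)).
Proof. by move=> mh [mf [c fc]]; split; [exact: cmeasurable_comp|exists c]. Qed.

Section Extension.
Context {R : realType} d d' (T : measurableType d) (T' : measurableType d')
  (P : probability T R).
Variables (X : T -> T') (Z : T -> R[i]) (kappa : R[i]).
Hypotheses (mX : measurable_fun setT X) (bZ : cbounded Z).
Hypothesis ZX : forall A, measurable A ->
  cexpectation P (fun w => Z w * (\1_A (X w) : R)%:C)
  = kappa * cexpectation P (fun w => (\1_A (X w) : R)%:C).

Let bind A : measurable A -> cbounded (fun w => (\1_A (X w) : R)%:C).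
Proof.
move=> mA; apply: (cbounded_comp mX (f := fun x => (\1_A x : R)%:C)).
exact: cbounded_indic.
Qed.

(* Approximation of [h] by its truncations to multiples of [1 / N]. *)
Let extend_real (h : T' -> R) (C : R) : measurable_fun setT h -> (forall x, 0 <= h x <= C) ->
  cexpectation P (fun w => Z w * (h (X w))%:C) = kappa * cexpectation P (fun w => (h (X w))%:C).
Proof.
move=> mh hC; pose q N x := Num.truncn (N.+1%:R * h x).
pose A N k := [set x | k%:R <= N.+1%:R * h x < k.+1%:R].
have mA N k : measurable (A N k).
  rewrite /A (_ : [set _ | _] = (fun x => N.+1%:R * h x) @^-1` `[k%:R, k.+1%:R[%classic); last first.
    by apply/seteqP; split => x /=; rewrite in_itv.
  rewrite -[X in measurable X]setTI; apply: measurable_funM => //; exact: measurable_itv.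
have Nh0 N x : 0 <= N.+1%:R * h x by rewrite mulr_ge0//; case/andP: (hC x).
have AE N k x : \1_(A N k) x = (q N x == k)%:R :> R.
  rewrite indicE; congr (_%:R); congr nat_of_bool; apply/idP/eqP => [/set_mem /= h1|<-].
    by apply/truncn_def; rewrite // h1.
  by apply/mem_set => /=; exact: truncn_itv.
pose B N := (Num.truncn (N.+1%:R * C)).+1.
have qB N x : (q N x < B N)%N.
  rewrite ltnS; apply: le_truncn; rewrite ler_wpM2l//.
  by case/andP: (hC x).
pose hN N x : R := (q N x)%:R / N.+1%:R.
have hNE N x : (hN N x)%:C = \sum_(k < B N) (k%:R / N.+1%:R : R)%:C * (\1_(A N k) x : R)%:C.
  rewrite (bigD1 (Ordinal (qB N x)))//= AE eqxx mulr1 big1 ?addr0// => i.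
  move=> iq; rewrite AE (_ : q N x == i = false) ?mulr0//.
  by apply/negbTE; apply: contra iq => /eqP qi; apply/eqP/val_inj.
have hNh N x : `|h x - hN N x| <= N.+1%:R^-1.
  have /andP[h1 h2] := truncn_itv (Nh0 N x).
  have N0 : 0 < N.+1%:R :> R by [].
  have hd : N.+1%:R * (h x - hN N x) = N.+1%:R * h x - (q N x)%:R.
    by rewrite mulrBr /hN mulrCA divff ?mulr1// gt_eqF.
  rewrite -(ler_pM2l N0) divff ?gt_eqF// -[X in X * _](ger0_norm (ltW N0)) -normrM hd.
  rewrite ger0_norm ?subr_ge0// lerBlDr; apply/ltW; apply: lt_le_trans h2 _.
  by rewrite -[(_).+1]addn1 natrD addrC.
have bhN N : cbounded (fun w => (hN N (X w))%:C).
  under eq_fun do rewrite hNE.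
  by apply: cbounded_sum => k; apply: cboundedZ; exact: bind.
have bh : cbounded (fun w => (h (X w))%:C).
  apply: (cbounded_comp mX (f := fun x => (h x)%:C)); split; first exact: cmeasurable_real.
  by exists C => x; rewrite normc_real; have /andP[h0 h1] := hC x; rewrite ger0_norm.
have step N : cexpectation P (fun w => Z w * (hN N (X w))%:C)
    = kappa * cexpectation P (fun w => (hN N (X w))%:C).
  under [in LHS]eq_cexpectation do rewrite hNE mulr_sumr.
  under [in RHS]eq_cexpectation do rewrite hNE.
  rewrite !cexpectation_sum.
  - rewrite mulr_sumr; apply: eq_bigr => k _.
    under eq_cexpectation do rewrite mulrCA.
    have b1 := bind (mA N k); have b2 := cboundedM bZ b1.
    by rewrite (cexpectationZ P _ b2) (cexpectationZ P _ b1) ZX// mulrCA.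
  - by move=> k; apply: cboundedZ; exact: bind.
  - by move=> k; apply: cboundedM => //; apply: cboundedZ; exact: bind.
have [c Zc] := bZ.2.
apply: (@clim_unique _ (fun N => cexpectation P (fun w => Z w * (hN N (X w))%:C))).
  apply: (@clim_bound _ _ _ (fun N => c * N.+1%:R^-1)).
    by rewrite -(mulr0 c); apply: cvgM; [exact: cvg_cst|exact: cvg_harmonic].
  move=> N; apply: cexpectation_dist; [exact: cboundedM|exact: cboundedM|].
  move=> w; rewrite -mulrBr Normc.normcM -rmorphB normc_real distrC.
  by apply: ler_pM; rewrite ?normc_ge0.
under eq_fun do rewrite step; apply: climZ.
apply: (@clim_bound _ _ _ (fun N => N.+1%:R^-1)); first exact: cvg_harmonic.
move=> N; apply: cexpectation_dist => // w.
by rewrite -rmorphB normc_real distrC.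
Qed.

(** Real and imaginary parts are made nonnegative by adding a constant, so that [extend_real]
    applies; the constant is then subtracted again. *)
Lemma cexpectation_extension (f : T' -> R[i]) : cbounded f ->
  cexpectation P (fun w => Z w * f (X w)) = kappa * cexpectation P (fun w => f (X w)).
Proof.
move=> [[mr mi] [C fC]].
pose C' := `|C|.
have fC' x : normc (f x) <= C' by apply: (le_trans (fC x)); exact: ler_norm.
pose hr x := complex.Re (f x) + C'; pose hi x := complex.Im (f x) + C'.
have hrC x : 0 <= hr x <= C' + C'.
  have := le_trans (normc_Re (f x)) (fC' x); rewrite ler_norml /hr => /andP[? ?]; lra.
have hiC x : 0 <= hi x <= C' + C'.
  have := le_trans (normc_Im (f x)) (fC' x); rewrite ler_norml /hi => /andP[? ?]; lra.
have mhr : measurable_fun setT hr by apply: measurable_funD.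
have mhi : measurable_fun setT hi by apply: measurable_funD.
have er := extend_real mhr hrC; have ei := extend_real mhi hiC.
have bnd (h : T' -> R) : measurable_fun setT h -> (forall x, 0 <= h x <= C' + C') ->
    cbounded (fun w => (h (X w))%:C).
  move=> mh hC; apply: (cbounded_comp mX (f := fun x => (h x)%:C)); split; first exact: cmeasurable_real.
  by exists (C' + C') => x; rewrite normc_real; have /andP[h0 h1] := hC x; rewrite ger0_norm.
have br := bnd _ mhr hrC; have bi := bnd _ mhi hiC.
pose c : R[i] := C' +i* C'.
have fE w : f (X w) = (hr (X w))%:C + 'i * (hi (X w))%:C - c.
  apply: complex_ext; rewrite !ReImE /= /hr /hi; ring.
(* The hypothesis on the whole space identifies [kappa], which is what the subtracted constant calls
   for. *)
have EZ : cexpectation P Z = kappa.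
  have := ZX measurableT; rewrite (_ : (fun w => (\1_setT (X w) : R)%:C) = fun=> 1); last first.
    by apply/funext => w; rewrite indicT.
  rewrite cexpectation_cst mulr1 => <-; apply: eq_cexpectation => w.
  by rewrite indicT mulr1.
under [in RHS]eq_cexpectation do rewrite fE.
have bc := cbounded_cst T c.
rewrite (cexpectationB P (cboundedD br (cboundedZ 'i bi)) bc).
rewrite (cexpectationD P br (cboundedZ 'i bi)) (cexpectationZ P 'i bi) cexpectation_cst.
under eq_cexpectation do rewrite fE mulrBr mulrDr [Z _ * ('i * _)]mulrCA [Z _ * c]mulrC.
have b1 := cboundedM bZ br; have b2 := cboundedM bZ bi.
rewrite (cexpectationB P (cboundedD b1 (cboundedZ 'i b2)) (cboundedZ c bZ)).
rewrite (cexpectationD P b1 (cboundedZ 'i b2)) (cexpectationZ P 'i b2) (cexpectationZ P c bZ).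
by rewrite er ei EZ; ring.
Qed.

End Extension.

Section IndependentProducts.
Context {R : realType} d d' (T : measurableType d) (T' : measurableType d')
  (P : probability T R) (I : choiceType) (X : I -> {RV P >-> T'}).
Hypothesis indX : mutually_independent P (fun i => preimage_set_system setT (X i) measurable).

Let mXA i A : measurable A -> measurable (X i @^-1` A).
Proof. by move=> mA; rewrite -[X in measurable X]setTI; exact: measurable_funP. Qed.

Let bindX i A : measurable A -> cbounded (fun w => (\1_A (X i w) : R)%:C).
Proof.
move=> mA; apply: (cbounded_comp (measurable_funP (X i)) (f := fun x => (\1_A x : R)%:C)).
exact: cbounded_indic.
Qed.

Let prod_indic (J : {fset I}) (A : I -> set T') : (forall i, measurable (A i)) ->
  cexpectation P (fun w => \prod_(i <- J) (\1_(A i) (X i w) : R)%:C)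
  = \prod_(i <- J) cexpectation P (fun w => (\1_(A i) (X i w) : R)%:C).
Proof.
move=> mA.
have E i : cexpectation P (fun w => (\1_(A i) (X i w) : R)%:C) = (fine (P (X i @^-1` A i)))%:C.
  by rewrite -cexpectation_indic//; exact: mXA.
have H : fine (P (\bigcap_(i in [set` J]) X i @^-1` A i)) = \prod_(i <- J) fine (P (X i @^-1` A i)).
  rewrite (indX (J := J) (A := fun i => X i @^-1` A i)); last first.
    by move=> i _; exists (A i) => //; rewrite setTI.
  rewrite -[RHS]/(fine (\prod_(i <- J) fine (P (X i @^-1` A i)))%:E); congr fine.
  elim/big_ind2 : _ => [//|x u y v -> ->|i _]; first by rewrite EFinM.
  by rewrite fineK// fin_num_measure//; exact: mXA.
rewrite (_ : (fun w => _) = (fun w => (\1_(\bigcap_(i in [set` J]) X i @^-1` A i) w : R)%:C)); last first.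
  apply/funext => w; rewrite -rmorph_prod; congr (_%:C).
  have [wA|wA] := pselect ((\bigcap_(i in [set` J]) X i @^-1` A i) w).
    rewrite indicE mem_set// big_seq big1// => i iJ.
    by rewrite indicE mem_set//; exact: (wA i).
  rewrite indicE memNset//; apply/eqP; rewrite prodf_seq_eq0; apply/hasP.
  move/existsNP : wA => [i /not_implyP[iJ wi]]; exists i => //.
  by rewrite /= indicE memNset.
rewrite cexpectation_indic; first by rewrite H rmorph_prod; apply: eq_bigr.
by apply: fin_bigcap_measurable => [|i _]; [exact: finite_fset|exact: mXA].
Qed.

(** Independence speaks of events, so indicators are replaced by functions one factor at a time,
    each time through [cexpectation_extension] with the other factors playing the role of [Z]. *)
Lemma cexpectation_prod (s : seq I) (f : I -> T' -> R[i]) : uniq s ->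
  (forall i, cbounded (f i)) ->
  cexpectation P (fun w => \prod_(i <- s) f i (X i w))
  = \prod_(i <- s) cexpectation P (fun w => f i (X i w)).
Proof.
move=> us bf.
have bfX i : cbounded (fun w => f i (X i w)) by exact: cbounded_comp.
(* The indices in [J] still carry indicators of arbitrary sets, those in [s] already carry
   functions; the induction moves one index across. *)
suff gen : forall (J : {fset I}) (A : I -> set T'), (forall i, measurable (A i)) ->
    (forall i, i \in s -> i \notin J) ->
    cexpectation P (fun w => (\prod_(i <- s) f i (X i w)) * \prod_(i <- J) (\1_(A i) (X i w) : R)%:C)
    = (\prod_(i <- s) cexpectation P (fun w => f i (X i w)))
      * \prod_(i <- J) cexpectation P (fun w => (\1_(A i) (X i w) : R)%:C).
  have := gen fset0 (fun=> setT) (fun=> measurableT); rewrite big_seq_fset0 mulr1 => <-.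
    by apply: eq_cexpectation => w; rewrite big_seq_fset0 mulr1.
  by move=> i _; rewrite inE.
elim: s us => [_|i s ih /= /andP[iNs us]] J A mA sJ.
  rewrite big_nil mul1r -prod_indic//.
  by apply: eq_cexpectation => w; rewrite big_nil mul1r.
have iJ : i \notin J by apply: sJ; rewrite inE eqxx.
under eq_cexpectation do rewrite big_cons -mulrA mulrC.
rewrite big_cons mulrAC [RHS]mulrC mulrA.
rewrite (cexpectation_extension (kappa := (\prod_(i <- s) cexpectation P (fun w => f i (X i w)))
      * \prod_(i <- J) cexpectation P (fun w => (\1_(A i) (X i w) : R)%:C)) (measurable_funP (X i))) //.
- by rewrite mulrAC.
- by apply: cboundedM; apply: cbounded_prod => // j; exact: bindX.
(* The test set [B] for [X i] is adjoined to the family of indicators, so the induction hypothesis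
   is used on the larger index set. *)
move=> B mB; pose A' j := if j == i then B else A j.
have A'J j : j \in J -> A' j = A j.
  by move=> jJ; rewrite /A' ifF//; apply/negbTE; apply: contraNneq iJ => <-.
have A'i : A' i = B by rewrite /A' eqxx.
have mA' j : measurable (A' j) by rewrite /A'; case: ifP.
have sJ' j : j \in s -> j \notin (i |` J)%fset.
  move=> js; rewrite !inE negb_or sJ ?andbT ?inE ?js ?orbT//.
  by apply: contraNneq iNs => <-.
have prodA' (F : set T' -> I -> R[i]) : \prod_(j <- J) F (A' j) j = \prod_(j <- J) F (A j) j.
  by rewrite !big_seq; apply: eq_bigr => j jJ; rewrite A'J.
have := ih us (i |` J)%fset A' mA' sJ'; rewrite big_fsetU1//= A'i.
rewrite (prodA' (fun S j => cexpectation P (fun w => (\1_S (X j w) : R)%:C))).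
rewrite mulrCA [RHS]mulrC => <-; apply: eq_cexpectation => w.
rewrite big_fsetU1//= A'i (prodA' (fun S j => (\1_S (X j w) : R)%:C)).
by rewrite mulrAC -!mulrA; congr (_ * _); rewrite mulrC.
Qed.

End IndependentProducts.

Lemma cexpectation_eq_distribution {R : realType} d d' (T : measurableType d)
    (T' : measurableType d') (P : probability T R) (X Y : {RV P >-> T'}) (f : T' -> R[i]) :
  (forall A, measurable A -> distribution P X A = distribution P Y A) -> cbounded f ->
  cexpectation P (fun w => f (X w)) = cexpectation P (fun w => f (Y w)).
Proof.
move=> XY bf.
have [[mr mi] [c fc]] := bf.
have real (h : T' -> R) : measurable_fun setT h -> (forall x, `|h x| <= c) ->
    \int[P]_w h (X w) = \int[P]_w h (Y w).
  move=> mh hc; rewrite /Rintegral; congr fine.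
  have int (Z : {RV P >-> T'}) : P.-integrable setT ((EFin \o h) \o Z).
    apply: (@integrable_bounded _ _ _ P (h \o Z) c) => [|w]; last exact: hc.
    exact: measurableT_comp.
  have mh' : measurable_fun setT (EFin \o h) by exact/measurable_EFinP.
  rewrite -[LHS](integral_distribution mh' (int X)) -[RHS](integral_distribution mh' (int Y)).
  by apply: eq_measure_integral => A mA _; exact: XY.
rewrite !cexpectationE /cintegral (real _ mr) ?(real _ mi)// => x.
  exact: le_trans (normc_Im _) (fc x).
exact: le_trans (normc_Re _) (fc x).
Qed.

Section PiSystemIndependence.
Context {R : realType} d d' (T : measurableType d) (T' : measurableType d')
  (P : probability T R) (Y : {RV P >-> T'}) (G : set (set T')) (A : set T).
Hypotheses (mA : measurable A) (mG : @measurable _ T' = <<s G >>) (GI : setI_closed G)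
  (GT : G setT).
Hypothesis AG : forall B, G B -> P (A `&` Y @^-1` B) = (P A * P (Y @^-1` B))%E.

(** Both sides are finite measures in [B], the law of [Y] restricted to [A] and the law of [Y]
    scaled by $P(A)$; they agree on a generating system stable under intersection. *)
Lemma independent_pi_system B : measurable B ->
  P (A `&` Y @^-1` B) = (P A * P (Y @^-1` B))%E.
Proof.
move=> mB.
have PA : (fine (P A))%:E = P A by rewrite fineK// fin_num_measure.
have PA0 : 0 <= fine (P A) by exact: fine_ge0.
pose m1 : {measure set T' -> \bar R} := pushforward (mrestr P mA) Y.
pose m2 : {measure set T' -> \bar R} := mscale (NngNum PA0) (distribution P Y).
have m1E C : m1 (measurable_funP Y) C = P (A `&` Y @^-1` C) by rewrite setIC.
have m2E C : m2 C = (P A * P (Y @^-1` C))%E by rewrite -[in RHS]PA.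
rewrite -m1E -m2E; apply: (measure_unique G (fun=> setT)) => //.
- by rewrite -subTset => x _; exists 0%N.
- by move=> C GC; rewrite m1E m2E; exact: AG.
- move=> _; rewrite m1E preimage_setT setIT.
  by rewrite (le_lt_trans (probability_le1 _ mA)) ?ltry.
Qed.

End PiSystemIndependence.

(** * Poisson transforms *)

Section ExponentialSeries.
Context {R : realType}.
Implicit Types (c : R) (z w : R[i]).

(** The associated series in a real $c$ is that of $\mathrm{Re}(w e^{cz})$, and differentiation
    multiplies $w$ by $z$. The choices $w=1$ and $w=i$ give the real part and minus the imaginary
    part of the exponential. *)
Let coef z w k : R := complex.Re (w * z ^+ k) / k`!%:R.
Let S z w c : R := limn (pseries (coef z w) c).

Let coef_cvg z w c : cvgn (pseries (coef z w) c).
Proof.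
apply: normed_cvg; apply: (series_le_cvg (v_ := fun k => normc w * (normc z * `|c|) ^+ k / k`!%:R)) => [k|k|k|].
- exact: normr_ge0.
- by rewrite divr_ge0 ?mulr_ge0 ?exprn_ge0 ?mulr_ge0 ?normc_ge0.
- rewrite (_ : normc w * _ / _ = normc (w * z ^+ k) / k`!%:R * `|c| ^+ k); last first.
    by rewrite Normc.normcM normcX exprMn; ring.
  rewrite /= /coef !normrM normfV normrX normr_nat.
  by rewrite !ler_wpM2r ?exprn_ge0 ?invr_ge0//; exact: normc_Re.
rewrite (_ : (fun k => _) = normc w *: (exp_coeff (normc z * `|c|))); last first.
  by apply/funext => k; rewrite /exp_coeff /= !fctE /GRing.scale/= mulrA.
by apply: is_cvg_seriesZ; exact: is_cvg_series_exp_coeff.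
Qed.

Let coef_diffs z w : pseries_diffs (coef z w) = coef z (w * z).
Proof.
apply/funext => k; rewrite /pseries_diffs /coef exprS mulrA factS natrM invfM.
by rewrite mulrCA; congr (_ * _); rewrite mulrA mulfV ?mul1r ?pnatr_eq0.
Qed.

Let S_derive z w c : is_derive c (1 : R) (S z w) (S z (w * z) c).
Proof.
have -> : S z (w * z) c = limn (pseries (pseries_diffs (coef z w)) c) by rewrite coef_diffs.
apply: (@pseries_snd_diffs _ _ (`|c| + 1)); rewrite ?coef_diffs; try exact: coef_cvg.
by rewrite [ltRHS]ger0_norm ?addr_ge0// ltrDl.
Qed.

Let S_linear z w (a b : R) w1 w2 c : w = a%:C * w1 + b%:C * w2 ->
  S z w c = a * S z w1 c + b * S z w2 c.
Proof.
move=> wE; apply: cvg_lim; first exact: norm_hausdorff.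
have h : (fun n => a * pseries (coef z w1) c n + b * pseries (coef z w2) c n) @ \oo
    --> a * S z w1 c + b * S z w2 c.
  by apply: cvgD; apply: cvgM; [exact: cvg_cst|exact: coef_cvg|exact: cvg_cst|exact: coef_cvg].
apply: cvg_trans h; apply: near_eq_cvg; apply: nearW => n.
rewrite /pseries /series /= !mulr_sumr -big_split/=; apply: eq_bigr => k _.
rewrite /coef wE; rewrite mulrDl ReD -!mulrA !ReM /= !mul0r !subr0; ring.
Qed.

Let S0 z w : S z w 0 = complex.Re w.
Proof.
apply: cvg_lim; first exact: norm_hausdorff.
apply: cvg_near_cst; exists 1%N => // -[//|n] _ /=.
rewrite /pseries /series /= big_mkord big_ord_recl/= expr0 mulr1 big1 ?addr0.
  by rewrite /coef expr0 mulr1 fact0 divr1.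
by move=> i _; rewrite /bump/= add1n expr0n mulr0.
Qed.

(* [p] and [q] solve the linear system [p' = A p + B q], [q' = A q - B p], so
   rotating [(p, q)] by the angle [B c] and scaling by [expR (- A c)] gives constants. *)
Lemma cexp_series z : clim (fun n => \sum_(k < n) z ^+ k / k`!%:R) (cexp z).
Proof.
pose A := complex.Re z; pose B := complex.Im z.
pose p := S z 1; pose q := S z 'i.
have dp c : is_derive c (1 : R) p (A * p c + B * q c).
  rewrite -(@S_linear z (1 * z) A B 1 'i c); first exact: S_derive.
  by apply: complex_ext; rewrite !ReImE /= /A /B; ring.
have dq c : is_derive c (1 : R) q (- B * p c + A * q c).
  rewrite -(@S_linear z ('i * z) (- B) A 1 'i c); first exact: S_derive.
  by apply: complex_ext; rewrite !ReImE /= /A /B; ring.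
have dE c : is_derive c (1 : R) (fun s => expR (- (A * s))) (- A * expR (- (A * c))).
  have d1 : is_derive c (1 : R) (fun s => - (A * s)) (- A).
    by apply: is_derive_eq; rewrite /GRing.scale/= mulr1.
  have h := @is_derive1_comp R expR (fun x => - (A * x)) c _ _ (is_derive_expR (- (A * c))) d1.
  by apply: (is_derive_eq h); rewrite mulrC.
have db c : is_derive c (1 : R) (fun s => B * s) B.
  by apply: is_derive_eq; rewrite /GRing.scale/= mulr1.
have dC c : is_derive c (1 : R) (fun s => cos (B * s)) (- B * sin (B * c)).
  have h := @is_derive1_comp R cos (fun x => B * x) c _ _ (is_derive_cos (B * c)) (db c).
  by apply: (is_derive_eq h); rewrite mulrC mulrN mulNr.
have dS c : is_derive c (1 : R) (fun s => sin (B * s)) (B * cos (B * c)).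
  have h := @is_derive1_comp R sin (fun x => B * x) c _ _ (is_derive_sin (B * c)) (db c).
  by apply: (is_derive_eq h); rewrite mulrC.
pose F c := expR (- (A * c)) * (p c * cos (B * c) - q c * sin (B * c)).
pose G c := expR (- (A * c)) * (p c * sin (B * c) + q c * cos (B * c)).
have dF c : is_derive c (1 : R) F 0.
  have h := is_deriveM (dE c) (is_deriveB (is_deriveM (dp c) (dC c)) (is_deriveM (dq c) (dS c))).
  apply: (is_derive_eq h); set e := expR (- (A * c)).
  transitivity (e * ((p c * (- B * sin (B * c)) + cos (B * c) * (A * p c + B * q c))
     - (q c * (B * cos (B * c)) + sin (B * c) * (- B * p c + A * q c)))
   + (p c * cos (B * c) - q c * sin (B * c)) * (- A * e)); first by [].
  by ring.
have dG c : is_derive c (1 : R) G 0.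
  have h := is_deriveM (dE c) (is_deriveD (is_deriveM (dp c) (dS c)) (is_deriveM (dq c) (dC c))).
  apply: (is_derive_eq h); set e := expR (- (A * c)).
  transitivity (e * ((p c * (B * cos (B * c)) + sin (B * c) * (A * p c + B * q c))
     + (q c * (- B * sin (B * c)) + cos (B * c) * (- B * p c + A * q c)))
   + (p c * sin (B * c) + q c * cos (B * c)) * (- A * e)); first by [].
  by ring.
have F1 : F 1 = 1.
  rewrite (is_derive_0_is_cst 1 0 dF) /F !mulr0 oppr0 expR0 cos0 sin0 /p S0 /=; ring.
have G1 : G 1 = 0.
  rewrite (is_derive_0_is_cst 1 0 dG) /G !mulr0 oppr0 expR0 cos0 sin0 /q /p !S0 /=; ring.
move: F1 G1; rewrite /F /G !mulr1 => F1 G1.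
have eA : expR (- A) * expR A = 1 by rewrite expRN mulVf// gt_eqF ?expR_gt0.
have cs : cos B ^+ 2 + sin B ^+ 2 = 1 by exact: cos2Dsin2.
have pE : p 1 = expR A * cos B.
  transitivity (expR A * ((expR (- A) * (p 1 * cos B - q 1 * sin B)) * cos B
    + (expR (- A) * (p 1 * sin B + q 1 * cos B)) * sin B)).
    transitivity ((expR (- A) * expR A) * (cos B ^+ 2 + sin B ^+ 2) * p 1); last ring.
    by rewrite eA cs !mul1r.
  by rewrite F1 G1; ring.
have qE : q 1 = - (expR A * sin B).
  transitivity (expR A * ((expR (- A) * (p 1 * sin B + q 1 * cos B)) * cos B
    - (expR (- A) * (p 1 * cos B - q 1 * sin B)) * sin B)).
    transitivity ((expR (- A) * expR A) * (cos B ^+ 2 + sin B ^+ 2) * q 1); last ring.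
    by rewrite eA cs !mul1r.
  by rewrite F1 G1; ring.
have invn k : (k`!%:R : R[i])^-1 = ((k`!%:R : R)^-1)%:C by rewrite fmorphV rmorph_nat.
apply: climP.
  rewrite [X in _ --> X](_ : _ = p 1); last by rewrite pE.
  apply: cvg_trans (@coef_cvg z 1 1); apply: near_eq_cvg; apply: nearW => n.
  rewrite /pseries /series /= big_mkord.
  elim/big_rec2 : _ => [//|k x y _ ->]; rewrite ReD; congr (_ + _).
  by rewrite /coef expr1n mulr1 mul1r invn ReM /= mulr0 subr0.
rewrite [X in _ --> X](_ : _ = - q 1); last by rewrite qE opprK.
apply: cvg_trans (cvgN (@coef_cvg z 'i 1)); apply: near_eq_cvg; apply: nearW => n.
rewrite /pseries /series /= !fctE big_mkord -sumrN.
elim/big_rec2 : _ => [//|k x y _ ->]; rewrite ImD; congr (_ + _).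
by rewrite /coef expr1n mulr1 invn ImM !ReM /=; ring.
Qed.

End ExponentialSeries.

Lemma Re_sum {R : realType} (I : Type) (r : seq I) (F : I -> R[i]) :
  complex.Re (\sum_(i <- r) F i) = \sum_(i <- r) complex.Re (F i).
Proof. exact: (big_morph _ (@ReD R)). Qed.

(** At $r=0$ the law is the Dirac mass at 0, and the exponential formula still gives it because
    $0^0=1$. *)
Lemma poisson_prob1 {R : realType} (r : R) k : 0 <= r ->
  poisson_prob r 0 [set k] = (expR (- r) * (r ^+ k / k`!%:R))%:E.
Proof.
rewrite le_eqVlt => /predU1P[<-|r0]; rewrite /poisson_prob.
  rewrite ltxx oppr0 expR0 mul1r diracE; case: k => [|k].
    by rewrite mem_set// expr0 fact0 divr1.
  by rewrite memNset//= exprS !mul0r.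
rewrite r0 esum_set1 /poisson_pmf ?r0; last by rewrite lee_fin !mulr_ge0 ?exprn_ge0 ?expR_ge0 ?ltW.
by rewrite mulrC mulrA.
Qed.

Lemma cvg_poisson {R : realType} (z : R[i]) (r : R) :
  clim (fun n => \sum_(i < n) (expR (- r) * (r ^+ i / i`!%:R))%:C * z ^+ i)
       (cexp (- (r%:C * (1 - z)))).
Proof.
rewrite (_ : - (r%:C * (1 - z)) = (- r)%:C + r%:C * z); last by apply: complex_ext; rewrite !ReImE /=; ring.
rewrite cexpD cexp_real.
apply: (eq_clim _ (climZ (expR (- r))%:C (cexp_series (r%:C * z)))) => n.
rewrite mulr_sumr; apply: eq_bigr => i _.
rewrite exprMn [in RHS]rmorphM/= [in RHS]rmorphM/= rmorphXn/= fmorphV rmorph_nat; ring.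
Qed.

Lemma cvg_poisson_sum {R : realType} (r : R) :
  (fun n => \sum_(i < n) expR (- r) * (r ^+ i / i`!%:R)) @ \oo --> (1 : R).
Proof.
have := @cvg_poisson _ 1 r; rewrite subrr mulr0 oppr0 cexp0 => /clim_Re; apply: cvg_trans.
apply: near_eq_cvg; apply: nearW => n; rewrite Re_sum.
by apply: eq_bigr => i _; rewrite expr1n mulr1.
Qed.

Section PoissonTransform.
Context {R : realType} d (T : measurableType d) (P : probability T R).
Variables (K L : T -> nat) (c c' : R).
Hypotheses (mK : measurable_fun setT K) (mL : measurable_fun setT L).
Hypotheses (c0 : 0 <= c) (c'0 : 0 <= c').
Hypothesis KL : forall i j, P [set w | K w = i /\ L w = j]
  = (poisson_prob c 0 [set i] * poisson_prob c' 0 [set j])%E.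

Let sum_pick (a : nat -> R[i]) (k n : nat) :
  \sum_(i < n) a i * (k == i)%:R = a k * (k < n)%:R.
Proof.
have [kn|nk] := ltnP k n.
  rewrite (bigD1 (Ordinal kn))//= eqxx big1 ?addr0// => i ik.
  by rewrite (_ : k == i = false) ?mulr0//; apply: contraNF ik => /eqP ki; apply/eqP/val_inj.
by rewrite mulr0 big1// => i _; rewrite gtn_eqF ?mulr0// (leq_trans (ltn_ord i)).
Qed.

(** On the event that both counts are below [n] the integrand is a finite combination of point
    indicators, whose expectation factors into two partial sums of exponential series. *)
Lemma poisson_transform (z z' : R[i]) : normc z <= 1 -> normc z' <= 1 ->
  cexpectation P (fun w => z ^+ K w * z' ^+ L w)
  = cexp (- (c%:C * (1 - z))) * cexp (- (c'%:C * (1 - z'))).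
Proof.
move=> z1 z'1.
pose E i j := [set w | K w = i /\ L w = j].
have mE i j : measurable (E i j).
  rewrite (_ : E i j = K @^-1` [set i] `&` L @^-1` [set j]); last by apply/seteqP; split => w [].
  by apply: measurableI; rewrite -[X in measurable X]setTI; [exact: mK|exact: mL].
pose pr (r : R) i := expR (- r) * (r ^+ i / i`!%:R).
have PE i j : fine (P (E i j)) = pr c i * pr c' j.
  by rewrite KL !poisson_prob1.
pose En n := [set w | (K w < n)%N /\ (L w < n)%N].
have mEn n : measurable (En n).
  rewrite (_ : En n = K @^-1` `I_n `&` L @^-1` `I_n); last by apply/seteqP; split => w [].
  by apply: measurableI; rewrite -[X in measurable X]setTI; [exact: mK|exact: mL].
have EE i j w : (\1_(E i j) w : R)%:C = (K w == i)%:R * (L w == j)%:R :> R[i].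
  rewrite indicE rmorph_nat -natrM mulnb; congr (nat_of_bool _)%:R; apply/idP/andP.
    by move=> /set_mem[/= -> ->].
  by move=> [/eqP ki /eqP lj]; apply/mem_set.
have EnE n w : (\1_(En n) w : R)%:C = (K w < n)%:R * (L w < n)%:R :> R[i].
  rewrite indicE rmorph_nat -natrM mulnb; congr (nat_of_bool _)%:R; apply/idP/andP.
    by move=> /set_mem[].
  by move=> [ki lj]; apply/mem_set.
pose f n w := \sum_(i < n) \sum_(j < n) z ^+ i * z' ^+ j * (\1_(E i j) w : R)%:C.
have fE n w : f n w = z ^+ K w * z' ^+ L w * (\1_(En n) w : R)%:C.
  rewrite /f EnE mulrACA -!sum_pick mulr_suml; apply: eq_bigr => i _.
  by rewrite mulr_sumr; apply: eq_bigr => j _; rewrite EE mulrACA.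
have bz (x : R[i]) (X : T -> nat) : measurable_fun setT X -> normc x <= 1 ->
    cbounded (fun w => x ^+ X w).
  move=> mX x1; apply: cbounded_le1.
    by apply: (cmeasurable_index (F := fun n _ => x ^+ n)) => // n; exact: cmeasurable_cst.
  by move=> w; rewrite normcX exprn_ile1 ?normc_ge0.
have bzz : cbounded (fun w => z ^+ K w * z' ^+ L w) by apply: cboundedM; exact: bz.
have bf n : cbounded (f n).
  rewrite (_ : f n = fun w => z ^+ K w * z' ^+ L w * (\1_(En n) w : R)%:C); last by apply/funext.
  by apply: cboundedM => //; exact: cbounded_indic.
have Ef n : cexpectation P (f n) = (\sum_(i < n) (pr c i)%:C * z ^+ i) * (\sum_(j < n) (pr c' j)%:C * z' ^+ j).
  rewrite /f cexpectation_sum; last first.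
    by move=> i; apply: cbounded_sum => j; apply: cboundedZ; exact: cbounded_indic.
  rewrite mulr_suml; apply: eq_bigr => i _; rewrite cexpectation_sum; last first.
    by move=> j; apply: cboundedZ; exact: cbounded_indic.
  rewrite mulr_sumr; apply: eq_bigr => j _; rewrite cexpectationZ; last exact: cbounded_indic.
  rewrite cexpectation_indic// PE rmorphM mulrACA; congr (_ * _); exact: mulrC.
have PEn n : fine (P (En n)) = (\sum_(i < n) pr c i) * (\sum_(j < n) pr c' j).
  apply: complexI; rewrite -cexpectation_indic//.
  transitivity (cexpectation P (fun w => \sum_(i < n) \sum_(j < n) (\1_(E i j) w : R)%:C)).
    apply: eq_cexpectation => w; rewrite EnE.
    have h k : (k < n)%:R = \sum_(i < n) (k == i)%:R :> R[i].
      by rewrite -[LHS]mul1r -(sum_pick (fun=> 1)); apply: eq_bigr => i _; rewrite mul1r.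
    rewrite !h mulr_suml; apply: eq_bigr => i _; rewrite mulr_sumr; apply: eq_bigr => j _.
    by rewrite EE.
  rewrite cexpectation_sum; last by move=> i; apply: cbounded_sum => j; exact: cbounded_indic.
  rewrite rmorphM !rmorph_sum mulr_suml; apply: eq_bigr => i _.
  rewrite cexpectation_sum; last by move=> j; exact: cbounded_indic.
  rewrite mulr_sumr; apply: eq_bigr => j _; rewrite cexpectation_indic// PE.
  exact: rmorphM.
apply: (@clim_unique _ (fun n => cexpectation P (f n))); last first.
  under eq_fun do rewrite Ef; apply: climM; exact: cvg_poisson.
(* The integrand has modulus at most 1, so truncation costs at most the probability of the
   complement of [En n], which vanishes because Poisson weights sum to 1. *)
apply: (@clim_bound _ _ _ (fun n => 1 - fine (P (En n)))).
  rewrite [X in _ --> X](_ : 0 = 1 - 1 * 1); last by rewrite mulr1 subrr.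
  apply: cvgB; first exact: cvg_cst.
  by under eq_fun do rewrite PEn; apply: cvgM; exact: cvg_poisson_sum.
move=> n; have -> : 1 - fine (P (En n)) = 1 * fine (P (~` En n)).
  by rewrite probability_setC// fineB ?fin_num_measure// mul1r.
apply: cexpectation_dist_indic => //; first exact: measurableC.
move=> w; rewrite fE -[X in _ - X]mulr1 -mulrBr Normc.normcM mul1r.
rewrite -[leRHS]mul1r; apply: ler_pM; rewrite ?normc_ge0//.
  rewrite Normc.normcM !normcX mulr_ile1 ?exprn_ge0 ?normc_ge0//; exact: exprn_ile1 (normc_ge0 _) _.
rewrite -(rmorph1 (real_complex R)) -rmorphB normc_real !indicE in_setC.
by case: (_ \in _); rewrite /= ?subrr ?sub0r ?normrN ?normr0 ?normr1.
Qed.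

End PoissonTransform.

(** * Attack times *)

Section Counting.
Context {R : realType}.
Implicit Types (u : nat -> R) (c a b : R).

(* The number of k such that [u k <= c], for u increasing and unbounded; the value is 0
   when [u] is bounded by [c]. *)
Definition count_le u c : nat :=
  if pselect (exists k, c < u k) is left h then ex_minn h else 0%N.

Lemma count_leP u c : (forall k, u k < u k.+1) -> (exists k, c < u k) ->
  forall k, (k < count_le u c)%N = (u k <= c).
Proof.
move=> uS uc k; have um : {homo u : i j / (i <= j)%N >-> i <= j}.
  by apply: homo_leq => // [i j l|i]; [exact: le_trans|exact: ltW].
rewrite /count_le; case: pselect => // h; case: ex_minnP => m cm mmin.
apply/idP/idP => [km|kc].
  by rewrite leNgt; apply/negP => /mmin; rewrite leqNgt km.
by rewrite ltnNge; apply/negP => mk; have := lt_le_trans cm (um _ _ mk); rewrite ltNge kc.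
Qed.

Lemma count_le_homo u a b : (forall k, u k < u k.+1) -> (exists k, b < u k) -> a <= b ->
  (count_le u a <= count_le u b)%N.
Proof.
move=> uS [k bk] ab; case E : (count_le u a) => [//|j].
have : (j < count_le u a)%N by rewrite E.
rewrite count_leP//; last by exists k; exact: le_lt_trans ab bk.
by move=> /le_trans/(_ ab); rewrite -count_leP//; exists k.
Qed.

(** Holds for every sequence, the second alternative being the default value 0. It exhibits the
    fibers through countably many comparisons, so that [count_le] is measurable on the whole
    space. *)
Lemma count_le_fiber u c (j : nat) : count_le u c = j <->
  (c < u j /\ (forall i, (i < j)%N -> u i <= c)) \/ (j = 0%N /\ forall i, u i <= c).
Proof.
rewrite /count_le; case: pselect => [h|h].
  case: ex_minnP => m cm mmin; split => [<-|].
    by left; split => // i im; rewrite leNgt; apply/negP => /mmin; rewrite leqNgt im.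
  case=> [[cj jmin]|[_ /(_ m)]]; last by rewrite leNgt cm.
  apply/eqP; rewrite eqn_leq mmin//= leqNgt; apply/negP => mj.
  by have := jmin _ mj; rewrite leNgt cm.
split => [<-|].
  by right; split => // i; rewrite leNgt; apply/negP => ci; apply: h; exists i.
by case=> [[cj _]|[]//]; exfalso; apply: h; exists j.
Qed.

Lemma measurable_fun_nat d (T : measurableType d) (f : T -> nat) :
  (forall j, measurable [set x | f x = j]) -> measurable_fun setT f.
Proof.
move=> mf _ Y _; rewrite setTI (_ : _ @^-1` Y = \bigcup_(j in Y) [set x | f x = j]).
  by apply: bigcup_measurable => j _.
by apply/seteqP; split => [x /= Yx|x [j Yj /= ->]//]; exists (f x).
Qed.

Lemma measurable_count_le d (T : measurableType d) (U : nat -> T -> R) (X : T -> R) :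
  (forall k, measurable_fun setT (U k)) -> measurable_fun setT X ->
  measurable_fun setT (fun x => count_le (U ^~ x) (X x)).
Proof.
move=> mU mX; have mlt k : measurable [set x | X x < U k x].
  rewrite -[X in measurable X]setTI.
  have := measurable_fun_ltr mX (mU k) measurableT (I : measurable [set true]).
  by congr measurable; apply/seteqP; split.
have mle k : measurable [set x | U k x <= X x].
  rewrite (_ : [set _ | _] = ~` [set x | X x < U k x]); first exact: measurableC.
  by apply/seteqP; split => x /=; rewrite leNgt => /negP.
apply: measurable_fun_nat => j.
rewrite (_ : [set _ | _] =
    ([set x | X x < U j x] `&` \bigcap_(i in `I_j) [set x | U i x <= X x]) `|`
    ([set x | j = 0%N] `&` \bigcap_i [set x | U i x <= X x])); last first.
  apply/seteqP; split => x; rewrite /= count_le_fiber.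
    by case=> [[h1 h2]|[h1 h2]]; [left; split => // i; exact: h2|right; split => // i _; exact: h2].
  by case=> [[? h]|[? h]]; [left; split => // i; exact: h|right; split => // i; exact: h].
apply: measurableU; apply: measurableI => //.
- by apply: fin_bigcap_measurable => // i _; exact: mle.
- case: (eqVneq j 0%N) => [->|j0].
    by rewrite (_ : [set _ | _] = setT)//; apply/seteqP; split.
  by rewrite (_ : [set _ | _] = set0)//; apply/seteqP; split => // x /= jE; rewrite jE in j0.
- by apply: bigcapT_measurable.
Qed.

(** The windows up to index [m] tile $[0,\tau_m]$, and the points falling in that interval are an
    initial segment of indices. The operation is kept general to serve both numbers of nodes and
    weights. *)
Lemma big_windows (V : Type) (idx : V) (op : Monoid.com_law idx) (F : nat -> V) u
    (tau : nat -> R) m :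
  (forall k, u k < u k.+1) -> (forall c, exists k, c < u k) -> 0 <= u 0%N ->
  (forall i, tau i <= tau i.+1) ->
  \big[op/idx]_(i < m.+1) \big[op/idx]_(k \in [set k |
      (if i : nat is j.+1 then `]tau j, tau j.+1]%classic else `[0, tau 0%N]%classic) (u k)]) F k
  = \big[op/idx]_(k < count_le u (tau m)) F k.
Proof.
move=> uS uoo u0 tauS.
have up k : 0 <= u k by elim: k => // k; move=> /le_trans; apply; exact: ltW.
have win0 : [set k | `[0, tau 0%N]%classic (u k)] = `I_(count_le u (tau 0%N)).
  by apply/seteqP; split => k /=; rewrite in_itv/= up/= count_leP.
have tau_le i : (count_le u (tau i) <= count_le u (tau i.+1))%N by exact: count_le_homo.
have winS i : `I_(count_le u (tau i.+1)) =
    `I_(count_le u (tau i)) `|` [set k | `]tau i, tau i.+1]%classic (u k)].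
  apply/seteqP; split => k /=; rewrite in_itv/= !count_leP//.
    by move=> ->; rewrite andbT ltNge; case: (u k <= tau i); [left|right].
  by case=> [/le_trans/(_ (tauS i))//|/andP[]].
elim: m => [|m ih]; first by rewrite big_ord1 win0 fsbig_ord.
rewrite big_ord_recr/= ih !fsbig_ord winS fsbigU0//.
  apply: (sub_finite_set (B := `I_(count_le u (tau m.+1)))) => //.
  by rewrite winS => k; right.
by move=> k [/= ]; rewrite count_leP// in_itv/= ltNge => ->.
Qed.

End Counting.

Section AttackTimes.
Context {R : realType} d (T : measurableType d) (P : probability T R).
Variables (lam : R) (t : nat -> {RV P >-> R}).
Hypotheses (lam0 : 0 < lam) (ht : poisson_process lam t).
Local Notation mu := (@lebesgue_measure R).

Let mt k (A : set R) : measurable A -> measurable (t k @^-1` A).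
Proof. by move=> mA; rewrite -[X in measurable X]setTI; exact: measurable_funP. Qed.

(** There are only countably many finite sets of indices, and each prescribes membership for every
    [k]. *)
Let measurable_card (A : set R) (c : nat) : measurable A ->
  measurable [set w | ([set k | A (t k w)] #= `I_c)%card].
Proof.
move=> mA; pose B (F : {fset nat}) := if #|` F| == c then
  \bigcap_k (if k \in F then t k @^-1` A else ~` (t k @^-1` A)) else set0.
rewrite (_ : [set w | _] = \bigcup_F B F); last first.
  apply/seteqP; split => [w /= cA|w [F _]].
    exists (fset_set [set k | A (t k w)]) => //; rewrite /B (card_fset_set cA) eqxx => k _.
    have fA : finite_set [set k | A (t k w)] by exists c.
    rewrite in_fset_set//; case: ifPn => [/set_mem//|/negP wA /= Aw].
    by apply: wA; apply/mem_set.
  rewrite /B; case: ifP => [/eqP <- h|//] /=.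
  rewrite (_ : [set k | _] = [set` F]); first exact/card_eq_fsetP.
  apply/seteqP; split => k /=; have := h k I; case: ifP => //.
apply: countable_bigcupT_measurable => [|F]; first exact: countableP.
rewrite /B; case: ifP => // _; apply: bigcapT_measurable => k.
by case: ifP => _; [exact: mt|apply: measurableC; exact: mt].
Qed.

Let law1 (A : set R) (c : nat) : measurable A -> A `<=` `[0, +oo[ -> (mu A < +oo)%E ->
  P [set w | ([set k | A (t k w)] #= `I_c)%card] = poisson_prob (lam * fine (mu A)) 0 [set c].
Proof.
move=> mA A0 Aoo.
have tr : trivIset setT (fun _ : 'I_1 => A) by move=> i j _ _ _; rewrite !ord1.
have := poisson_process_law ht (m := 1) (A := fun=> A) (fun=> c) (fun=> mA) (fun=> A0) (fun=> Aoo) tr.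
rewrite big_ord1 => h; apply: etrans h.
by congr (P _); apply/seteqP; split => [w h _|w /(_ ord0)].
Qed.

(** Unboundedness makes [count_le] a genuine count; positivity excludes an attack at time 0, so that
    the count at time 0 matches the convention for the index $-1$. *)
Definition regular_times (w : T) : Prop := 0 < t 0%N w /\ forall c : R, exists k, c < t k w.

Lemma measurable_regular_times : measurable [set w | regular_times w].
Proof.
rewrite (_ : [set w | _] = t 0%N @^-1` `]0, +oo[ `&` \bigcap_N \bigcup_k (t k @^-1` `]N%:R, +oo[)); last first.
  apply/seteqP; split => w; rewrite /regular_times /= in_itv/= andbT => -[h0 h].
    by split => // N _; have [k kc] := h N%:R; exists k => //=; rewrite in_itv/= kc.
  split => // c; have [k _] := h (Num.truncn `|c|).+1 I.
  rewrite /= in_itv/= andbT => kc; exists k; apply: le_lt_trans kc.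
  by rewrite (le_trans (ler_norm _))// ltW// truncnS_gt.
apply: measurableI; first by apply: mt; exact: measurable_itv.
apply: bigcapT_measurable => N; apply: bigcupT_measurable => k; apply: mt; exact: measurable_itv.
Qed.

(** The number of points in $\{0\}$ is Poisson with parameter 0. The number in $[0,N]$ takes finite
    values with total probability 1, whereas times bounded by $N$ would put infinitely many points
    there. *)
Lemma regular_times_ae : P (~` [set w | regular_times w]) = 0%E.
Proof.
have itv0 N : mu `[0, N%:R]%classic = N%:R%:E.
  rewrite lebesgue_measure_itv/= lte_fin -EFinB subr0.
  by case: N => [|N]; rewrite ?ltxx ?ltr0n.
have null0 : P (~` (t 0%N @^-1` `]0, +oo[)) = 0%E.
  have : P [set w | ([set k | [set 0 : R] (t k w)] #= `I_0)%card] = 1%E.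
    rewrite law1//; last by rewrite [X in (X < _)%E]lebesgue_measure_set1 ltry.
      by rewrite lebesgue_measure_set1 /= mulr0 poisson_prob1// oppr0 expR0 expr0 fact0 divr1 mulr1.
    by move=> x /= ->; rewrite in_itv/= lexx.
  move=> P1; apply/eqP; rewrite eq_le measure_ge0 andbT.
  have mE := measurable_card 0 (measurable_set1 (0 : R)).
  have <- : P (~` [set w | ([set k | [set 0 : R] (t k w)] #= `I_0)%card]) = 0%E.
    by rewrite probability_setC// P1 subee.
  apply: le_measure; rewrite ?inE.
  - by apply: measurableC; apply: mt; exact: measurable_itv.
  - exact: measurableC.
  move=> w /= t0; apply: contra_not t0; rewrite II0 card_eq0 => /eqP h.
  rewrite in_itv/= andbT lt_neqAle (poisson_process_ge0 ht) andbT eq_sym.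
  by apply/eqP => h0; have : [set k | t k w = 0] 0%N by []; rewrite h.
have nullN (N : nat) : P (~` (\bigcup_k (t k @^-1` `]N%:R, +oo[))) = 0%E.
  pose E c := [set w | ([set k | `[0, N%:R]%classic (t k w)] #= `I_c)%card].
  have mI : measurable (`[0, N%:R]%classic : set R) by exact: measurable_itv.
  have mE c : measurable (E c) by exact: measurable_card.
  have PE c : P (E c) = (expR (- (lam * N%:R)) * ((lam * N%:R) ^+ c / c`!%:R))%:E.
    rewrite /E law1//.
    - by rewrite [X in fine X]itv0 poisson_prob1// mulr_ge0// ltW.
    - by move=> x /=; rewrite !in_itv/= => /andP[->].
    - by rewrite [X in (X < _)%E]itv0 ltry.
  have tE : trivIset setT E.
    apply/trivIsetP => i j _ _ ij; rewrite -subset0 => w [/= hi hj].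
    by move: ij; rewrite -(card_fset_set hi) -(card_fset_set hj) eqxx.
  have PU : P (\bigcup_c E c) = 1%E.
    have h1 := measure_sigma_additive (mu := P) mE tE.
    have h2 : (fun n => (\sum_(0 <= c < n) P (E c))%E) @ \oo --> 1%E.
      rewrite (_ : (fun n => _) = fun n => (\sum_(i < n) expR (- (lam * N%:R)) * ((lam * N%:R) ^+ i / i`!%:R))%:E).
        by apply: cvg_EFin; [exact: nearW|exact: cvg_poisson_sum].
      by apply/funext => n; rewrite big_mkord -sumEFin; apply: eq_bigr => i _; exact: PE.
    by have := cvg_unique _ h1 h2; apply.
  have mU : measurable (\bigcup_c E c) by exact: bigcupT_measurable.
  apply/eqP; rewrite eq_le measure_ge0 andbT.
  have <- : P (~` (\bigcup_c E c)) = 0%E by rewrite probability_setC// PU subee.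
  apply: le_measure; rewrite ?inE.
  - by apply: measurableC; apply: bigcupT_measurable => k; apply: mt; exact: measurable_itv.
  - exact: measurableC.
  move=> w /= wN [c _ /= hc]; apply: wN; apply: contrapT => wN; apply: infinite_nat.
  exists c; rewrite (_ : setT = [set k | `[0, N%:R]%classic (t k w)])//.
  apply/seteqP; split => // k _ /=; rewrite in_itv/=.
  have -> /= : 0 <= t k w.
    elim: k => [|k ih]; first exact: poisson_process_ge0 ht _.
    by apply: (le_trans ih); apply: ltW; exact: (poisson_process_lt ht).
  rewrite leNgt; apply/negP => kN; apply: wN; exists k => //=.
  by rewrite in_itv/= kN.
apply/negligibleP; first exact/measurableC/measurable_regular_times.
apply: (@negligibleS _ _ _ _ (~` (t 0%N @^-1` `]0, +oo[) `|`
    \bigcup_N ~` (\bigcup_k (t k @^-1` `]N%:R, +oo[)))).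
  move=> w /= wr; apply: contrapT => /not_orP[w0 wN]; apply: wr; split.
    by move: w0 => /contrapT /=; rewrite in_itv/= andbT.
  move=> c; apply: contrapT => wc; apply: wN; exists (Num.truncn `|c|).+1 => // -[k _ /=].
  rewrite in_itv/= andbT => kc; apply: wc; exists k; apply: le_lt_trans kc.
  by rewrite (le_trans (ler_norm _))// ltW// truncnS_gt.
apply: negligibleU; first by apply/negligibleP => //; apply: measurableC; apply: mt; exact: measurable_itv.
apply: negligible_bigcup => N; apply/negligibleP; last exact: nullN.
by apply: measurableC; apply: bigcupT_measurable => k; apply: mt; exact: measurable_itv.
Qed.

(** Two windows are enough: at a given index, an attack matters only through being before
    $\tau_{m-1}$ or between $\tau_{m-1}$ and $\tau_m$. *)
Lemma count_law (a b : R) (i j : nat) : 0 <= a -> a <= b ->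
  P [set w | count_le (t ^~ w) a = i /\ (count_le (t ^~ w) b - count_le (t ^~ w) a)%N = j]
  = (poisson_prob (lam * a) 0 [set i] * poisson_prob (lam * (b - a)) 0 [set j])%E.
Proof.
move=> a0 ab.
pose A (k : 'I_2) : set R := if k == ord0 then `[0, a]%classic else `]a, b]%classic.
pose c (k : 'I_2) := if k == ord0 then i else j.
have mA k : measurable (A k) by rewrite /A; case: ifP => _; exact: measurable_itv.
have muA k : mu (A k) = (if k == ord0 then a else b - a)%:E.
  rewrite /A; case: ifP => _; rewrite lebesgue_measure_itv/= lte_fin -EFinB ?subr0.
    by case: (ltP 0 a) => // a0'; have -> : a = 0 by apply/le_anti; rewrite a0' a0.
  by case: (ltP a b) => // ba; have -> : b = a by [apply/le_anti; rewrite ba ab]; rewrite subrr.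
have := poisson_process_law ht (m := 2) (A := A) c mA _ _ _.
rewrite big_ord_recl big_ord1 !muA /c/= => <-; last 3 first.
- move=> k x; rewrite /A; case: ifP => _; rewrite /= !in_itv/= andbT; first by case/andP.
  by move=> /andP[ax _]; rewrite (le_trans a0)// ltW.
- by move=> k; rewrite muA ltry.
- apply/trivIsetP => k l _ _; rewrite /A -subset0.
  have sub x : `[0, a]%classic x -> `]a, b]%classic x -> False.
    by rewrite /= !in_itv/= => /andP[_ xa] /andP[ax _]; rewrite ltNge xa in ax.
  move=> kl x; case: ifPn => k0; case: ifPn => l0 [xk xl].
  + by move: kl; rewrite (eqP k0) (eqP l0) eqxx.
  + exact: (sub x).
  + exact: (sub x).
  + move: kl; suff -> : k = l by rewrite eqxx.
    by case: k k0 {xk} => [[|[|k]]] //= hk _; case: l l0 {xl} => [[|[|l]]] //= hl _; apply/val_inj.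
set S1 := [set w | _ /\ _]; set S2 := [set w | _].
have mS2 : measurable S2.
  rewrite (_ : S2 = \bigcap_(k in setT) [set w | ([set l | A k (t l w)] #= `I_(c k))%card]).
    apply: fin_bigcap_measurable => [|k _]; first exact: finite_finset.
    exact: measurable_card.
  by apply/seteqP; split => [w h k _|w h k]; apply: h.
have mcount x : measurable_fun setT (fun w => count_le (t ^~ w) x).
  by apply: measurable_count_le => // k; exact: measurable_funP.
have mS1 : measurable S1.
  rewrite (_ : S1 = (fun w => count_le (t ^~ w) a) @^-1` [set i] `&`
     (fun w => count_le (t ^~ w) b - count_le (t ^~ w) a)%N @^-1` [set j]); last by apply/seteqP; split.
  apply: measurableI; rewrite -[X in measurable X]setTI; first exact: mcount.
  exact: (measurable_fun_subn (mcount b) (mcount a)).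
(* At regular points the cardinalities of the windows are the counts. Elsewhere [count_le] may take
   its default value, so both events are compared inside the regular set. *)
have key w : regular_times w -> (S1 w <-> S2 w).
  move=> [t0 too].
  have uS k : t k w < t k.+1 w by exact: (poisson_process_lt ht).
  have up k : 0 <= t k w by elim: k => [|k ih]; [exact: ltW|apply: (le_trans ih); exact: ltW].
  have Ca : [set l | `[0, a]%classic (t l w)] = `I_(count_le (t ^~ w) a).
    by apply/seteqP; split => l /=; rewrite in_itv/= up/= count_leP.
  have cab : (count_le (t ^~ w) a <= count_le (t ^~ w) b)%N by exact: count_le_homo.
  have Cb : ([set l | `]a, b]%classic (t l w)] #=
      `I_(count_le (t ^~ w) b - count_le (t ^~ w) a))%card.
    rewrite (_ : [set l | _] = `I_(count_le (t ^~ w) b) `\` `I_(count_le (t ^~ w) a)).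
      exact: card_IID.
    apply/seteqP; split => l /=; rewrite in_itv/= !count_leP// ltNge.
      by move=> /andP[/negP].
    by move=> [-> /negP ->].
  rewrite /S1 /S2 /A /c /=; split => [[<- <-] k|h].
    by case: ifP => _; [rewrite Ca|].
  split.
    by have := h ord0; rewrite eqxx Ca => /card_fset_set <-; rewrite (card_fset_set (card_eqxx _)).
  by have := h ord_max; rewrite /= => hb; rewrite -(card_fset_set Cb) (card_fset_set hb).
have null : P (~` [set w | regular_times w]) = 0%E := regular_times_ae.
have mreg := measurable_regular_times.
have restr S : measurable S -> P S = P (S `&` [set w | regular_times w]).
  move=> mS; have h0 : P (S `\` [set w | regular_times w]) = 0%E.
    apply/eqP; rewrite eq_le measure_ge0 andbT -null; apply: le_measure; rewrite ?inE.
    - exact: measurableD.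
    - exact: measurableC.
    - by move=> w [].
  by apply: etrans (measureDI P mS mreg) _; rewrite [X in (X + _)%E]h0 add0e.
rewrite (restr _ mS1) (restr _ mS2); congr (P _).
by apply/seteqP; split => w [/= h r]; split => //; apply/(key w r).
Qed.

End AttackTimes.

(** * Transforms of the attack process *)

Section SigmaAlgebras.
Context {R : realType} d (T : measurableType d) (P : probability T R).

(** Lets the identity serve as a random element of the space with a smaller sigma-algebra:
    independence of sigma-algebras is then independence of two such identities. *)
Lemma measurable_id_generated (G : set (set T)) : G `<=` measurable ->
  measurable_fun setT (fun w : T => w : g_sigma_algebraType G).
Proof.
move=> Gm _ Y mY; rewrite setTI; apply: (smallest_sub _ Gm mY).
exact: sigma_algebra_measurable.
Qed.

Lemma measurable_generated d' (T' : measurableType d') (G : set (set T)) (X : T -> T') :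
  preimage_set_system setT X measurable `<=` <<s G >> ->
  measurable_fun setT (X : g_sigma_algebraType G -> T').
Proof. by move=> XG _ Y mY; apply: XG; exists Y. Qed.

Lemma sub_sigma_of (I : Type) d' (T' : measurableType d') (X : I -> T -> T') i :
  preimage_set_system setT (X i) measurable `<=` sigma_of X.
Proof. by move=> A XA; apply: sub_sigma_algebra; exists i. Qed.

Lemma sigma_of_measurable (I : Type) d' (T' : measurableType d') (X : I -> {RV P >-> T'}) :
  sigma_of X `<=` measurable.
Proof.
apply: smallest_sub; first exact: sigma_algebra_measurable.
by move=> A [i _ [B mB <-]]; exact: measurable_funP.
Qed.

Lemma sigma_ofT (I : Type) d' (T' : measurableType d') (X : I -> T -> T') :
  sigma_of X setT.
Proof. exact: (@measurableT _ (g_sigma_algebraType (\bigcup_i preimage_set_system setT (X i) measurable))). Qed.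

End SigmaAlgebras.

(** The truncation at 0 makes the exponential bounded on all of [R]; on nonnegative variables it
    changes nothing. *)
Lemma cbounded_decay {R : realType} (v : R[i]) : 0 <= complex.Re v ->
  cbounded (fun x : R => cexp (- (v * (Num.max x 0)%:C))).
Proof.
move=> v0; apply: cbounded_le1 => [|x].
  apply/cmeasurable_cexp/cmeasurableN/cmeasurableM; first exact: cmeasurable_cst.
  by apply: cmeasurable_real; exact: measurable_maxr.
apply: normc_cexp_le1; rewrite ReN ReM /= mulr0 subr0 oppr_le0 mulr_ge0//.
by rewrite le_max lexx orbT.
Qed.

Lemma lst_max {R : realType} d (T : measurableType d) (P : probability T R)
    (X : {RV P >-> R}) (v : R[i]) : (forall w, 0 <= X w) ->
  lst X v = cexpectation P (fun w => cexp (- (v * (Num.max (X w) 0)%:C))).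
Proof. by move=> X0; apply: eq_cexpectation => w; rewrite max_l. Qed.

Lemma normc_lst_le1 {R : realType} d (T : measurableType d) (P : probability T R)
    (X : {RV P >-> R}) (v : R[i]) : (forall w, 0 <= X w) -> 0 <= complex.Re v ->
  normc (lst X v) <= 1.
Proof.
move=> X0 v0; rewrite lst_max//; apply: normc_cexpectation.
  exact: (cmeasurable_comp (measurable_funP X) (cbounded_decay v0).1).
move=> w; apply: normc_cexp_le1; rewrite ReN ReM /= mulr0 subr0 oppr_le0 mulr_ge0//.
by rewrite le_max lexx orbT.
Qed.

(** * Joint transform of numbers of nodes and weights *)

Section Marks.
Context {R : realType} d (T : measurableType d) (P : probability T R).
Variables (n : nat -> {RV P >-> nat}) (wt : nat -> nat -> {RV P >-> R}).
Hypotheses (hn1 : forall k w, (1 <= n k w)%N) (hniid : iid n)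
  (hwt0 : forall j k w, 0 <= wt j k w)
  (hwtiid : iid (fun jk : nat * nat => wt jk.1 jk.2)).
Let wt2 (jk : nat * nat) := wt jk.1 jk.2.
Hypothesis hnwt : independent P (sigma_of n) (sigma_of wt2).

Definition attack_weight k w : R := \sum_(l < n k w) wt l k w.

Lemma attack_weight_ge0 k w : 0 <= attack_weight k w.
Proof. by apply: sumr_ge0 => l _. Qed.

Let Gn := \bigcup_k preimage_set_system setT (n k) measurable.
Let Gw := \bigcup_jk preimage_set_system setT (wt2 jk) measurable.
Let Tn := g_sigma_algebraType Gn.
Let Tw := g_sigma_algebraType Gw.

Let mn k : measurable_fun setT (n k : Tn -> nat).
Proof. by apply: measurable_generated; exact: (@sub_sigma_of _ _ _ _ _ (fun k => n k)). Qed.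

Let mw l k : measurable_fun setT (wt l k : Tw -> R).
Proof. by apply: measurable_generated; exact: (@sub_sigma_of _ _ _ _ _ wt2 (l, k)). Qed.

Let bn (z : R[i]) : normc z <= 1 -> cbounded (fun k : nat => z ^+ k).
Proof.
move=> z1; apply: cbounded_le1 => [|k]; last by rewrite normcX exprn_ile1 ?normc_ge0.
by split; [move=> _ Y mY; exact: I|move=> _ Y mY; exact: I].
Qed.

Lemma cmeasurable_attack_weight d' (S : measurableType d') (fn : S -> T) (fw : S -> T) k (v : R[i]) :
  measurable_fun setT (fun x => n k (fn x)) ->
  (forall l, measurable_fun setT (fun x => wt l k (fw x))) ->
  cmeasurable setT (fun x => cexp (- (v * (\sum_(l < n k (fn x)) wt l k (fw x))%:C))).
Proof.
move=> mN mW.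
apply: (cmeasurable_index (k := fun x => n k (fn x))
  (F := fun m x => cexp (- (v * (\sum_(l < m) wt l k (fw x))%:C)))) => // m.
apply/cmeasurable_cexp/cmeasurableN/cmeasurableM; first exact: cmeasurable_cst.
by apply: cmeasurable_real; exact: measurable_sum.
Qed.

(** With the numbers of nodes frozen, the weights contribute one factor $l(v_k)$ per node, which
    leaves $(z_k l(v_k))^{n_k}$; the independent $n_k$ then give one generating function each. *)
Lemma marks_transform (z v : nat -> R[i]) j : (forall k, normc (z k) <= 1) ->
  (forall k, 0 <= complex.Re (v k)) ->
  cexpectation P (fun w => \prod_(k < j) (z k ^+ n k w * cexp (- (v k * (attack_weight k w)%:C))))
  = \prod_(k < j) pgf (n 0%N) (z k * lst (wt 0%N 0%N) (v k)).
Proof.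
move=> z1 v0.
have iotaE m : iota 0 m = index_iota 0 m by rewrite /index_iota subn0.
pose f (x : Tn * Tw) := \prod_(k < j) (z k ^+ n k x.1 *
  cexp (- (v k * (\sum_(l < n k x.1) wt l k x.2)%:C))).
have mf : cmeasurable setT f.
  apply: cmeasurable_prod => k; apply: cmeasurableM.
    apply: (cmeasurable_index (k := fun x : Tn * Tw => n k x.1) (F := fun m x => z k ^+ m)).
      exact: (measurableT_comp (mn k)).
    by move=> m; exact: cmeasurable_cst.
  apply: cmeasurable_attack_weight; first exact: (measurableT_comp (mn k)).
  by move=> l; exact: (measurableT_comp (mw l k)).
have f1 x : normc (f x) <= 1.
  rewrite normc_prod; apply: prodr_ile1 => k _; rewrite normc_ge0/= Normc.normcM.
  rewrite mulr_ile1 ?normc_ge0 ?normcX ?exprn_ile1 ?normc_ge0 ?normc_cexp_le1//.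
  by rewrite ReN ReM /= mulr0 subr0 oppr_le0 mulr_ge0// sumr_ge0.
have XY A B : measurable A -> measurable B ->
    P ((fun w : T => w : Tn) @^-1` A `&` (fun w : T => w : Tw) @^-1` B)
    = (P ((fun w : T => w : Tn) @^-1` A) * P ((fun w : T => w : Tw) @^-1` B))%E.
  by move=> mA mB; exact: hnwt.
have mXn : measurable_fun setT (fun w : T => w : Tn).
  apply: measurable_id_generated => A [k _ [B mB <-]]; exact: measurable_funP.
have mXw : measurable_fun setT (fun w : T => w : Tw).
  apply: measurable_id_generated => A [k _ [B mB <-]]; exact: measurable_funP.
rewrite [LHS](cexpectation_independent mXn mXw XY mf f1).
pose lw k := lst (wt 0%N 0%N) (v k).
have inner w1 : cexpectation P (fun w2 => f (w1, w2)) = \prod_(k < j) (z k * lw k) ^+ n k w1.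
  (* The weights occurring in the first [j] attacks, listed without repetition as pairs, so that
     independence over a doubly indexed family applies. *)
  pose s := [seq (l, k) | k <- iota 0 j, l <- iota 0 (n k w1)].
  pose g (lk : nat * nat) (x : R) := cexp (- (v lk.2 * (Num.max x 0)%:C)).
  have us : uniq s.
    apply: allpairs_uniq_dep => [|k _|]; rewrite ?iota_uniq//.
    by move=> [k1 l1] [k2 l2] _ _ /= [-> ->].
  have big_s (h : nat * nat -> R[i]) : \prod_(i <- s) h i = \prod_(k < j) \prod_(l < n k w1) h (l : nat, k : nat).
    rewrite big_allpairs_dep/= (iotaE j) big_mkord; apply: eq_bigr => k _.
    by rewrite (iotaE (n k w1)) big_mkord.
  transitivity (cexpectation P (fun w2 => (\prod_(k < j) z k ^+ n k w1) * \prod_(i <- s) g i (wt2 i w2))).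
    apply: eq_cexpectation => w2; rewrite big_s -big_split/=; apply: eq_bigr => k _.
    congr (_ * _); rewrite rmorph_sum mulr_sumr -sumrN cexp_sum; apply: eq_bigr => l _.
    by rewrite /g/= max_l// hwt0.
  have bg i : cbounded (g i) by exact: cbounded_decay.
  rewrite cexpectationZ; last first.
    by apply: cbounded_prod => i; apply: (cbounded_comp (measurable_funP (wt2 i)) (bg i)).
  rewrite (cexpectation_prod hwtiid.1 us bg) big_s -big_split/=; apply: eq_bigr => k _.
  rewrite exprMn; congr (_ * _).
  transitivity (\prod_(l < n k w1) lw k); last by rewrite prodr_const card_ord.
  apply: eq_bigr => l _; rewrite /lw (lst_max _ (hwt0 _ _)).
  exact: (cexpectation_eq_distribution (X := wt2 (l : nat, k : nat)) (Y := wt2 (0, 0)%N)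
    (hwtiid.2 _ _) (bg (l : nat, k : nat))).
under eq_cexpectation do rewrite inner.
have b1 k : normc (z k * lw k) <= 1.
  by rewrite Normc.normcM mulr_ile1 ?normc_ge0 ?normc_lst_le1.
pose h k (m : nat) := (z k * lw k) ^+ m.
transitivity (cexpectation P (fun w => \prod_(k <- iota 0 j) h k (n k w))).
  by apply: eq_cexpectation => w; rewrite (iotaE j) big_mkord.
have bh k : cbounded (h k) by exact: bn.
rewrite (cexpectation_prod hniid.1 (iota_uniq 0 j) bh) (iotaE j) big_mkord.
apply: eq_bigr => k _; exact: (cexpectation_eq_distribution (hniid.2 _ _) (bh k)).
Qed.

(** Every attack destroys at least one node, so $|z^{n}|\le|z|$. This contraction is the source of
    the geometric decay in the observation index. *)
Lemma pgf_le (z : R[i]) : normc z <= 1 -> normc (pgf (n 0%N) z) <= normc z.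
Proof.
move=> z1; apply: normc_cexpectation.
  exact: (cmeasurable_comp (measurable_funP (n 0%N)) (bn z1).1).
move=> w; rewrite normcX -[leRHS]expr1.
by apply: ler_wiXn2l; rewrite ?normc_ge0.
Qed.

End Marks.

Lemma prod_if_lt {R : realType} (a b : R[i]) (i j : nat) : (i <= j)%N ->
  \prod_(k < j) (if (k < i)%N then a else b) = a ^+ i * b ^+ (j - i).
Proof.
move=> ij; rewrite -(big_mkord predT (fun k => if (k < i)%N then a else b)).
rewrite (big_cat_nat (n := i))//=; congr (_ * _).
  rewrite (eq_big_nat _ _ (F2 := fun=> a)) => [|k /andP[_ ->]//].
  by rewrite prodr_const_nat subn0.
rewrite (eq_big_nat _ _ (F2 := fun=> b)) => [|k /andP[ik _]]; first by rewrite prodr_const_nat.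
by rewrite ltnNge ik.
Qed.

(** * Transform of the attack process at two fixed times *)

Section AttackTransform.
Context {R : realType} d (T : measurableType d) (P : probability T R).
Variables (lam : R) (t : nat -> {RV P >-> R}).
Variables (n : nat -> {RV P >-> nat}) (wt : nat -> nat -> {RV P >-> R}).
Hypotheses (lam0 : 0 < lam) (ht : poisson_process lam t).
Hypotheses (hn1 : forall k w, (1 <= n k w)%N) (hniid : iid n)
  (hwt0 : forall j k w, 0 <= wt j k w)
  (hwtiid : iid (fun jk : nat * nat => wt jk.1 jk.2)).
Let wt2 (jk : nat * nat) := wt jk.1 jk.2.
Hypothesis hattack : mutually_independent P
  (tnth [tuple sigma_of t; sigma_of n; sigma_of wt2]).

Let Gt := \bigcup_k preimage_set_system setT (t k) measurable.
Let Gn := \bigcup_k preimage_set_system setT (n k) measurable.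
Let Gw := \bigcup_jk preimage_set_system setT (wt2 jk) measurable.
Let Tt := g_sigma_algebraType Gt.
Let Tn := g_sigma_algebraType Gn.
Let Tw := g_sigma_algebraType Gw.

Let product_rule (A B C : set T) : sigma_of t A -> sigma_of n B -> sigma_of wt2 C ->
  P (A `&` (B `&` C)) = (P A * (P B * P C))%E.
Proof.
move=> tA nB wC.
pose o0 : 'I_3 := @Ordinal 3 0 isT.
pose o1 : 'I_3 := @Ordinal 3 1 isT.
pose o2 : 'I_3 := @Ordinal 3 2 isT.
pose S (i : 'I_3) : set T := nth setT [:: A; B; C] i.
have hS : forall i, i \in [fset o0; o1; o2]%fset ->
    tnth [tuple sigma_of t; sigma_of n; sigma_of wt2] i (S i).
  by move=> i; rewrite !inE -orbA => /or3P[] /eqP ->.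
have := hattack hS; rewrite fsetUC big_fsetU1/=; last by rewrite !inE.
rewrite big_fsetU1/=; last by rewrite !inE.
rewrite big_seq_fset1 /S/=.
have -> : \bigcap_(i in [set` ([fset o2] `|` [fset o0; o1])%fset]) nth setT [:: A; B; C] i
    = A `&` (B `&` C).
  apply/seteqP; split => [w h|w [Aw [Bw Cw]] i /=].
    by split; [|split]; [apply: (h o0)|apply: (h o1)|apply: (h o2)]; rewrite /= !inE eqxx ?orbT.
  by rewrite !inE => /or3P[] /eqP ->.
by move=> ->; rewrite muleC -muleA.
Qed.

Lemma independent_marks : independent P (sigma_of n) (sigma_of wt2).
Proof.
move=> B C nB wC; have tT : sigma_of t setT by exact: sigma_ofT.
have := product_rule tT nB wC.
by rewrite setTI probability_setT mul1e.
Qed.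

Let mt k : measurable_fun setT (t k : Tt -> R).
Proof. by apply: measurable_generated; exact: (@sub_sigma_of _ _ _ _ _ (fun k => t k)). Qed.

Let mn k : measurable_fun setT (n k : Tn -> nat).
Proof. by apply: measurable_generated; exact: (@sub_sigma_of _ _ _ _ _ (fun k => n k)). Qed.

Let mw l k : measurable_fun setT (wt l k : Tw -> R).
Proof. by apply: measurable_generated; exact: (@sub_sigma_of _ _ _ _ _ wt2 (l, k)). Qed.

Let mXt : measurable_fun setT (fun w : T => w : Tt).
Proof. by apply: measurable_id_generated => A [k _ [B mB <-]]; exact: measurable_funP. Qed.

Let mXn : measurable_fun setT (fun w : T => w : Tn).
Proof. by apply: measurable_id_generated => A [k _ [B mB <-]]; exact: measurable_funP. Qed.

Let mXw : measurable_fun setT (fun w : T => w : Tw).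
Proof. by apply: measurable_id_generated => A [k _ [B mB <-]]; exact: measurable_funP. Qed.

Let mXnw : measurable_fun setT (fun w : T => (w, w) : Tn * Tw).
Proof. exact: measurable_fun_pair. Qed.

Let Ynw : {RV P >-> (Tn * Tw)%type} :=
  HB.pack (fun w : T => (w, w) : Tn * Tw) (isMeasurableFun.Build _ _ _ _ _ mXnw).

(** Independence of the three families gives the rule on rectangles, and these generate the product
    sigma-algebra; hence the attack times are independent of all marks taken together. *)
Let independent_times (A : set Tt) (B : set (Tn * Tw)) : measurable A -> measurable B ->
  P ((fun w : T => w : Tt) @^-1` A `&` Ynw @^-1` B)
  = (P ((fun w : T => w : Tt) @^-1` A) * P (Ynw @^-1` B))%E.
Proof.
move=> mA mB; apply: (@independent_pi_system _ _ _ _ _ P Ynw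
  [set X `*` Y | X in measurable & Y in measurable]) => //.
- by rewrite -[A](setTI); exact: mXt.
- exact: measurable_prod_measurableType.
- move=> _ _ [B1 mB1 [C1 mC1 <-]] [B2 mB2 [C2 mC2 <-]].
  by rewrite -setXI; exists (B1 `&` B2); [exact: measurableI|exists (C1 `&` C2); [exact: measurableI|]].
- by exists setT => //; exists setT => //; rewrite setXTT.
- move=> _ [B1 mB1 [C1 mC1 <-]].
  have := product_rule mA mB1 mC1.
  have -> : P (B1 `&` C1) = (P B1 * P C1)%E by exact: independent_marks.
  by move=> <-.
Qed.

Variables (z1 v1 z2 v2 : R[i]).
Hypotheses (nz1 : normc z1 <= 1) (nz2 : normc z2 <= 1)
  (rv1 : 0 <= complex.Re v1) (rv2 : 0 <= complex.Re v2).

Definition mark (z v : R[i]) k w : R[i] :=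
  z ^+ n k w * cexp (- (v * (attack_weight n wt k w)%:C)).

(** Attacks before index [i] enter both cumulative sums and get their own parameters; those from [i]
    to [j] enter only the later one. *)
Definition marks (i j : nat) w : R[i] :=
  \prod_(k < j) (if (k < i)%N then mark z1 v1 k w else mark z2 v2 k w).

Definition psi z v : R[i] := pgf (n 0%N) (z * lst (wt 0%N 0%N) v).

Lemma normc_psi z v : normc z <= 1 -> 0 <= complex.Re v -> normc (psi z v) <= normc z.
Proof.
move=> nz rv; have l1 := normc_lst_le1 (hwt0 0 0) rv.
apply: (le_trans (pgf_le hn1 _)); rewrite Normc.normcM.
  by rewrite mulr_ile1 ?normc_ge0.
by rewrite -[leRHS]mulr1 ler_wpM2l ?normc_ge0.
Qed.

(** With the attack times frozen, averaging the marks leaves one factor [psi] per attack; the two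
    counts are independent Poisson variables, and their generating functions give the
    exponentials. *)
Lemma attack_transform_cst (s s' : R) : 0 <= s -> s <= s' ->
  cexpectation P (fun w => marks (count_le (t ^~ w) s) (count_le (t ^~ w) s') w)
  = cexp (- ((lam * s)%:C * (1 - psi z1 v1))) * cexp (- ((lam * (s' - s))%:C * (1 - psi z2 v2))).
Proof.
move=> s0 ss'.
pose K (s : R) (w : T) := count_le (t ^~ w) s.
pose mk z v k (x : Tn * Tw) := z ^+ n k x.1 *
  cexp (- (v * (\sum_(l < n k x.1) wt l k x.2)%:C)).
have bmk z v k x : normc z <= 1 -> 0 <= complex.Re v -> normc (mk z v k x) <= 1.
  move=> nz rv; rewrite Normc.normcM mulr_ile1 ?normc_ge0 ?normcX ?exprn_ile1 ?normc_ge0//.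
  by apply: normc_cexp_le1; rewrite ReN ReM /= mulr0 subr0 oppr_le0 mulr_ge0// sumr_ge0.
pose f (x : Tt * (Tn * Tw)) := \prod_(k < K s' x.1)
   (if (k < K s x.1)%N then mk z1 v1 k x.2 else mk z2 v2 k x.2).
have f1 x : normc (f x) <= 1.
  rewrite normc_prod; apply: prodr_ile1 => k _; rewrite normc_ge0/=.
  by case: ifP => _; exact: bmk.
have mmk z v k : cmeasurable setT (mk z v k).
  apply: cmeasurableM.
    apply: (cmeasurable_index (k := fun x : Tn * Tw => n k x.1) (F := fun m x => z ^+ m)).
      exact: (measurableT_comp (mn k)).
    by move=> m; exact: cmeasurable_cst.
  apply: cmeasurable_attack_weight; first exact: (measurableT_comp (mn k)).
  by move=> l; exact: (measurableT_comp (mw l k)).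
have mK c : measurable_fun setT (fun x : Tt * (Tn * Tw) => K c x.1).
  by apply: measurable_count_le => // k; exact: (measurableT_comp (mt k)).
have mf : cmeasurable setT f.
  apply: (cmeasurable_index (k := fun x : Tt * (Tn * Tw) => K s' x.1) (F := fun j x => \prod_(k < j)
     (if (k < K s x.1)%N then mk z1 v1 k x.2 else mk z2 v2 k x.2))) => // j.
  apply: (cmeasurable_index (k := fun x : Tt * (Tn * Tw) => K s x.1) (F := fun i x => \prod_(k < j)
     (if (k < i)%N then mk z1 v1 k x.2 else mk z2 v2 k x.2))) => // i.
  apply: cmeasurable_prod => k; case: (k < i)%N; apply: cmeasurable_comp => //; exact: measurable_snd.
transitivity (cexpectation P (fun w => f (w, Ynw w))); first exact: eq_cexpectation.
rewrite (cexpectation_independent mXt mXnw independent_times mf f1).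
pose z i k := if (k < i)%N then z1 else z2.
pose v i k := if (k < i)%N then v1 else v2.
have inner w1 : cexpectation P (fun w2 => f (w1, Ynw w2)) =
    \prod_(k < K s' w1) (if (k < K s w1)%N then psi z1 v1 else psi z2 v2).
  transitivity (cexpectation P (fun w => \prod_(k < K s' w1)
     (z (K s w1) k ^+ n k w * cexp (- (v (K s w1) k * (attack_weight n wt k w)%:C))))).
    by apply: eq_cexpectation => w; apply: eq_bigr => k _; rewrite /z/v/=; case: ifP.
  rewrite (marks_transform hniid hwt0 hwtiid independent_marks).
  - by apply: eq_bigr => k _; rewrite /z/v; case: ifP.
  - by move=> k; rewrite /z; case: ifP.
  - by move=> k; rewrite /v; case: ifP.
under eq_cexpectation do rewrite inner.
(* Off the regular set the count need not be monotone in time, so the product is rewritten as two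
   powers only up to a null set. *)
rewrite (cexpectation_eq_off_null (N := ~` [set w | regular_times t w])
  (g := fun w => psi z1 v1 ^+ K s w * psi z2 v2 ^+ (K s' w - K s w))).
- apply: poisson_transform.
  + exact: measurable_count_le.
  + apply: (measurable_fun_index (k := K s) (F := fun i w => K s' w - i)%N).
      exact: measurable_count_le.
    move=> i; apply: (measurableT_comp (f := fun m : nat => (m - i)%N)) => //.
    exact: measurable_count_le.
  + by rewrite mulr_ge0// ltW.
  + by rewrite mulr_ge0 ?subr_ge0// ltW.
  + by move=> i j; exact: (count_law lam0 ht).
  + exact: le_trans (normc_psi nz1 rv1) nz1.
  + exact: le_trans (normc_psi nz2 rv2) nz2.
- by apply: measurableC; exact: measurable_regular_times.
- exact: (regular_times_ae lam0 ht).
- move=> w /= /contrapT [_ rt]; apply: prod_if_lt.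
  by apply: count_le_homo => // k; exact: (poisson_process_lt ht).
Qed.

End AttackTransform.

(** * Transform at the random observation times *)

Section ObservedTransform.
Context {R : realType} d (T : measurableType d) (P : probability T R).
Variables (lam : R) (t : nat -> {RV P >-> R}).
Variables (n : nat -> {RV P >-> nat}) (wt : nat -> nat -> {RV P >-> R}).
Hypotheses (lam0 : 0 < lam) (ht : poisson_process lam t).
Hypotheses (hn1 : forall k w, (1 <= n k w)%N) (hniid : iid n)
  (hwt0 : forall j k w, 0 <= wt j k w)
  (hwtiid : iid (fun jk : nat * nat => wt jk.1 jk.2)).
Let wt2 (jk : nat * nat) := wt jk.1 jk.2.
Hypothesis hattack : mutually_independent P
  (tnth [tuple sigma_of t; sigma_of n; sigma_of wt2]).
Variable Delta : nat -> {RV P >-> R}.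
Hypotheses (hD0 : forall m w, 0 <= Delta m w) (hDiid : iid (fun m => Delta m.+1)).
Hypothesis hDindep : independent P (sigma_of (fun _ : unit => Delta 0%N))
                                   (sigma_of (fun m => Delta m.+1)).
Hypothesis hobs : independent P (sigma_of Delta)
     <<s sigma_of t `|` sigma_of n `|` sigma_of wt2 >>.

Let GD := \bigcup_k preimage_set_system setT (Delta k) measurable.
Let GA := sigma_of t `|` sigma_of n `|` sigma_of wt2.
Let TD := g_sigma_algebraType GD.
Let TA := g_sigma_algebraType GA.

Let mt k : measurable_fun setT (t k : TA -> R).
Proof.
apply: measurable_generated => A tA; apply: sub_sigma_algebra; left; left.
exact: (@sub_sigma_of _ _ _ _ _ (fun k => t k) k).
Qed.

Let mn k : measurable_fun setT (n k : TA -> nat).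
Proof.
apply: measurable_generated => A nA; apply: sub_sigma_algebra; left; right.
exact: (@sub_sigma_of _ _ _ _ _ (fun k => n k) k).
Qed.

Let mw l k : measurable_fun setT (wt l k : TA -> R).
Proof.
apply: measurable_generated => A wA; apply: sub_sigma_algebra; right.
exact: (@sub_sigma_of _ _ _ _ _ wt2 (l, k)).
Qed.

Let mD k : measurable_fun setT (Delta k : TD -> R).
Proof. by apply: measurable_generated; exact: (@sub_sigma_of _ _ _ _ _ (fun k => Delta k)). Qed.

Let mXD : measurable_fun setT (fun w : T => w : TD).
Proof. by apply: measurable_id_generated => A [k _ [B mB <-]]; exact: measurable_funP. Qed.

Let mXA : measurable_fun setT (fun w : T => w : TA).
Proof. by apply: measurable_id_generated => A [[]|]; exact: sigma_of_measurable. Qed.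

Let K (s : R) w := count_le (t ^~ w) s.

(** The argument at which $L_0$ and $L$ are evaluated in $\gamma_0$ and $\gamma$. *)
Definition exponent (z v theta : R[i]) : R[i] := theta + lam%:C - lam%:C * psi n wt z v.

Lemma exponentE z v theta (s : R) :
  cexp (- (exponent z v theta * s%:C))
  = cexp (- ((lam * s)%:C * (1 - psi n wt z v))) * cexp (- (theta * s%:C)).
Proof. by rewrite -cexpD; congr cexp; rewrite /exponent rmorphM/=; move: (lam%:C) (s%:C) (psi _ _ _ _) => a b p; ring. Qed.

Lemma Re_exponent_ge0 z v theta : normc z <= 1 -> 0 <= complex.Re v ->
  0 <= complex.Re theta -> 0 <= complex.Re (exponent z v theta).
Proof.
move=> nz rv rt; have p1 := le_trans (normc_psi hn1 hwt0 nz rv) nz.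
have := le_trans (le_trans (ler_norm _) (normc_Re _)) p1.
rewrite /exponent; move: (psi n wt z v) => p rp; rewrite !ReImE/= mul0r subr0 -addrA.
by rewrite addr_ge0// -[X in X - _]mulr1 -mulrBr mulr_ge0 ?subr_ge0// ltW.
Qed.

Section FixedParameters.
Variables (z1 v1 th1 z2 v2 th2 : R[i]).
Hypotheses (nz1 : normc z1 <= 1) (nz2 : normc z2 <= 1)
  (rv1 : 0 <= complex.Re v1) (rv2 : 0 <= complex.Re v2)
  (rt1 : 0 <= complex.Re th1) (rt2 : 0 <= complex.Re th2).

(** The times are functions of the observation process, which is independent of the attack process:
    they are frozen, the case of constant times is applied, and the Poisson exponentials merge with
    the time factors into [exponent]. *)
Lemma attack_transform (s s' : TD -> R) : measurable_fun setT s -> measurable_fun setT s' ->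
  (forall w, 0 <= s w) -> (forall w, s w <= s' w) ->
  cexpectation P (fun w => marks n wt z1 v1 z2 v2 (K (s w) w) (K (s' w) w) w
     * (cexp (- (th1 * (s w)%:C)) * cexp (- (th2 * (s' w - s w)%:C))))
  = cexpectation P (fun w => cexp (- (exponent z1 v1 th1 * (s w)%:C))
     * cexp (- (exponent z2 v2 th2 * (s' w - s w)%:C))).
Proof.
move=> ms ms' s0 ss'.
pose e (x : TD) := cexp (- (th1 * (s x)%:C)) * cexp (- (th2 * (s' x - s x)%:C)).
pose f (x : TD * TA) := marks n wt z1 v1 z2 v2 (K (s x.1) x.2) (K (s' x.1) x.2) x.2 * e x.1.
have me : cmeasurable setT e.
  apply: cmeasurableM; apply/cmeasurable_cexp/cmeasurableN/cmeasurableM; try exact: cmeasurable_cst.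
    exact: cmeasurable_real.
  by apply: cmeasurable_real; exact: measurable_funB.
have e1 x : normc (e x) <= 1.
  have c1 (a : R[i]) (b : R) : 0 <= complex.Re a -> 0 <= b -> normc (cexp (- (a * b%:C))) <= 1.
    by move=> a0 b0; rewrite normc_cexp_le1// ReN ReM /= mulr0 subr0 oppr_le0 mulr_ge0.
  by rewrite Normc.normcM mulr_ile1 ?normc_ge0 ?c1 ?subr_ge0.
have mk1 z v k w : normc z <= 1 -> 0 <= complex.Re v -> normc (mark n wt z v k w) <= 1.
  move=> nz rv; rewrite Normc.normcM mulr_ile1 ?normc_ge0 ?normcX ?exprn_ile1 ?normc_ge0//.
  apply: normc_cexp_le1; rewrite ReN ReM /= mulr0 subr0 oppr_le0 mulr_ge0//.
  exact: attack_weight_ge0.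
have f1 x : normc (f x) <= 1.
  rewrite Normc.normcM mulr_ile1 ?normc_ge0 ?e1//.
  rewrite normc_prod; apply: prodr_ile1 => k _; rewrite normc_ge0/=.
  by case: ifP => _; exact: mk1.
have mmk z v k : cmeasurable setT (mark n wt z v k : TA -> R[i]).
  apply: cmeasurableM.
    apply: (cmeasurable_index (k := n k : TA -> nat) (F := fun m x => z ^+ m)) => //.
  exact: (@cmeasurable_attack_weight _ _ _ _ n wt _ TA (fun x : TA => x : T) (fun x : TA => x : T)
    k v (mn k) (fun l => mw l k)).
have mK c : measurable_fun setT c -> measurable_fun setT (fun x : TD * TA => K (c x.1) x.2).
  move=> mc; apply: measurable_count_le => [k|]; first exact: (measurableT_comp (mt k)).
  exact: (measurableT_comp mc).
have mmarks dX (X : measurableType dX) (p : X -> TA) (i j : X -> nat) :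
    measurable_fun setT p -> measurable_fun setT i -> measurable_fun setT j ->
    cmeasurable setT (fun x => marks n wt z1 v1 z2 v2 (i x) (j x) (p x)).
  move=> mp mi mj; apply: (cmeasurable_index (k := j) (F := fun j x =>
     marks n wt z1 v1 z2 v2 (i x) j (p x))) => // j'.
  apply: (cmeasurable_index (k := i) (F := fun i x =>
     marks n wt z1 v1 z2 v2 i j' (p x))) => // i'.
  apply: (cmeasurable_comp (h := p)) => //.
  by apply: cmeasurable_prod => k; case: (k < i')%N.
have mf : cmeasurable setT f.
  apply: cmeasurableM; last exact: (cmeasurable_comp (h := fst)).
  by apply: mmarks; [exact: measurable_snd|exact: mK|exact: mK].
have DA (A : set TD) (B : set TA) : measurable A -> measurable B ->
    P ((fun w : T => w : TD) @^-1` A `&` (fun w : T => w : TA) @^-1` B)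
    = (P ((fun w : T => w : TD) @^-1` A) * P ((fun w : T => w : TA) @^-1` B))%E.
  by move=> mA mB; exact: hobs.
rewrite [LHS](cexpectation_independent mXD mXA DA mf f1).
apply: eq_cexpectation => w; rewrite /f/=.
under eq_cexpectation do rewrite mulrC.
rewrite cexpectationZ; last first.
  have mb (c : R) : measurable_fun setT (fun w' => K c w') by exact: measurable_count_le.
  apply: cbounded_le1 => [|w']; first exact: (mmarks _ _ (fun w' : T => w' : TA)).
  rewrite normc_prod; apply: prodr_ile1 => k _; rewrite normc_ge0/=.
  by case: ifP => _; exact: mk1.
rewrite (attack_transform_cst lam0 ht hn1 hniid hwt0 hwtiid hattack nz1 nz2 rv1 rv2 (s0 w) (ss' w)).
by rewrite mulrC /e !exponentE mulrACA.
Qed.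

End FixedParameters.

Let tau := obs_time Delta.

Lemma obs_timeS m w : tau m.+1 w = tau m w + Delta m.+1 w.
Proof. by rewrite /tau /obs_time big_ord_recr. Qed.

Lemma obs_time_ge0 m w : 0 <= tau m w.
Proof. by rewrite /tau /obs_time sumr_ge0. Qed.

Lemma before_obs_time_ge0 m w : 0 <= before tau m w.
Proof. by case: m => //= m; exact: obs_time_ge0. Qed.

Lemma before_obs_time_le m w : before tau m w <= tau m w.
Proof. by case: m => [|m]/=; [exact: obs_time_ge0|rewrite obs_timeS lerDl]. Qed.

(** The increments $\Delta_0,\dots,\Delta_{m-1}$ carry [c1] and only $\Delta_m$ carries [c2]. For
    $m=0$ the earlier time is 0, so $\Delta_0$ itself carries [c2]. *)
Lemma delta_transform (c1 c2 : R[i]) m : 0 <= complex.Re c1 -> 0 <= complex.Re c2 ->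
  cexpectation P (fun w => cexp (- (c1 * (before tau m w)%:C))
     * cexp (- (c2 * (tau m w - before tau m w)%:C)))
  = if m is m'.+1 then lst (Delta 0%N) c1 * lst (Delta 1%N) c1 ^+ m' * lst (Delta 1%N) c2
    else lst (Delta 0%N) c2.
Proof.
move=> r1 r2; case: m => [|m].
  apply: eq_cexpectation => w /=; rewrite mulr0 oppr0 cexp0 mul1r subr0.
  by rewrite /tau /obs_time big_ord1.
pose c i := if (i < m)%N then c1 else c2.
have rc i : 0 <= complex.Re (c i) by rewrite /c; case: ifP.
pose g i (x : R) := cexp (- (c i * (Num.max x 0)%:C)).
have bg i : cbounded (g i) by exact: cbounded_decay.
have gD i w : g i (Delta i.+1 w) = cexp (- (c i * (Delta i.+1 w)%:C)) by rewrite /g max_l.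
pose T0 := g_sigma_algebraType (\bigcup_(_ : unit) preimage_set_system setT (Delta 0%N) measurable).
pose T1 := g_sigma_algebraType (\bigcup_k preimage_set_system setT (Delta k.+1) measurable).
have m0 : measurable_fun setT (Delta 0%N : T0 -> R).
  by apply: measurable_generated; exact: (@sub_sigma_of _ _ _ _ _ (fun _ : unit => Delta 0%N) tt).
have m1 k : measurable_fun setT (Delta k.+1 : T1 -> R).
  by apply: measurable_generated; exact: (@sub_sigma_of _ _ _ _ _ (fun k => Delta k.+1)).
have mX0 : measurable_fun setT (fun w : T => w : T0).
  by apply: measurable_id_generated => A [k _ [B mB <-]]; exact: measurable_funP.
have mX1 : measurable_fun setT (fun w : T => w : T1).
  by apply: measurable_id_generated => A [k _ [B mB <-]]; exact: measurable_funP.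
have ind (A : set T0) (B : set T1) : measurable A -> measurable B ->
    P ((fun w : T => w : T0) @^-1` A `&` (fun w : T => w : T1) @^-1` B)
    = (P ((fun w : T => w : T0) @^-1` A) * P ((fun w : T => w : T1) @^-1` B))%E.
  by move=> mA mB; exact: hDindep.
pose f0 (w : T0) := cexp (- (c1 * (Num.max (Delta 0%N w) 0)%:C)).
pose f1 (w : T1) := \prod_(i <- iota 0 m.+1) g i (Delta i.+1 w).
have mf0 : cmeasurable setT f0 := cmeasurable_comp m0 (cbounded_decay r1).1.
have mf1 : cmeasurable setT f1.
  by apply: cmeasurable_prod => i; exact: (cmeasurable_comp (m1 i) (bg i).1).
have d1 (a : R[i]) (x : R) : 0 <= complex.Re a -> normc (cexp (- (a * (Num.max x 0)%:C))) <= 1.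
  move=> a0; apply: normc_cexp_le1; rewrite ReN ReM /= mulr0 subr0 oppr_le0 mulr_ge0//.
  by rewrite le_max lexx orbT.
have n0 w : normc (f0 w) <= 1 by exact: d1.
have n1 w : normc (f1 w) <= 1.
  by rewrite normc_prod; apply: prodr_ile1 => i _; rewrite normc_ge0 d1.
have iotaE : iota 0 m.+1 = index_iota 0 m.+1 by rewrite /index_iota subn0.
transitivity (cexpectation P (fun w => f0 w * f1 w)).
  apply: eq_cexpectation => w /=; rewrite obs_timeS addrC addKr.
  rewrite /f0 max_l// /f1 iotaE big_mkord big_ord_recr/= mulrA; congr (_ * _); last first.
    by rewrite gD /c ltnn.
  rewrite /tau /obs_time big_ord_recl rmorphD/= mulrDr opprD cexpD; congr (_ * _).
  rewrite rmorph_sum mulr_sumr -sumrN cexp_sum; apply: eq_bigr => i _.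
  by rewrite gD /c ltn_ord.
rewrite (cexpectationM mX0 mX1 ind mf0 mf1 n0 n1) -mulrA; congr (_ * _).
  by rewrite [RHS]lst_max.
rewrite /f1 (cexpectation_prod (X := fun i => Delta i.+1) hDiid.1 (iota_uniq 0 m.+1) bg).
have E i : cexpectation P (fun w => g i (Delta i.+1 w)) = lst (Delta 1%N) (c i).
  rewrite [RHS]lst_max//.
  exact: (cexpectation_eq_distribution (X := Delta i.+1) (Y := Delta 1%N) (hDiid.2 i 0%N) (bg i)).
rewrite iotaE big_mkord big_ord_recr/=; congr (_ * _); last by rewrite E /c ltnn.
transitivity (\prod_(i < m) lst (Delta 1%N) c1); last by rewrite prodr_const card_ord.
by apply: eq_bigr => i _; rewrite E /c ltn_ord.
Qed.

Let good w : bool := `[< regular_times t w >].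

(* Away from the null set of irregular attack times these are [cum_nodes] and [cum_weight];
   unlike them they are everywhere measurable and nondecreasing in [m]. *)
Definition reg_nodes m w : nat :=
  if good w then (\sum_(k < K (tau m w) w) n k w)%N else 0%N.

Definition reg_weight m w : R :=
  if good w then \sum_(k < K (tau m w) w) attack_weight n wt k w else 0.

Lemma reg_nodesE m w : regular_times t w -> reg_nodes m w = cum_nodes t n Delta m w.
Proof.
move=> rw; rewrite /reg_nodes /good asboolT//; apply/esym.
case: rw => t0 tc; rewrite /K -(@big_windows R _ _ addn (fun k => n k w) (t ^~ w) (tau ^~ w))//.
- by move=> k; exact: (poisson_process_lt ht).
- exact: ltW.
- by move=> i; rewrite obs_timeS lerDl.
Qed.

Lemma reg_weightE m w : regular_times t w -> reg_weight m w = cum_weight t n wt Delta m w.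
Proof.
move=> rw; rewrite /reg_weight /good asboolT//; apply/esym.
case: rw => t0 tc; rewrite /K -(@big_windows R _ _ +%R (attack_weight n wt ^~ w) (t ^~ w)
  (tau ^~ w))//.
- by move=> k; exact: (poisson_process_lt ht).
- exact: ltW.
- by move=> i; rewrite obs_timeS lerDl.
Qed.

Lemma measurable_obs_time m : measurable_fun setT (tau m).
Proof. exact: measurable_sum. Qed.

Let measurable_good : measurable_fun setT good.
Proof.
apply: (measurable_fun_bool true); rewrite setTI (_ : _ @^-1` _ = [set w | regular_times t w]).
  exact: measurable_regular_times.
by apply/seteqP; split => w /=; rewrite /good; [move/asboolP|move=> ?; apply/asboolP].
Qed.

Let mK m : measurable_fun setT (fun w => K (tau m w) w).
Proof. by apply: measurable_count_le => //; exact: measurable_obs_time. Qed.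

Lemma measurable_reg_nodes m : measurable_fun setT (reg_nodes m).
Proof.
apply: measurable_fun_ifT => //.
apply: (measurable_fun_index (F := fun j w => \sum_(k < j) n k w)%N) => // j.
elim: j => [|j IH]; first by under eq_fun do rewrite big_ord0; exact: measurable_cst.
by under eq_fun do rewrite big_ord_recr/=; exact: measurable_fun_addn.
Qed.

Lemma measurable_reg_weight m : measurable_fun setT (reg_weight m).
Proof.
apply: measurable_fun_ifT => //.
apply: (measurable_fun_index (F := fun j w => \sum_(k < j) attack_weight n wt k w)) => // j.
apply: measurable_sum => k.
apply: (measurable_fun_index (F := fun j w => \sum_(l < j) wt l k w)) => // j'.
exact: measurable_sum.
Qed.

Let K_homo m w : good w -> (K (tau m w) w <= K (tau m.+1 w) w)%N.
Proof.
move=> /asboolP[_ tc]; apply: count_le_homo => //; first by move=> k; exact: (poisson_process_lt ht).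
by rewrite obs_timeS lerDl.
Qed.

Lemma reg_nodes_homo m w : (reg_nodes m w <= reg_nodes m.+1 w)%N.
Proof.
rewrite /reg_nodes; case: ifP => // gw; rewrite -!(big_mkord predT (fun k => n k w)).
by rewrite [leqRHS](big_cat_nat (n := K (tau m w) w)) ?K_homo//= leq_addr.
Qed.

Lemma reg_weight_ge0 m w : 0 <= reg_weight m w.
Proof.
rewrite /reg_weight; case: ifP => // _; apply: sumr_ge0 => k _; exact: attack_weight_ge0.
Qed.

Lemma reg_weight_homo m w : reg_weight m w <= reg_weight m.+1 w.
Proof.
rewrite /reg_weight; case: ifP => // gw; rewrite -!(big_mkord predT (attack_weight n wt ^~ w)).
rewrite [leRHS](big_cat_nat (n := K (tau m w) w)) ?K_homo//= lerDl.
by apply: sumr_ge0 => k _; exact: attack_weight_ge0.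
Qed.

Lemma marksE (a z b v : R[i]) (i j : nat) w : (i <= j)%N ->
  marks n wt (a * z) (b + v) z v i j w
  = a ^+ (\sum_(k < i) n k w) * z ^+ (\sum_(k < j) n k w)
    * cexp (- (b * (\sum_(k < i) attack_weight n wt k w)%:C)
            - v * (\sum_(k < j) attack_weight n wt k w)%:C).
Proof.
move=> ij.
have mE c e l : \prod_(k < l) mark n wt c e k w = c ^+ (\sum_(k < l) n k w)
    * cexp (- (e * (\sum_(k < l) attack_weight n wt k w)%:C)).
  rewrite big_split/=; congr (_ * _); first by rewrite prodrXr.
  by rewrite -cexp_sum rmorph_sum mulr_sumr sumrN.
rewrite cexpD mulrACA -!mE (big_ord_widen j (fun k => mark n wt a b k w) ij) big_mkcond/=.
rewrite -big_split/=; apply: eq_bigr => k _; case: ifP => _; last by rewrite mul1r.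
rewrite /mark exprMn mulrDl opprD cexpD; ring.
Qed.

(** Parameters are kept general because multiplication by $x^N e^{-yW}$ at either index stays within
    this family: [x] joins [a] or [z], and [y] joins [b] or [v]. *)
Definition first_passage_term (a z b v th' th : R[i]) m w : R[i] :=
  a ^+ before reg_nodes m w * z ^+ reg_nodes m w
  * cexp (- (b * (before reg_weight m w)%:C) - v * (reg_weight m w)%:C)
  * cexp (- (th' * (before tau m w)%:C) - th * (tau m w)%:C).

Local Notation gamma i := (increment_transform lam (n 0%N) (wt 0%N 0%N) (Delta i)).

Lemma cmeasurable_first_passage_term (a z b v th' th : R[i]) m :
  cmeasurable setT (first_passage_term a z b v th' th m).
Proof.
have mb d' (V : measurableType d') (u : nat -> T -> V) (x0 : V) k : (forall k, measurable_fun setT (u k)) ->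
    measurable_fun setT (fun w => if k is k'.+1 then u k' w else x0).
  by case: k => [|k] mu; [exact: measurable_cst|exact: mu].
have me (e : R[i]) (X : T -> R) : measurable_fun setT X -> cmeasurable setT (fun w => e * (X w)%:C).
  by move=> mX; apply: cmeasurableM; [exact: cmeasurable_cst|exact: cmeasurable_real].
have mp (e : R[i]) (k : T -> nat) : measurable_fun setT k -> cmeasurable setT (fun w => e ^+ k w).
  by move=> mk; apply: (cmeasurable_index (F := fun j _ => e ^+ j)) => // j; exact: cmeasurable_cst.
apply: cmeasurableM; first apply: cmeasurableM; first apply: cmeasurableM.
- apply: mp; exact: (mb _ _ reg_nodes 0%N m measurable_reg_nodes).
- by apply: mp; exact: measurable_reg_nodes.
- apply/cmeasurable_cexp/cmeasurableB; last by apply: me; exact: measurable_reg_weight.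
  by apply/cmeasurableN/me; exact: (mb _ _ reg_weight 0 m measurable_reg_weight).
- apply/cmeasurable_cexp/cmeasurableB; last by apply: me; exact: measurable_obs_time.
  by apply/cmeasurableN/me; exact: (mb _ _ tau 0 m measurable_obs_time).
Qed.

Lemma normc_first_passage_term_le1 (a z b v th' th : R[i]) m w :
  normc a <= 1 -> normc z <= 1 -> 0 <= complex.Re b -> 0 <= complex.Re v ->
  0 <= complex.Re th' -> 0 <= complex.Re th ->
  normc (first_passage_term a z b v th' th m w) <= 1.
Proof.
move=> na nz rb rv rt' rt.
have ce (u u' : R[i]) (s s' : R) : 0 <= complex.Re u -> 0 <= complex.Re u' -> 0 <= s -> 0 <= s' ->
    normc (cexp (- (u * s%:C) - u' * s'%:C)) <= 1.
  move=> u0 u0' s0 s0'; apply: normc_cexp_le1.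
  by rewrite !ReImE/= !mulr0 !subr0 -opprD oppr_le0 addr_ge0// mulr_ge0.
have bw0 : 0 <= before reg_weight m w by case: (m) => [|k]; [exact: lexx|exact: reg_weight_ge0].
rewrite !Normc.normcM !normcX; do ![apply: mulr_ile1]; rewrite ?mulr_ge0 ?exprn_ge0 ?normc_ge0//.
- by rewrite exprn_ile1 ?normc_ge0.
- by rewrite exprn_ile1 ?normc_ge0.
- by apply: ce => //; exact: reg_weight_ge0.
- by apply: ce => //; [exact: before_obs_time_ge0|exact: obs_time_ge0].
Qed.

(** Values at index $m-1$ are part of those at index $m$, so everything up to $\tau_{m-1}$ carries
    the combined parameters $az$, $b+v$, $\theta'+\theta$, and the last window only $z$, $v$,
    $\theta$. *)
Lemma first_passage_transform (a z b v th' th : R[i]) m :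
  normc a <= 1 -> normc z <= 1 -> 0 <= complex.Re b -> 0 <= complex.Re v ->
  0 <= complex.Re th' -> 0 <= complex.Re th ->
  cexpectation P (first_passage_term a z b v th' th m)
  = if m is m'.+1 then gamma 0 (a * z) (b + v) (th' + th) * gamma 1 (a * z) (b + v) (th' + th) ^+ m'
      * gamma 1 z v th else gamma 0 z v th.
Proof.
move=> na nz rb rv rt' rt.
have naz : normc (a * z) <= 1 by rewrite Normc.normcM mulr_ile1 ?normc_ge0.
have rbv : 0 <= complex.Re (b + v) by rewrite ReD addr_ge0.
have rtt : 0 <= complex.Re (th' + th) by rewrite ReD addr_ge0.
transitivity (cexpectation P (fun w => cexp (- (exponent (a * z) (b + v) (th' + th) * (before tau m w)%:C))
     * cexp (- (exponent z v th * (tau m w - before tau m w)%:C)))); last first.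
  by rewrite delta_transform ?Re_exponent_ge0//; case: (m).
have mtau k : measurable_fun setT (tau k : TD -> R) by exact: measurable_sum.
rewrite -(attack_transform naz nz rbv rv rtt rt (s := before tau m : TD -> R) (s' := tau m : TD -> R)) //.
- apply: (cexpectation_eq_off_null (N := ~` [set w | regular_times t w])).
  + by apply: measurableC; exact: measurable_regular_times.
  + exact: (regular_times_ae lam0 ht).
  + move=> w /= /contrapT rw; have [t0 tc] := rw.
    have tlt k : t k w < t k.+1 w by exact: (poisson_process_lt ht).
    (* This reconciles the case $m=0$, where the earlier time is 0, with the value 0 of the sums at
       index $-1$. *)
    have K0 : K 0 w = 0%N.
      by apply/eqP; rewrite -leqn0 leqNgt; apply/negP; rewrite count_leP// leNgt t0.
    have bn : before reg_nodes m w = (\sum_(k < K (before tau m w) w) n k w)%N.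
      by case: (m) => [|m'] /=; rewrite ?K0 ?big_ord0// /reg_nodes /good asboolT.
    have bw : before reg_weight m w = \sum_(k < K (before tau m w) w) attack_weight n wt k w.
      by case: (m) => [|m'] /=; rewrite ?K0 ?big_ord0// /reg_weight /good asboolT.
    rewrite /first_passage_term bn bw /reg_nodes /reg_weight /good asboolT// marksE; last first.
      by apply: count_le_homo => //; exact: before_obs_time_le.
    rewrite -cexpD; congr (_ * cexp _); rewrite rmorphB/=; ring.
- by case: (m) => [|k]; [exact: measurable_cst|exact: mtau].
- exact: before_obs_time_ge0.
- exact: before_obs_time_le.
Qed.

Hypothesis hDnz : ~ {ae P, forall w, Delta 1%N w = 0}.

(** The rate $\lambda/2$ is a lower bound for $\mathrm{Re}(\theta+\lambda-\lambda g(zl(v)))$ when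
    $|z|\le 1/2$, since then $|g(zl(v))|\le 1/2$. *)
Definition decay_rate : R := \int[P]_w expR (- (lam / 2 * Delta 1%N w)).

Let decay_ge0 w : 0 <= lam / 2 * Delta 1%N w.
Proof. by rewrite mulr_ge0// divr_ge0// ltW. Qed.

Let decay_le1 w : expR (- (lam / 2 * Delta 1%N w)) <= 1.
Proof. by rewrite -[leRHS]expR0 ler_expR oppr_le0. Qed.

Let mdecay : measurable_fun setT (fun w => expR (- (lam / 2 * Delta 1%N w))).
Proof.
apply: measurableT_comp => //; apply: measurableT_comp => //; exact: measurable_funM.
Qed.

Let idecay : P.-integrable setT (EFin \o (fun w => expR (- (lam / 2 * Delta 1%N w)))).
Proof.
by apply: (integrable_bounded P (c := 1)) => // w; rewrite ger0_norm ?expR_ge0.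
Qed.

Lemma decay_rate_ge0 : 0 <= decay_rate.
Proof. by apply: Rintegral_ge0 => w _; exact: expR_ge0. Qed.

(** Otherwise the nonnegative variable $1-e^{-\lambda\Delta_1/2}$ would have integral 0 and vanish
    almost surely, forcing $\Delta_1=0$ almost surely. *)
Lemma decay_rate_lt1 : decay_rate < 1.
Proof.
rewrite ltNge; apply/negP => r1; apply: hDnz.
pose g w := 1 - expR (- (lam / 2 * Delta 1%N w)).
have g0 w : 0 <= g w by rewrite subr_ge0.
have mg : measurable_fun setT g by exact: measurable_funB.
have : (\int[P]_w `|(g w)%:E| = 0)%E.
  have gE : (\int[P]_w `|(g w)%:E| = \int[P]_w (g w)%:E)%E.
    by apply: eq_integral => w _; rewrite gee0_abs// lee_fin.
  rewrite gE -[LHS]fineK; last first.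
    by apply: integrable_fin_num => //; exact: integrableB (integrable_cst_prob P 1) idecay.
  congr EFin; apply/eqP; rewrite eq_le fine_ge0 ?andbT; last first.
    by apply: integral_ge0 => w _; rewrite lee_fin.
  have := @RintegralB _ _ _ P setT (cst 1) _ measurableT (integrable_cst_prob P 1) idecay.
  by rewrite Rintegral_cst_prob /Rintegral => ->; rewrite subr_le0.
move/(ae_eq_integral_abs P measurableT (iffRL (measurable_EFinP _ _) mg)).
apply: filterS => w /(_ I) [] /eqP; rewrite subr_eq0 eq_sym => /eqP.
rewrite -[1 in RHS]expR0 => /expR_inj /eqP; rewrite oppr_eq0 mulf_eq0 => /orP[|/eqP//].
by rewrite mulf_eq0 invr_eq0 pnatr_eq0 orbF gt_eqF.
Qed.

Lemma normc_lst_decay c : lam / 2 <= complex.Re c -> normc (lst (Delta 1%N) c) <= decay_rate.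
Proof.
move=> rc; rewrite /lst cexpectationE; apply: normc_cintegral => //.
  apply: (cintegrable_bounded _ (c := 1)) => [|w].
    apply/cmeasurable_cexp/cmeasurableN/cmeasurableM; first exact: cmeasurable_cst.
    exact: cmeasurable_real.
  apply: normc_cexp_le1; rewrite ReN ReM /= mulr0 subr0 oppr_le0 mulr_ge0//.
  by apply: le_trans rc; rewrite divr_ge0// ltW.
move=> w _; rewrite normc_cexp ler_expR ReN ReM /= mulr0 subr0 lerN2.
by rewrite ler_wpM2r.
Qed.

Lemma normc_increment_transform_le1 i z v th : normc z <= 1 -> 0 <= complex.Re v ->
  0 <= complex.Re th -> normc (gamma i z v th) <= 1.
Proof. by move=> nz rv rt; apply: normc_lst_le1 => //; exact: Re_exponent_ge0. Qed.

Lemma normc_increment_transform_decay z v th : normc z <= 2^-1 -> 0 <= complex.Re v ->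
  0 <= complex.Re th -> normc (gamma 1 z v th) <= decay_rate.
Proof.
move=> nz rv rt; apply: normc_lst_decay.
have nz1 : normc z <= 1 by apply: le_trans nz _; lra.
have := le_trans (normc_psi hn1 hwt0 nz1 rv) nz; rewrite -/(psi n wt z v).
move: (psi n wt z v) => p np; have := le_trans (ler_norm _) (le_trans (normc_Re p) np).
move=> /(ler_wpM2l (ltW lam0)) pr; rewrite !ReImE/= mul0r subr0.
by move: (complex.Re th) (complex.Re p) rt pr => a b a0 pr; lra.
Qed.

(** Markov's inequality for $2^{-N_m}$: on the event this variable is at least $2^{-p}$, and its
    mean is the transform at $z=1/2$, a product of one $\gamma_0$ and $m$ factors $\gamma$. *)
Lemma tail_reg_nodes p m : fine (P [set w | (reg_nodes m w <= p)%N]) <= 2 ^+ p * decay_rate ^+ m.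
Proof.
pose A := [set w | (reg_nodes m w <= p)%N].
have mA : measurable A.
  rewrite -[A]setTI; exact: (measurable_reg_nodes m _ (Y := [set k | (k <= p)%N])).
pose g w : R := 2^-1 ^+ reg_nodes m w.
have mg : measurable_fun setT g.
  by apply: (measurableT_comp (f := fun k : nat => 2^-1 ^+ k : R)) => //; exact: measurable_reg_nodes.
have ig : P.-integrable setT (EFin \o g).
  apply: (integrable_bounded P (c := 1)) => // w.
  rewrite ger0_norm ?exprn_ge0 ?exprn_ile1 ?invr_ge0//; lra.
have gE : \int[P]_w g w <= decay_rate ^+ m.
  have -> : \int[P]_w g w = complex.Re (cexpectation P (first_passage_term 1 (2^-1)%:C 0 0 0 0 m)).
    rewrite cexpectationE/=; apply: eq_Rintegral => w _.
    by rewrite /first_passage_term expr1n !mul0r !subr0 oppr0 cexp0 !mulr1 mul1r -realcX.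
  have h1 : normc (1 : R[i]) <= 1 by rewrite normc1'.
  have h2 : normc ((2^-1 : R)%:C) <= 2^-1 by rewrite normc_real ger0_norm// invr_ge0.
  have h3 : normc ((2^-1 : R)%:C) <= 1 by apply: le_trans h2 _; lra.
  apply: le_trans (ler_norm _) (le_trans (normc_Re _) _).
  rewrite first_passage_transform//= mul1r !add0r.
  case: (m) => [|m']; first by rewrite expr0 normc_increment_transform_le1.
  rewrite exprSr !Normc.normcM normcX ler_pM ?mulr_ge0 ?exprn_ge0 ?normc_ge0//.
    rewrite -[leRHS]mul1r ler_pM ?exprn_ge0 ?normc_ge0 ?normc_increment_transform_le1//.
    by rewrite lerXn2r ?nnegrE ?normc_ge0 ?decay_rate_ge0// normc_increment_transform_decay.
  by rewrite normc_increment_transform_decay.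
have i2 : P.-integrable setT (EFin \o (fun w => 2 ^+ p * g w)).
  have := @integrableZl _ _ _ P setT measurableT (2 ^+ p) _ ig.
  by apply: eq_integrable => // w _; rewrite /= EFinM.
have := normc_cintegral measurableT (cbounded_cintegrable P (cbounded_indic mA)) i2.
rewrite -cexpectationE cexpectation_indic// normc_real ger0_norm ?fine_ge0// => h.
apply: le_trans (h _) _ => [w _|].
  rewrite normc_real indicE; case: (boolP (w \in A)) => [|_]; last first.
    by rewrite normr0 mulr_ge0// exprn_ge0// invr_ge0.
  rewrite inE /A/= normr1 /g exprVn => Nw.
  by rewrite ler_pdivlMr ?exprn_gt0// mul1r ler_weXn2l// ler1n.
rewrite RintegralZl// ler_pM2l// exprn_gt0//.
Qed.

End ObservedTransform.

(** * First passage *)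

Section IndexInfimum.
Context {R : realType}.
Implicit Types Q : set nat.

Lemma inf_index_ge Q k : (forall j, Q j -> (k <= j)%N) -> (k%:R%:E <= inf_index (R := R) Q)%E.
Proof. by move=> Qk; apply: le_ereal_inf_tmp => _ [j Qj <-]; rewrite lee_fin ler_nat Qk. Qed.

Lemma inf_index_min Q k : Q k -> (forall j, Q j -> (k <= j)%N) -> inf_index (R := R) Q = k%:R%:E.
Proof.
move=> Qk kmin; apply/eqP; rewrite eq_le inf_index_ge// andbT.
by apply: ereal_inf_lbound; exists k.
Qed.

Lemma inf_index0 : inf_index (R := R) set0 = +oo%E.
Proof. by rewrite /inf_index image_set0 ereal_inf0. Qed.

End IndexInfimum.

Lemma normcN {R : realType} (z : R[i]) : normc (- z) = normc z.
Proof. by rewrite -sub0r normc_sub subr0. Qed.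

Lemma normc_sum_le {R : realType} n (F : nat -> R[i]) (C : R) : (forall m, normc (F m) <= C) ->
  normc (\sum_(m < n) F m) <= n%:R * C.
Proof.
move=> FC; apply: (le_trans (normc_sum _ _ _)).
apply: (@le_trans _ _ (\sum_(m < n) C)); first exact: ler_sum.
by rewrite sumr_const card_ord mulr_natl.
Qed.

(** * First passage of nondecreasing sequences and its transforms *)

Section Passage.
Context {R : realType} d (T : measurableType d) (P : probability T R).
Variables (N : nat -> T -> nat) (W : nat -> T -> R) (c : nat -> T -> R[i]) (r : R).
Hypotheses (mN : forall m, measurable_fun setT (N m)) (mW : forall m, measurable_fun setT (W m))
  (mc : forall m, cmeasurable setT (c m)).
Hypotheses (N_homo : forall m w, (N m w <= N m.+1 w)%N) (W_homo : forall m w, W m w <= W m.+1 w)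
  (W0 : forall m w, 0 <= W m w) (c1 : forall m w, normc (c m w) <= 1).
Hypotheses (r0 : 0 <= r) (r1 : r < 1)
  (tail : forall p m, fine (P [set w | (N m w <= p)%N]) <= 2 ^+ p * r ^+ m).

Definition passage p s w : R[i] :=
  at_index (Order.min (inf_index [set m | (p < N m w)%N]) (inf_index [set m | s < W m w])) (c ^~ w).

Definition stay (p : nat) (s : R) (i : nat) (x : R) : R[i] := if (i <= p)%N && (x <= s) then 1 else 0.

Definition passage_sum p s n w : R[i] :=
  \sum_(m < n) c m w * (stay p s (before N m w) (before W m w) - stay p s (N m w) (W m w)).

(** Since $N$ and $W$ are nondecreasing, the summand of index $m$ survives only at the first index
    where one of the bounds fails, which is the smaller of the two passage indices. If no bound ever
    fails, [at_index] gives 0 and so does the sum. *)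
Lemma passage_sumE p s w : 0 <= s ->
  (exists k, [/\ passage p s w = c k w,
     (forall n, passage_sum p s n w = if (k < n)%N then c k w else 0) &
     forall n, (n < k)%N -> (N n w <= p)%N])
  \/ (passage p s w = 0 /\ forall n, passage_sum p s n w = 0).
Proof.
move=> s0; pose B m := (N m w <= p)%N && (W m w <= s).
(* The condition at index $m-1$. At $m=0$ it is true, because the values at index $-1$ are 0 and
   $s\ge 0$. *)
pose B' m := if m is m'.+1 then B m' else true.
have Bhomo m k : (m <= k)%N -> B k -> B m.
  move=> mk /andP[Nk Wk]; apply/andP; split.
    by apply: leq_trans Nk; elim: k mk {Wk} => [|k IH]; [rewrite leqn0 => /eqP->|
      rewrite leq_eqVlt => /orP[/eqP->//|/IH h]; exact: leq_trans h (N_homo k w)].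
  by apply: le_trans Wk; elim: k mk {Nk} => [|k IH]; [rewrite leqn0 => /eqP->|
    rewrite leq_eqVlt => /orP[/eqP->//|/IH h]; exact: le_trans h (W_homo k w)].
have stepE m : stay p s (before N m w) (before W m w) - stay p s (N m w) (W m w)
    = ((B' m)%:R - (B m)%:R : R[i]).
  rewrite /stay -/(B m); case: m => [|m]/=; first by rewrite s0; case: (B 0%N).
  by rewrite -/(B m); case: (B m); case: (B m.+1).
rewrite /passage_sum.
case: (pselect (exists k, ~~ B k)) => [exk|nk]; [left|right].
  case: (ex_minnP exk) => k Bk kmin.
  have BE m : B m = (m < k)%N.
    apply/idP/idP => [Bm|mk]; last by apply: contraT => /kmin; rewrite leqNgt mk.
    by rewrite ltnNge; apply: contra Bk => km; exact: Bhomo km Bm.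
  have rhoE : Order.min (inf_index [set m | (p < N m w)%N]) (inf_index [set m | s < W m w])
      = k%:R%:E :> \bar R.
    have kN j : (p < N j w)%N -> (k <= j)%N by rewrite ltnNge => h; apply: kmin; rewrite /B (negbTE h).
    have kW j : s < W j w -> (k <= j)%N by rewrite ltNge => h; apply: kmin; rewrite /B (negbTE h) andbF.
    move: Bk; rewrite /B negb_and -ltnNge -ltNge => /orP[h|h].
      by rewrite (inf_index_min h kN) min_l// inf_index_ge.
    by rewrite (inf_index_min h kW) min_r// inf_index_ge.
  exists k; split => [|n|n]; last by rewrite -BE => /andP[].
    by rewrite /passage rhoE /= natrK.
  under eq_bigr do rewrite stepE.
  transitivity (\sum_(m < n | m == k :> nat) c m w); last by rewrite (big_ord1_eq _ (c ^~ w)).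
  rewrite [RHS]big_mkcond/=; apply: eq_bigr => m _.
  have -> : B' m = (m <= k)%N by rewrite /B'; case: (m : nat) => //= m'; rewrite BE.
  rewrite BE leq_eqVlt; case: eqVneq => [->|_]/=; first by rewrite ltnn subr0 mulr1.
  by rewrite subrr mulr0.
have BT m : B m by apply: contraT => h; case: nk; exists m.
split=> [|n].
  have A0 : [set m | (p < N m w)%N] = set0.
    by apply/seteqP; split => // m /=; rewrite ltnNge; have /andP[-> _] := BT m.
  have A1 : [set m | s < W m w] = set0.
    by apply/seteqP; split => // m /=; rewrite ltNge; have /andP[_ ->] := BT m.
  by rewrite /passage A0 A1 inf_index0 minxx.
rewrite big1// => m _; rewrite stepE /B'.
by case: (m : nat) => [|m']; rewrite ?BT subrr mulr0.
Qed.

Lemma normc_passage_le1 p s w : 0 <= s -> normc (passage p s w) <= 1.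
Proof. by move/(passage_sumE p w) => [[k [-> _ _]]|[-> _]]; rewrite ?normc0'. Qed.

(** The sum over indices up to [n] differs from its limit only if passage occurs after [n], and then
    $N_n\le p$; the bound is independent of [s]. *)
Lemma passage_sum_dist p s n w : 0 <= s ->
  normc (passage p s w - passage_sum p s n.+1 w) <= 1 * \1_[set w | (N n w <= p)%N] w.
Proof.
rewrite mul1r => /(passage_sumE p w) [[k [-> -> kn]]|[-> ->]]; last first.
  by rewrite subrr normc0' indicE.
case: ifPn => [_|nk]; first by rewrite subrr normc0' indicE.
by rewrite subr0 indicE mem_set// /=; apply: kn; rewrite -leqNgt in nk.
Qed.

Lemma passage_sum_cvg p s w : 0 <= s -> clim (fun n => passage_sum p s n w) (passage p s w).
Proof.
move/(passage_sumE p w) => [[k [-> h _]]|[-> h]]; last first.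
  by apply: (eq_clim (u := fun=> 0)) => //; exact: clim_cst.
apply: (clim_bound_near (e := fun=> 0)); first exact: cvg_cst.
by exists k.+1 => // n /= kn; rewrite h kn subrr normc0'.
Qed.

Lemma cmeasurable_stay d' (X : measurableType d') p (s : X -> R) (i : X -> nat) (x : X -> R) :
  measurable_fun setT s -> measurable_fun setT i -> measurable_fun setT x ->
  cmeasurable setT (fun w => stay p (s w) (i w) (x w)).
Proof.
move=> ms mi mx; apply: (cmeasurable_if (b := fun w => (i w <= p)%N && (x w <= s w))).
- by apply: measurable_and; [exact: measurable_fun_leq|exact: measurable_fun_ler].
- exact: cmeasurable_cst.
- exact: cmeasurable_cst.
Qed.

Let mbN m : measurable_fun setT (before N m).
Proof. by case: m => [|m]; [exact: measurable_cst|exact: mN]. Qed.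

Let mbW m : measurable_fun setT (before W m).
Proof. by case: m => [|m]; [exact: measurable_cst|exact: mW]. Qed.

Lemma cmeasurable_passage_sum d' (X : measurableType d') p n (s : X -> R) (g : X -> T) :
  measurable_fun setT s -> measurable_fun setT g ->
  cmeasurable setT (fun x => passage_sum p (s x) n (g x)).
Proof.
move=> ms mg; apply: cmeasurable_sum => m; apply: cmeasurableM.
  exact: (cmeasurable_comp mg (mc m)).
by apply: cmeasurableB; apply: cmeasurable_stay => //; exact: (measurableT_comp _ mg).
Qed.

Let stay_le1 p s i x : normc (stay p s i x) <= 1.
Proof. by rewrite /stay; case: ifP; rewrite ?normc0' ?normc1'. Qed.

Lemma normc_passage_sum p s n w : normc (passage_sum p s n w) <= n%:R * 2.
Proof.
apply: (normc_sum_le _ (F := fun m =>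
  c m w * (stay p s (before N m w) (before W m w) - stay p s (N m w) (W m w)))) => m; rewrite Normc.normcM -[leRHS]mul1r ler_pM ?normc_ge0//.
apply: (le_trans (le_normcD _ _)); rewrite normcN -[2]/(1 + 1) lerD//.
Qed.

Lemma cbounded_passage_sum p s n : cbounded (passage_sum p s n).
Proof.
split; last by exists (n%:R * 2) => w; exact: normc_passage_sum.
by apply: (cmeasurable_passage_sum _ _ (s := fun=> s) (g := id)).
Qed.

Lemma cbounded_passage p s : 0 <= s -> cbounded (passage p s).
Proof.
move=> s0; apply: cbounded_le1 => [|w]; last exact: normc_passage_le1.
apply: (cmeasurable_lim (F := fun n => passage_sum p s n)) => [n|w _].
  exact: (cbounded_passage_sum _ _ _).1.
exact: passage_sum_cvg.
Qed.

Definition passage_mean p s := cexpectation P (passage p s).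
Definition passage_sum_mean p n s := cexpectation P (passage_sum p s n).

Lemma passage_mean_dist p n s : 0 <= s ->
  normc (passage_mean p s - passage_sum_mean p n.+1 s) <= 2 ^+ p * r ^+ n.
Proof.
move=> s0; apply: le_trans (tail p n); rewrite -[leRHS]mul1r.
apply: cexpectation_dist_indic => [|||w]; [exact: cbounded_passage|exact: cbounded_passage_sum| |].
  by rewrite -[X in measurable X]setTI; exact: (mN n _ (Y := [set k | (k <= p)%N])).
exact: passage_sum_dist.
Qed.

Let rX : (fun n => r ^+ n) @ \oo --> (0 : R).
Proof. by apply: cvg_expr; rewrite ger0_norm. Qed.

(** For $q<s$ the two cut-offs differ only where $q<X\le s$, an event whose probability is an
    increment of the distribution function of $X$. *)
Lemma right_continuous_stay_mean (i : T -> nat) (X : T -> R) (z : T -> R[i]) p q e :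
  measurable_fun setT i -> measurable_fun setT X -> cmeasurable setT z ->
  (forall w, normc (z w) <= 1) -> 0 < e ->
  \forall s \near q^'+, normc (cexpectation P (fun w => z w * stay p q (i w) (X w))
    - cexpectation P (fun w => z w * stay p s (i w) (X w))) < e.
Proof.
move=> mi mX mz z1 e0.
pose X' : {RV P >-> R} := HB.pack X (isMeasurableFun.Build _ _ _ _ X mX).
have : cdf X' s @[s --> q^'+] --> (fine (cdf X' q))%:E.
  by rewrite fineK ?fin_num_measure//; exact: cdf_right_continuous.
move=> /fine_cvg/cvgrPdist_lt/(_ e e0).
have qe : \forall s \near q^'+, q < s by exact: nbhs_right_gt.
apply: filterS2 qe => s qs h.
pose A := X @^-1` `]q, s].
have mA : measurable A by rewrite -[A]setTI; exact: (mX measurableT).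
have PA : fine (P A) = fine (cdf X' s) - fine (cdf X' q).
  rewrite /cdf/= /distribution/= /pushforward.
  have mle b : measurable (X @^-1` `]-oo, b]) by rewrite -[X in measurable X]setTI; exact: (mX measurableT).
  rewrite -fineB ?fin_num_measure//; congr fine.
  have -> : A = X @^-1` `]-oo, s] `\` X @^-1` `]-oo, q].
    apply/seteqP; split => w /=; rewrite /A/= !in_itv/=.
      by move=> /andP[h1 h2]; split => //; apply/negP; rewrite -ltNge.
    by move=> [h1 /negP]; rewrite -ltNge => h2; rewrite h1 h2.
  rewrite measureD ?ltey_eq ?fin_num_measure//; congr (_ - P _)%E.
  apply: setIidr => w /=; rewrite !in_itv/= => /le_trans; apply; exact: ltW.
apply: le_lt_trans h; rewrite distrC (le_trans _ (ler_norm _))// -PA -[leRHS]mul1r.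
have bstay s' : cbounded (fun w => z w * stay p s' (i w) (X w)).
  apply: cboundedM; first exact: cbounded_le1.
  apply: cbounded_le1 => [|w]; last exact: stay_le1.
  by apply: (cmeasurable_stay _ (s := fun=> s')).
apply: cexpectation_dist_indic => // w.
rewrite mul1r -mulrBr Normc.normcM -[leRHS]mul1r ler_pM ?normc_ge0// /stay indicE.
case: (i w <= p)%N; last by rewrite !andFb subrr normc0'.
rewrite !andTb.
have [Xq|qX] := leP (X w) q; first by rewrite (le_trans Xq (ltW qs)) subrr normc0'.
have [Xs|sX] := leP (X w) s; last by rewrite subrr normc0'.
by rewrite sub0r normcN normc1' mem_set// /A/= in_itv/= qX Xs.
Qed.

(** The truncation error is uniform in [s], so it takes a quarter of the tolerance at each of the
    two points, and half remains for the finitely many right-continuous terms. *)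
Lemma right_continuous_passage_mean p q : 0 <= q -> right_continuous_at (passage_mean p) q.
Proof.
move=> q0; apply/right_continuous_atP => e e0.
have e4 : 0 < e / 4 by rewrite divr_gt0.
have [n Hn] : exists n, 2 ^+ p * r ^+ n < e / 4.
  have : (fun n => 2 ^+ p * r ^+ n) @ \oo --> (2 ^+ p * 0 : R) by apply: cvgM => //; exact: cvg_cst.
  rewrite mulr0 => /cvgrPdist_lt/(_ _ e4)[n _ /(_ n (leqnn n))].
  by rewrite sub0r normrN ger0_norm ?mulr_ge0 ?exprn_ge0// => h; exists n.
pose term m s w := c m w * (stay p s (before N m w) (before W m w) - stay p s (N m w) (W m w)).
have n2 : 0 < e / 2 / (2 * n.+1%:R) by rewrite !divr_gt0// mulr_gt0// ltr0n.
have bstay m s : cbounded (fun w => c m w * stay p s (before N m w) (before W m w)).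
  apply: cboundedM; first exact: cbounded_le1.
  apply: cbounded_le1 => [|w]; last exact: stay_le1.
  by apply: (cmeasurable_stay _ (s := fun=> s)).
have astay m s : cbounded (fun w => c m w * stay p s (N m w) (W m w)).
  apply: cboundedM; first exact: cbounded_le1.
  apply: cbounded_le1 => [|w]; last exact: stay_le1.
  by apply: (cmeasurable_stay _ (s := fun=> s)).
pose U m s := cexpectation P (fun w => c m w * stay p s (before N m w) (before W m w)).
pose L m s := cexpectation P (fun w => c m w * stay p s (N m w) (W m w)).
have sumE s : passage_sum_mean p n.+1 s = \sum_(m < n.+1) (U m s - L m s).
  rewrite /passage_sum_mean /passage_sum cexpectation_sum => [|m]; last first.
    by under eq_fun do rewrite mulrBr; exact: cboundedB.
  apply: eq_bigr => m _; rewrite -cexpectationB//.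
  by apply: eq_cexpectation => w; rewrite mulrBr.
have near_all : \forall s \near q^'+, forall m : 'I_n.+1,
    normc (U m q - U m s) < e / 2 / (2 * n.+1%:R) /\ normc (L m q - L m s) < e / 2 / (2 * n.+1%:R).
  apply: filter_forall => m; apply: filterI; exact: right_continuous_stay_mean.
have qe : \forall s \near q^'+, q < s by exact: nbhs_right_gt.
apply: filterS2 qe near_all => s qs Hs.
have s0 := le_trans q0 (ltW qs).
have hq := passage_mean_dist p n q0; have hs := passage_mean_dist p n s0.
have hm : normc (passage_sum_mean p n.+1 q - passage_sum_mean p n.+1 s) <= e / 2.
  rewrite !sumE -sumrB; apply: (le_trans (normc_sum _ _ _)).
  apply: (@le_trans _ _ (\sum_(m < n.+1) e / 2 / n.+1%:R)); last first.
    by rewrite sumr_const card_ord -[leLHS]mulr_natr divfK.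
  apply: ler_sum => m _; have [h1 h2] := Hs m.
  have -> : U m q - L m q - (U m s - L m s) = (U m q - U m s) + - (L m q - L m s) by ring.
  apply: (le_trans (le_normcD _ _)).
  rewrite normcN; apply: (le_trans (lerD (ltW h1) (ltW h2))).
  by rewrite invfM mulrA -mulrDl [e / 2 / 2 + _]addrC -splitr.
have -> : passage_mean p q - passage_mean p s = (passage_mean p q - passage_sum_mean p n.+1 q)
   + ((passage_sum_mean p n.+1 q - passage_sum_mean p n.+1 s)
   + - (passage_mean p s - passage_sum_mean p n.+1 s)) by ring.
apply: (le_lt_trans (le_normcD _ _)).
apply: (le_lt_trans (lerD (lexx _) (le_normcD _ _))); rewrite normcN.
move: hq hs hm Hn; move: (normc _) (normc _) (normc _) (2 ^+ p * _) => a b c' d' *; lra.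
Qed.

Local Notation mu := (@lebesgue_measure R).
Local Notation D := `[0, +oo[%classic.

Let mD : measurable (D : set (measurableTypeR R)).
Proof. exact: measurable_itv. Qed.

Section LaplaceTransforms.
Variable y : R[i].
Hypothesis y0 : 0 < complex.Re y.
Let a := complex.Re y.

Let e (s : R) := cexp (- (y * s%:C)).

Let normc_e s : normc (e s) = expR (- (a * s)).
Proof. by rewrite normc_cexp ReN ReM /= mulr0 subr0. Qed.

Let decay : mu.-integrable D (EFin \o fun s => expR (- (a * s)))
  /\ \int[mu]_(s in D) expR (- (a * s)) = a^-1.
Proof.
have [] := @laplace_step R a%:C 0 y0 (lexx 0).
have aE s : cexp (- (a%:C * s%:C)) = (expR (- (a * s)))%:C by rewrite -rmorphM -rmorphN cexp_real.
move=> [ir _] eq; split.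
  move: ir; apply: eq_integrable => // s; rewrite inE /= in_itv/= andbT => s0.
  by rewrite s0 mulr1 aE.
rewrite rmorph0 mulr0 oppr0 cexp0 mul1r (_ : (a%:C)^-1 = (a^-1)%:C) in eq; last by rewrite fmorphV.
move/(congr1 (@complex.Re R)): eq; rewrite /cintegral/=.
move=> <-; apply: eq_Rintegral => s; rewrite inE /= in_itv/= andbT => s0.
by rewrite s0 mulr1 aE.
Qed.

Let scaled_decay (C : R) : mu.-integrable D (EFin \o fun s => C * expR (- (a * s)))
  /\ \int[mu]_(s in D) (C * expR (- (a * s))) = C / a.
Proof.
have [i1 <-] := decay; split; last by rewrite RintegralZl.
have := @integrableZl _ _ _ mu D mD C _ i1.
by apply: eq_integrable => // w _; rewrite /= EFinM.
Qed.

(* [lap_stay p i x / y] is the Laplace transform of [fun s => stay p s i x] at [y]. *)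
Definition lap_stay (p i : nat) (x : R) : R[i] := if (i <= p)%N then cexp (- (y * x%:C)) else 0.

Definition lap_sum p n w : R[i] :=
  \sum_(m < n) c m w * (lap_stay p (before N m w) (before W m w) - lap_stay p (N m w) (W m w)).

Let lap_stayE p i x : 0 <= x -> cintegrable mu D (fun s => e s * stay p s i x)
  /\ cintegral mu D (fun s => e s * stay p s i x) = lap_stay p i x / y.
Proof.
move=> x0; rewrite /stay /lap_stay; case: (i <= p)%N => /=; first exact: laplace_step.
have -> : (fun s : R => e s * 0) = (fun=> 0) by apply/funext => s; rewrite mulr0.
rewrite mul0r cintegral0//; split => //; exact: cintegrable0.
Qed.

Let bW0 m w : 0 <= before W m w.
Proof. by case: m => [|m]; [exact: lexx|exact: W0]. Qed.

Let me : cmeasurable setT (e : measurableTypeR R -> R[i]).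
Proof.
apply/cmeasurable_cexp/cmeasurableN/cmeasurableM; first exact: cmeasurable_cst.
exact: cmeasurable_real.
Qed.

Lemma cbounded_lap_stay p (i : T -> nat) (x : T -> R) : measurable_fun setT i -> measurable_fun setT x ->
  (forall w, 0 <= x w) -> cbounded (fun w => lap_stay p (i w) (x w)).
Proof.
move=> mi mx x0; apply: cbounded_le1 => [|w].
  apply: (cmeasurable_if (b := fun w => (i w <= p)%N)).
  - exact: measurable_fun_leq.
  - apply/cmeasurable_cexp/cmeasurableN/cmeasurableM; first exact: cmeasurable_cst.
    exact: cmeasurable_real.
  - exact: cmeasurable_cst.
rewrite /lap_stay; case: ifP => _; rewrite ?normc0'//.
by apply: normc_cexp_le1; rewrite ReN ReM /= mulr0 subr0 oppr_le0 mulr_ge0// ltW.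
Qed.

Lemma cbounded_lap_sum p n : cbounded (lap_sum p n).
Proof.
apply: cbounded_sum => m; apply: cboundedM; first exact: cbounded_le1.
by apply: cboundedB; exact: cbounded_lap_stay.
Qed.

(** Fubini exchanges the expectation with the integral over [s]; each cut-off then has an explicit
    transform, a step function starting at the attained weight. *)
Lemma laplace_passage_sum_mean p n :
  cintegrable mu D (fun s => e s * passage_sum_mean p n s)
  /\ cintegral mu D (fun s => e s * passage_sum_mean p n s) = cexpectation P (lap_sum p n) / y.
Proof.
pose f (x : measurableTypeR R * T) := e x.1 * passage_sum p x.1 n x.2.
have mf : cmeasurable setT f.
  apply: cmeasurableM; first exact: (cmeasurable_comp (h := fst)).
  by apply: cmeasurable_passage_sum; [exact: measurable_fst|exact: measurable_snd].
have fg x w : D x -> normc (f (x, w)) <= (n%:R * 2) * expR (- (a * x)).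
  move=> _; rewrite Normc.normcM normc_e mulrC ler_wpM2r ?expR_ge0//.
  exact: normc_passage_sum.
have [i1 i2] := @cintegral_cexpectation _ _ _ _ _ mu P D mD f _ mf (scaled_decay _).1 fg.
have E s : cexpectation P (fun w => f (s, w)) = e s * passage_sum_mean p n s.
  by rewrite /f/= cexpectationZ//; exact: cbounded_passage_sum.
have <- : (fun s : R => cexpectation P (fun w => f (s, w))) = (fun s => e s * passage_sum_mean p n s).
  by apply/funext.
split; first exact: i1.
rewrite i2 mulrC -cexpectationZ; last exact: cbounded_lap_sum.
apply: eq_cexpectation => w; rewrite /f /passage_sum/=.
transitivity (cintegral mu D (fun s => \sum_(m < n) (c m w *
   (e s * stay p s (before N m w) (before W m w) - e s * stay p s (N m w) (W m w))))).
  by apply: eq_cintegral => s _; rewrite mulr_sumr; apply: eq_bigr => m _; ring.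
have iu m := (lap_stayE p (before N m w) (bW0 m w)).
have il m := (lap_stayE p (N m w) (W0 m w)).
rewrite cintegral_sum//; last first.
  by move=> m; apply/cintegrableZ => //; apply: cintegrableB => //; [exact: (iu m).1|exact: (il m).1].
rewrite /lap_sum mulr_sumr; apply: eq_bigr => m _.
rewrite cintegralZ//; last by apply: cintegrableB => //; [exact: (iu m).1|exact: (il m).1].
rewrite cintegralB//; [|exact: (iu m).1|exact: (il m).1].
by rewrite (iu m).2 (il m).2; ring.
Qed.

(** Measurability in [s] is inherited from the truncated means, which converge pointwise and are
    measurable by Fubini. *)
Lemma cintegrable_passage_mean p : cintegrable mu D (fun s => e s * passage_mean p s).
Proof.
have [ig _] := decay; apply: cintegrable_le ig _ => //.
  apply: (cmeasurable_lim (F := fun n s => e s * passage_sum_mean p n.+1 s)) => [n|s].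
    have [[h1 h2] _] := laplace_passage_sum_mean p n.+1.
    by split; apply/measurable_EFinP; [exact: (measurable_int _ h1)|exact: (measurable_int _ h2)].
  rewrite /= in_itv/= andbT => s0; apply: climZ.
  apply: (clim_bound (e := fun n => 2 ^+ p * r ^+ n)) => [|n].
    by rewrite -[0](mulr0 (2 ^+ p)); apply: cvgM => //; exact: cvg_cst.
  by rewrite normc_sub; exact: passage_mean_dist.
move=> s Ds; have s0 : 0 <= s by move: Ds; rewrite /= in_itv/= andbT.
  rewrite Normc.normcM normc_e ler_piMr ?expR_ge0//.
by apply: normc_cexpectation => [|w]; [exact: (cbounded_passage _ s0).1|exact: normc_passage_le1].
Qed.

(** Will turn out to be the coefficient of $x^p$ in $F(x,y)/(1-x)$. *)
Definition passage_coef p : R[i] := y * cintegral mu D (fun s => e s * passage_mean p s).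

Lemma normc_passage_coef p : normc (passage_coef p) <= normc y / a.
Proof.
rewrite Normc.normcM ler_wpM2l ?normc_ge0//; have [ig <-] := decay.
apply: normc_cintegral => //; first exact: cintegrable_passage_mean.
move=> s Ds; have s0 : 0 <= s by move: Ds; rewrite /= in_itv/= andbT.
  rewrite Normc.normcM normc_e ler_piMr ?expR_ge0//.
by apply: normc_cexpectation => [|w]; [exact: (cbounded_passage _ s0).1|exact: normc_passage_le1].
Qed.

Let yn0 : y != 0.
Proof. by apply: contraTneq y0 => ->; rewrite ltxx. Qed.

Lemma passage_coef_dist p n :
  normc (passage_coef p - cexpectation P (lap_sum p n.+1)) <= normc y / a * (2 ^+ p * r ^+ n).
Proof.
have [i1 e1] := laplace_passage_sum_mean p n.+1.
have -> : cexpectation P (lap_sum p n.+1)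
    = y * cintegral mu D (fun s => e s * passage_sum_mean p n.+1 s) by rewrite e1 mulrC divfK.
have ip := cintegrable_passage_mean p.
rewrite /passage_coef -mulrBr -cintegralB// Normc.normcM -mulrA [a^-1 * _]mulrC ler_wpM2l ?normc_ge0//.
have [ig <-] := scaled_decay (2 ^+ p * r ^+ n).
apply: normc_cintegral => //; first exact: cintegrableB.
move=> s Ds; have s0 : 0 <= s by move: Ds; rewrite /= in_itv/= andbT.
  rewrite -mulrBr Normc.normcM normc_e mulrC.
by rewrite ler_wpM2r ?expR_ge0// passage_mean_dist.
Qed.

End LaplaceTransforms.

Definition power_sum (y x : R[i]) n w : R[i] :=
  \sum_(m < n) c m w * (x ^+ before N m w * cexp (- (y * (before W m w)%:C))
                        - x ^+ N m w * cexp (- (y * (W m w)%:C))).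

Let geometric_tail (x u : R[i]) (i k : nat) :
  (1 - x) * (\sum_(p < k) (if (i <= p)%N then u else 0) * x ^+ p) = u * (x ^+ i - x ^+ maxn i k).
Proof.
elim: k => [|k IH]; first by rewrite big_ord0 mulr0 maxn0 subrr mulr0.
rewrite big_ord_recr/= mulrDr IH; case: leqP => ik.
  by rewrite (maxn_idPr (leqW ik)) exprS; ring.
by rewrite (maxn_idPl ik) mul0r mulr0 addr0.
Qed.

Let geometric_half n : \sum_(p < n) (2^-1 : R) ^+ p <= 2.
Proof.
have -> : \sum_(p < n) (2^-1 : R) ^+ p = 2 - 2 * 2^-1 ^+ n.
  elim: n => [|n IH]; first by rewrite big_ord0 expr0 mulr1 subrr.
  by rewrite big_ord_recr/= IH exprS; field.
by rewrite gerBl mulr_ge0// exprn_ge0// invr_ge0.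
Qed.

Section PowerSeriesLimit.
Variables (y x : R[i]).
Hypotheses (y0 : 0 < complex.Re y) (x4 : normc x <= 4^-1).

Let x1 : normc x <= 1. Proof. by apply: le_trans x4 _; lra. Qed.

Let e (s : R) : R[i] := cexp (- (y * s%:C)).

Let e1 s : 0 <= s -> normc (e s) <= 1.
Proof.
by move=> s0; apply: normc_cexp_le1; rewrite ReN ReM /= mulr0 subr0 oppr_le0 mulr_ge0// ltW.
Qed.

Let bW0 m w : 0 <= before W m w.
Proof. by case: m => [|m]; [exact: lexx|exact: W0]. Qed.

Lemma cbounded_power_sum n : cbounded (power_sum y x n).
Proof.
have be (i : T -> nat) (s : T -> R) : measurable_fun setT i -> measurable_fun setT s ->
    (forall w, 0 <= s w) -> cbounded (fun w => x ^+ i w * e (s w)).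
  move=> mi ms s0; apply: cbounded_le1 => [|w]; last first.
    by rewrite Normc.normcM mulr_ile1 ?normc_ge0 ?e1// normcX exprn_ile1 ?normc_ge0.
  apply: cmeasurableM.
    by apply: (cmeasurable_index (F := fun j _ => x ^+ j)) => // j; exact: cmeasurable_cst.
  apply/cmeasurable_cexp/cmeasurableN/cmeasurableM; first exact: cmeasurable_cst.
  exact: cmeasurable_real.
apply: cbounded_sum => m; apply: cboundedM; first exact: cbounded_le1.
by apply: cboundedB; exact: be.
Qed.

(** Summing the cut-offs over $p<k$ leaves only the terms $x^{\max(i,k)}$ of [geometric_tail], of
    modulus at most $|x|^k$. *)
Let lap_power_dist k n w :
  normc ((1 - x) * (\sum_(p < k) lap_sum y p n w * x ^+ p) - power_sum y x n w)
  <= n%:R * (2 * normc x ^+ k).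
Proof.
have -> : (1 - x) * (\sum_(p < k) lap_sum y p n w * x ^+ p) - power_sum y x n w
    = \sum_(m < n) - (c m w * (e (before W m w) * x ^+ maxn (before N m w) k
                            - e (W m w) * x ^+ maxn (N m w) k)).
  rewrite /lap_sum; under eq_bigr do rewrite mulr_suml.
  rewrite exchange_big/= mulr_sumr /power_sum -sumrB; apply: eq_bigr => m _.
  transitivity (c m w * ((1 - x) * (\sum_(p < k) (if (before N m w <= p)%N then e (before W m w) else 0) * x ^+ p)
     - (1 - x) * (\sum_(p < k) (if (N m w <= p)%N then e (W m w) else 0) * x ^+ p))
     - c m w * (x ^+ before N m w * e (before W m w) - x ^+ N m w * e (W m w))).
    congr (_ - _); rewrite -mulrBr -sumrB [in RHS]mulrCA; congr (_ * _).
    by rewrite mulr_sumr; apply: eq_bigr => p _; rewrite /lap_stay -/(e _) -/(e _); ring.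
  by rewrite !geometric_tail; ring.
apply: (normc_sum_le _ (F := fun m => - (c m w * (e (before W m w) * x ^+ maxn (before N m w) k
                            - e (W m w) * x ^+ maxn (N m w) k)))) => m.
rewrite normcN Normc.normcM -[leRHS]mul1r ler_pM ?normc_ge0//.
have b1 i s : 0 <= s -> normc (e s * x ^+ maxn i k) <= normc x ^+ k.
  move=> s0; rewrite Normc.normcM -[leRHS]mul1r ler_pM ?normc_ge0 ?e1// normcX.
  by apply: ler_wiXn2l; rewrite ?normc_ge0 ?leq_maxr.
apply: (le_trans (le_normcD _ _)); rewrite normcN mulr_natl mulr2n.
by apply: lerD; exact: b1.
Qed.

(** The same [n] truncates both $m$ and $p$. Truncation in $m$ costs $C2^pr^n$ in each coefficient;
    weighted by $4^{-p}$ and by $|1-x|\le 2$ this sums to $4Cr^n$. Truncation in $p$ costs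
    $2(n+1)|x|^n\le 2\cdot 2^n4^{-n}$. *)
Lemma passage_series_dist n :
  normc ((1 - x) * (\sum_(p < n) passage_coef y p * x ^+ p) - cexpectation P (power_sum y x n.+1))
  <= 4 * (normc y / complex.Re y) * r ^+ n + 2 * 2^-1 ^+ n.
Proof.
pose C := normc y / complex.Re y.
have C0 : 0 <= C by rewrite divr_ge0 ?normc_ge0// ltW.
pose A p := cexpectation P (lap_sum y p n.+1).
have step1 : normc ((1 - x) * (\sum_(p < n) passage_coef y p * x ^+ p)
    - (1 - x) * (\sum_(p < n) A p * x ^+ p)) <= 4 * C * r ^+ n.
  rewrite -mulrBr Normc.normcM -sumrB.
  have h1 : normc (1 - x) <= 2.
    apply: (le_trans (le_normcD _ _)); rewrite normcN normc1'; move: x1; move: (normc x) => z ?; lra.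
  have h2 : normc (\sum_(p < n) (passage_coef y p * x ^+ p - A p * x ^+ p)) <= C * r ^+ n * 2.
    apply: (le_trans (normc_sum _ _ _)).
    apply: (@le_trans _ _ (C * r ^+ n * (\sum_(p < n) 2^-1 ^+ p))); last first.
      by rewrite ler_wpM2l// mulr_ge0// exprn_ge0.
    rewrite mulr_sumr; apply: ler_sum => p _; rewrite -mulrBl Normc.normcM normcX.
    have h3 := passage_coef_dist y0 p n.
    apply: (@le_trans _ _ (C * (2 ^+ p * r ^+ n) * 4^-1 ^+ p)).
      by apply: ler_pM; rewrite ?normc_ge0 ?exprn_ge0 ?normc_ge0// lerXn2r ?nnegrE ?normc_ge0// invr_ge0.
    have -> : (4^-1 : R) = 2^-1 * 2^-1 by field.
    rewrite exprMn exprVn; have : (2 ^+ p : R) != 0 by rewrite expf_neq0.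
    by move: (2 ^+ p) => z z0; rewrite le_eqVlt; apply/orP; left; apply/eqP; field.
  apply: (le_trans (ler_pM (normc_ge0 _) (normc_ge0 _) h1 h2)).
  by rewrite le_eqVlt; apply/orP; left; apply/eqP; ring.
have step2 : normc ((1 - x) * (\sum_(p < n) A p * x ^+ p) - cexpectation P (power_sum y x n.+1))
    <= 2 * 2^-1 ^+ n.
  have bl p : cbounded (lap_sum y p n.+1) by exact: cbounded_lap_sum.
  have bs : cbounded (fun w => \sum_(p < n) x ^+ p * lap_sum y p n.+1 w).
    by apply: cbounded_sum => p; exact: cboundedZ.
  have -> : (1 - x) * (\sum_(p < n) A p * x ^+ p)
      = cexpectation P (fun w => (1 - x) * (\sum_(p < n) x ^+ p * lap_sum y p n.+1 w)).
    rewrite cexpectationZ// cexpectation_sum => [|p]; last exact: cboundedZ.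
    by congr (_ * _); apply: eq_bigr => p _; rewrite cexpectationZ// mulrC.
  apply: (@le_trans _ _ (n.+1%:R * (2 * normc x ^+ n))).
    apply: cexpectation_dist => [||w]; [exact: cboundedZ|exact: cbounded_power_sum|].
    by under eq_bigr do rewrite mulrC; exact: lap_power_dist.
  rewrite mulrCA ler_wpM2l//.
  apply: (@le_trans _ _ (2 ^+ n * (2^-1 * 2^-1) ^+ n)).
    apply: ler_pM; rewrite ?exprn_ge0 ?normc_ge0//.
      by rewrite -natrX ler_nat ltn_expl.
    rewrite lerXn2r ?nnegrE ?normc_ge0 ?mulr_ge0 ?invr_ge0//.
    by have <- : (4^-1 : R) = 2^-1 * 2^-1 by field.
  by rewrite exprMn mulrA exprVn divff ?mul1r// expf_neq0.
rewrite (_ : _ - _ = ((1 - x) * (\sum_(p < n) passage_coef y p * x ^+ p)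
    - (1 - x) * (\sum_(p < n) A p * x ^+ p)) + ((1 - x) * (\sum_(p < n) A p * x ^+ p)
    - cexpectation P (power_sum y x n.+1))); last by ring.
by apply: (le_trans (le_normcD _ _)); exact: lerD.
Qed.

End PowerSeriesLimit.

(** Letting [n] grow in [passage_series_dist] expands $F(x,y)/(1-x)$ in powers of $x$; extracting a
    coefficient returns $y$ times the Laplace transform of the mean. *)
Lemma passage_inverse_laplace (F : R[i] -> R[i] -> R[i]) :
  (forall x y, normc x <= 4^-1 -> 0 < complex.Re y ->
     clim (fun n => cexpectation P (power_sum y x n.+1)) (F x y)) ->
  forall p, is_inverse_laplace (fun y => Dop p (F ^~ y) / y) (passage_mean p).
Proof.
move=> hF p; split => [q q0|y y0 h]; first exact: right_continuous_passage_mean.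
split; first exact: cintegrable_passage_mean.
suff -> : Dop p (F ^~ y) = passage_coef y p.
  by rewrite /passage_coef mulrC mulKf//; apply: contraTneq y0 => ->; rewrite ltxx.
apply: (@Dop_series _ _ _ _ (normc y / complex.Re y) 1 4^-1).
- by rewrite invr_gt0.
- exact: ltr01.
- by move=> k; rewrite expr1n mulr1; exact: normc_passage_coef.
move=> x /ltW x4.
have x1 : 1 - x != 0.
  apply: contraTneq x4 => /eqP; rewrite subr_eq0 => /eqP <-; rewrite normc1' -ltNge; lra.
have : clim (fun n => (1 - x) * (\sum_(k < n) passage_coef y k * x ^+ k)) (F x y).
  rewrite -[F x y]add0r; apply: (eq_clim (u := fun n =>
    ((1 - x) * (\sum_(k < n) passage_coef y k * x ^+ k) - cexpectation P (power_sum y x n.+1))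
    + cexpectation P (power_sum y x n.+1))); first by move=> n; rewrite subrK.
  apply: climD; last exact: hF.
  apply: (clim_bound (e := fun n => 4 * (normc y / complex.Re y) * r ^+ n + 2 * 2^-1 ^+ n)).
    rewrite -[0]addr0 -[X in _ --> X + _](mulr0 (4 * (normc y / complex.Re y))) -[X in _ --> _ + X](mulr0 2).
    apply: cvgD; apply: cvgM; try exact: cvg_cst; first exact: rX.
    by apply: cvg_expr; rewrite ger0_norm ?invr_ge0//; lra.
  by move=> n; rewrite subr0; exact: passage_series_dist.
move=> /(climZ (1 - x)^-1); rewrite mulrC; apply: eq_clim => n.
by rewrite mulKf.
Qed.

End Passage.

(** * Geometric summation and identification of the functional *)

Lemma clim_geometric {R : realType} (g : R[i]) (r : R) : normc g <= r -> r < 1 ->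
  clim (fun n => \sum_(m < n) g ^+ m) (1 - g)^-1.
Proof.
move=> gr r1; have g1 : 1 - g != 0.
  apply: contraTneq (le_lt_trans gr r1) => /eqP; rewrite subr_eq0 => /eqP <-.
  by rewrite normc1' ltxx.
have gE n : \sum_(m < n) g ^+ m = (1 - g)^-1 * (1 - g ^+ n).
  by apply: (mulfI g1); rewrite mulrA divff// mul1r -[RHS]opprB subrX1; ring.
have r0 := le_trans (normc_ge0 g) gr.
apply: (clim_bound (e := fun n => normc (1 - g)^-1 * r ^+ n)) => [|n].
  rewrite -[0](mulr0 (normc (1 - g)^-1)); apply: cvgM; first exact: cvg_cst.
  by apply: cvg_expr; rewrite ger0_norm.
rewrite gE (_ : _ - _ = (1 - g)^-1 * - g ^+ n); last by ring.
by rewrite Normc.normcM normcN normcX ler_wpM2l ?normc_ge0// lerXn2r ?nnegrE ?normc_ge0.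
Qed.

Theorem corollary2p6 (R : realType) (d : measure_display) (T : measurableType d)
  (P : probability T R)
  (lam : R) (hlam : 0 < lam)
  (t : nat -> {RV P >-> R})
  (n : nat -> {RV P >-> nat})
  (wt : nat -> nat -> {RV P >-> R})
  (ht : poisson_process lam t)
  (hn1 : forall k w, (1 <= n k w)%N)
  (hniid : iid n)
  (hwt0 : forall j k w, 0 <= wt j k w)
  (hwtiid : iid (fun jk : nat * nat => wt jk.1 jk.2))
  (hattack : mutually_independent P
     (tnth [tuple sigma_of t; sigma_of n;
                  sigma_of (fun jk : nat * nat => wt jk.1 jk.2)]))
  (Delta : nat -> {RV P >-> R})
  (hD0 : forall m w, 0 <= Delta m w)
  (hDiid : iid (fun m => Delta m.+1))
  (hDnz : ~ {ae P, forall w, Delta 1%N w = 0})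
  (hDindep : independent P (sigma_of (fun _ : unit => Delta 0%N))
                           (sigma_of (fun m => Delta m.+1)))
  (hobs : independent P (sigma_of Delta)
     <<s sigma_of t `|` sigma_of n
         `|` sigma_of (fun jk : nat * nat => wt jk.1 jk.2) >>)
  (M : nat) (hM : (0 < M)%N) (V : R) (hV : 0 < V)
  (alpha0 alpha beta0 beta h0 h : R[i])
  (halpha0 : `|alpha0| <= 1) (halpha : `|alpha| <= 1)
  (hbeta0 : 0 <= complex.Re beta0) (hbeta : 0 <= complex.Re beta)
  (hh0 : 0 <= complex.Re h0) (hh : 0 <= complex.Re h) :
  let tau := obs_time Delta in
  let N := cum_nodes t n Delta in
  let W := cum_weight t n wt Delta in
  let mu := fun w => inf_index [set m | (M < N m w)%N] : \bar R in
  let nu := fun w => inf_index [set m | V < W m w] : \bar R in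
  let rho := fun w => Order.min (mu w) (nu w) in
  let gamma0 := increment_transform lam (n 0%N) (wt 0%N 0%N) (Delta 0%N) in
  let gamma := increment_transform lam (n 0%N) (wt 0%N 0%N) (Delta 1%N) in
  cexpectation P (fun w => at_index (rho w) (fun r =>
      alpha0 ^+ before N r w * alpha ^+ N r w
      * cexp (- (beta0 * (before W r w)%:C) - beta * (W r w)%:C)
      * cexp (- (h0 * (before tau r w)%:C) - h * (tau r w)%:C)))
  = Dinv (fun x y =>
      let ga := gamma (alpha0 * alpha * x) (beta0 + beta + y) (h0 + h) in
      let ga0 := gamma0 (alpha0 * alpha * x) (beta0 + beta + y) (h0 + h) in
      let Ga := gamma (alpha * x) (beta + y) h in
      let Ga0 := gamma0 (alpha * x) (beta + y) h in
      let zeta := gamma alpha beta h in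
      let zeta0 := gamma0 alpha beta h in
      zeta0 - Ga0 + ga0 / (1 - ga) * (zeta - Ga)) M V.
Proof.
move=> tau N W mu nu rho gamma0 gamma.
rewrite normc_le1 in halpha0; rewrite normc_le1 in halpha.
pose N' := reg_nodes t n Delta.
pose W' := reg_weight t n wt Delta.
pose term := first_passage_term t n wt Delta.
pose c := term alpha0 alpha beta0 beta h0 h.
pose F x y :=
  let ga := gamma (alpha0 * alpha * x) (beta0 + beta + y) (h0 + h) in
  let ga0 := gamma0 (alpha0 * alpha * x) (beta0 + beta + y) (h0 + h) in
  let Ga := gamma (alpha * x) (beta + y) h in
  let Ga0 := gamma0 (alpha * x) (beta + y) h in
  gamma0 alpha beta h - Ga0 + ga0 / (1 - ga) * (gamma alpha beta h - Ga).
have lhsE : cexpectation P (fun w => at_index (rho w) (fun r =>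
      alpha0 ^+ before N r w * alpha ^+ N r w
      * cexp (- (beta0 * (before W r w)%:C) - beta * (W r w)%:C)
      * cexp (- (h0 * (before tau r w)%:C) - h * (tau r w)%:C)))
    = passage_mean P N' W' c M V.
  apply: (cexpectation_eq_off_null (N := ~` [set w | regular_times t w])).
  - by apply: measurableC; exact: measurable_regular_times.
  - exact: (regular_times_ae hlam ht).
  move=> w /= /contrapT rw.
  have NE m : N m w = N' m w by rewrite /N' (reg_nodesE n ht hD0).
  have WE m : W m w = W' m w by rewrite /W' (reg_weightE n wt ht hD0).
  rewrite /passage /rho /mu /nu.
  have -> : [set m | (M < N m w)%N] = [set m | (M < N' m w)%N].
    by apply/seteqP; split => m /=; rewrite NE.
  have -> : [set m | V < W m w] = [set m | V < W' m w].
    by apply/seteqP; split => m /=; rewrite WE.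
  congr at_index; apply/funext => m; rewrite /c /term /first_passage_term -/N' -/W' NE WE.
  by case: m => [|m]/=; rewrite ?NE ?WE.
rewrite lhsE /Dinv /LCinv /inverse_laplace -/(F _ _).
pose G y := Dop M (F ^~ y) / y.
(* [inverse_laplace] selects some function with the required transform: exhibiting one makes the
   selection valid, and uniqueness identifies its value at [V]. *)
suff inv : is_inverse_laplace G (passage_mean P N' W' c M).
  have inv' := xgetPex (fun=> 0) (ex_intro _ _ inv).
  exact: (laplace_unique inv inv' (ltW hV)).
have r1 := decay_rate_lt1 hlam hD0 hDnz.
apply: (passage_inverse_laplace (r := decay_rate lam Delta)) => //.
- by move=> m; exact: measurable_reg_nodes.
- by move=> m; exact: measurable_reg_weight.
- by move=> m; exact: cmeasurable_first_passage_term.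
- by move=> m w; exact: (reg_nodes_homo n ht hD0).
- by move=> m w; exact: (reg_weight_homo n ht hwt0 hD0).
- by move=> m w; exact: reg_weight_ge0.
- by move=> m w; exact: normc_first_passage_term_le1.
- exact: decay_rate_ge0.
- by move=> p m; exact: (tail_reg_nodes hlam ht hn1 hniid hwt0 hwtiid hattack hD0 hDiid hDindep hobs).
move=> x y x4 y0.
have x1 : normc x <= 1 by apply: le_trans x4 _; lra.
have rb0 : 0 <= complex.Re (beta0 + y) by rewrite ReD addr_ge0// ltW.
have rb : 0 <= complex.Re (beta + y) by rewrite ReD addr_ge0// ltW.
have na0 : normc (alpha0 * x) <= 1 by rewrite Normc.normcM mulr_ile1 ?normc_ge0.
have na : normc (alpha * x) <= 1 by rewrite Normc.normcM mulr_ile1 ?normc_ge0.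
(* In [u] the weight $x^N e^{-yW}$ is taken at index $m-1$ and is absorbed by [alpha0] and [beta0];
   in [l] it is taken at index $m$ and is absorbed by [alpha] and [beta]. *)
pose u m := term (alpha0 * x) alpha (beta0 + y) beta h0 h m.
pose l m := term alpha0 (alpha * x) beta0 (beta + y) h0 h m.
have bu m : cbounded (u m).
  apply: cbounded_le1 => [|w]; first exact: cmeasurable_first_passage_term.
  exact: normc_first_passage_term_le1.
have bl m : cbounded (l m).
  apply: cbounded_le1 => [|w]; first exact: cmeasurable_first_passage_term.
  exact: normc_first_passage_term_le1.
have powerE k : cexpectation P (power_sum N' W' c y x k)
    = \sum_(m < k) (cexpectation P (u m) - cexpectation P (l m)).
  transitivity (cexpectation P (fun w => \sum_(m < k) (u m w - l m w))).
    apply: eq_cexpectation => w; apply: eq_bigr => m _.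
    rewrite /c /u /l /term /first_passage_term -/N' -/W' mulrBr !exprMn !mulrDl !opprD !cexpD.
    congr (_ - _);
      move: (alpha0 ^+ _) (alpha ^+ _) (x ^+ _) (cexp (- (beta0 * _))) (cexp (- (beta * _)))
        (cexp (- (h0 * _))) (cexp (- (h * _))) (cexp (- (y * _))) => *; ring.
  rewrite cexpectation_sum => [|m]; last exact: cboundedB.
  by apply: eq_bigr => m _; rewrite cexpectationB.
have transform a z b v m := @first_passage_transform _ _ _ _ _ _ _ _ hlam ht hn1 hniid hwt0 hwtiid
  hattack _ hD0 hDiid hDindep hobs a z b v h0 h m.
pose ga := gamma (alpha0 * alpha * x) (beta0 + beta + y) (h0 + h).
pose ga0 := gamma0 (alpha0 * alpha * x) (beta0 + beta + y) (h0 + h).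
have uE m : cexpectation P (u m)
    = if m is m'.+1 then ga0 * ga ^+ m' * gamma alpha beta h else gamma0 alpha beta h.
  have e1 : alpha0 * alpha * x = alpha0 * x * alpha by rewrite mulrAC.
  have e2 : beta0 + beta + y = beta0 + y + beta by rewrite addrAC.
  by rewrite /ga /ga0 e1 e2; exact: (transform _ _ _ _ _ na0 halpha rb0 hbeta hh0 hh).
have lE m : cexpectation P (l m)
    = if m is m'.+1 then ga0 * ga ^+ m' * gamma (alpha * x) (beta + y) h
      else gamma0 (alpha * x) (beta + y) h.
  have e1 : alpha0 * alpha * x = alpha0 * (alpha * x) by rewrite mulrA.
  have e2 : beta0 + beta + y = beta0 + (beta + y) by rewrite addrA.
  by rewrite /ga /ga0 e1 e2; exact: (transform _ _ _ _ _ halpha0 na hbeta0 rb hh0 hh).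
have gr : normc ga <= decay_rate lam Delta.
  apply: normc_increment_transform_decay => //; last by rewrite ReD addr_ge0.
    rewrite !Normc.normcM -[leRHS]mul1r; apply: ler_pM; rewrite ?mulr_ge0 ?normc_ge0//.
      by rewrite mulr_ile1 ?normc_ge0.
    by apply: le_trans x4 _; lra.
  by rewrite !ReD !addr_ge0// ltW.
(* Index 0 contributes $\zeta_0^1-\Gamma_0$ on its own, and index $m+1$ contributes
   $\gamma_0\gamma^m(\zeta^1-\Gamma)$. *)
apply: (eq_clim (u := fun k => (gamma0 alpha beta h - gamma0 (alpha * x) (beta + y) h)
   + (ga0 * (gamma alpha beta h - gamma (alpha * x) (beta + y) h)) * (\sum_(m < k) ga ^+ m))).
  move=> k; rewrite powerE big_ord_recl uE lE/=; congr (_ + _).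
  rewrite mulr_sumr; apply: eq_bigr => m _; rewrite uE lE /=.
  by rewrite -mulrBr mulrAC.
rewrite /F /= -/ga -/ga0 mulrAC.
by apply: climD; [exact: clim_cst|apply: climZ; exact: clim_geometric gr r1].
Qed.
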